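(* Fix $\rho\in(0,1)$ and a real number $\lambda$ (free of $n$) with $|\lambda|\le\rho$. For each $n$ let $\boldsymbol\sigma$ be drawn, given $c=(c_1,\dots,c_n)^\top$, from the quadratic interaction model with coupling matrix $A_n$, field vector $c$, and common base measure $\mu$, where $c_1,\dots,c_n$ are i.i.d. from a distribution $F$ on $\mathbb R$ with $\mathbb E_F\psi'(c_1)=0$. Assume $\|A_n\|_4\le\rho$ and let $q\in\mathbb R^n$ be a deterministic vector with $\|q\|=1$. Set $\upsilon=\mathbb E_F\psi''(c_1)>0$, $\boldsymbol\epsilon=A_nq-\lambda q$ and $$\mathrm{Err}(A_n,q)=\sqrt{\alpha_n}+\sqrt n\,\alpha_n+\|\boldsymbol\epsilon\|+\|q\|_\infty.$$ Let $W_\infty\sim N\big(0,\frac{\upsilon}{1-\lambda\upsilon}\big)$ and $\widetilde W_\infty\sim N\big(0,\frac{\mathbb E_F[\psi'(c_1)^2]}{(1-\lambda\upsilon)^2}\big)$ be independent. (a) We have $$d_{KS}\Big(\sum_{i=1}^nq_i(\sigma_i-u_i),\,W_\infty\,\Big|\,c\Big)=O_P\big(\mathrm{Err}(A_n,q)\big).$$ (b) We have $$d_{KS}\Big(\sum_{i=1}^nq_i\Big(\sigma_i-\frac{\psi'(c_i)}{1-\lambda\upsilon}\Big),\,W_\infty\,\Big|\,c\Big)=O_P\big(\mathrm{Err}(A_n,q)+\sqrt{n\alpha_n}\,\|\boldsymbol\epsilon\|\big),$$ $$d_{KS}\Big(\sum_{i=1}^nq_i\sigma_i,\;W_\infty+\widetilde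 W_\infty\Big)=O\big(\mathrm{Err}(A_n,q)+\sqrt{n\alpha_n}\,\|\boldsymbol\epsilon\|\big).$$ In both parts the implicit constants depend only on $\rho$ and $\upsilon$.
   Context: Model: $\mu$ is a fixed non-degenerate probability measure supported on $[-1,1]$ with both $-1$ and $1$ in its support; $A_n$ is a (deterministic) real symmetric $n\times n$ matrix with zero diagonal. Given $c$, $\boldsymbol\sigma$ has the law on $[-1,1]^n$ with density, with respect to $\mu^{\otimes n}$, $$\frac1{Z_n}\exp\Big(\tfrac12\boldsymbol\sigma^\top A_n\boldsymbol\sigma+c^\top\boldsymbol\sigma\Big).$$ $\mathbb E_F$ denotes expectation over $c$. Norms: $\|\cdot\|,\|\cdot\|_\infty$ are the $\ell_2$ and $\ell_\infty$ norms of vectors; $\|A_n\|_4$ is the $\ell_4\to\ell_4$ operator norm. $\alpha_n=\max_{1\le i\le n}\sum_{j=1}^nA_n(i,j)^2$. $d_{KS}(X,Y)=\sup_{t}|P(X\le t)-P(Y\le t)|$; $d_{KS}(X,Y\mid c)$ is the Kolmogorov–Smirnov distance between the conditional law of $X$ given $c$ and the (unconditional) law of $Y$, where $Y$ is independent of $c$; it is a random variable (function of $c$), and $O_P$ refers to the randomness of $c$ as $n\to\infty$. The last display in (b) is unconditional (averaged over $c$). Mean-Field optimizer: $\psi(\theta)=\log\int e^{\theta z}\,d\mu(z)$; $\phi:(-1,1)\to\mathbb R$ is the inverse of $\psi':\mathbb R\to(-1,1)$; $I(z)=z\phi(z)-\psi(\phi(z))$ (extended to $z=\pm1$ by its limits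 in $[0,\infty]$). When $\|A_n\|<1$ in $\ell_2$ operator norm (in particular when $\|A_n\|_4<1$), the function $z\mapsto\frac12z^\top A_nz+z^\top c-\sum_iI(z_i)$ on $[-1,1]^n$ has a unique maximizer $u=u(A_n,c)\in(-1,1)^n$, which satisfies $u_i=\psi'\big(\sum_jA_n(i,j)u_j+c_i\big)$. *)

(* Defs.v *)
From HB Require Import structures.
From mathcomp Require Import all_boot all_order all_algebra.
From mathcomp Require Import all_classical all_reals all_analysis.

Set Implicit Arguments.
Unset Strict Implicit.
Unset Printing Implicit Defensive.

Import Order.TTheory GRing.Theory Num.Theory.
Import numFieldNormedType.Exports.

Local Open Scope classical_set_scope.
Local Open Scope ring_scope.

Definition tcons (R : realType) n (p : measurableTypeR R * n.-tuple (measurableTypeR R)) :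
  n.+1.-tuple (measurableTypeR R) := [tuple of p.1 :: p.2].

Lemma measurable_tcons (R : realType) n : measurable_fun setT (@tcons R n).
Proof. exact: measurable_cons. Qed.

HB.instance Definition _ (R : realType) n :=
  isMeasurableFun.Build _ _ _ _ (@tcons R n) (@measurable_tcons R n).

(* The law of n independent draws from P, i.e. the n-fold product of P. *)
Fixpoint iid (R : realType) (P : probability (measurableTypeR R) R) (n : nat) :
  probability (n.-tuple (measurableTypeR R)) R :=
  if n is m.+1 then distribution (P \x iid P m)%E (@tcons R m)
  else \d_([tuple] : 0.-tuple (measurableTypeR R)).

Section vectors.
Variables (R : realType) (n : nat).
Implicit Types (x y : 'cV[R]_n) (A : 'M[R]_n).

Definition dot x y : R := \sum_(i < n) x i 0 * y i 0.
Definition l2norm x : R := Num.sqrt (\sum_(i < n) x i 0 ^+ 2).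
Definition l4norm x : R := (\sum_(i < n) x i 0 ^+ 4) `^ (4^-1).
Definition linfnorm x : R := \big[Num.max/0]_(i < n) `|x i 0|.

Definition opnorm4 A : R := sup [set l4norm (A *m x) | x in [set x | l4norm x <= 1]].

Definition alpha A : R := \big[Num.max/0]_(i < n) \sum_(j < n) A i j ^+ 2.

Definition coupling A : Prop := A^T = A /\ forall i, A i i = 0.

Definition colv (s : n.-tuple (measurableTypeR R)) : 'cV[R]_n := \col_i tnth s i.

End vectors.

Section base_measure.
Variable (R : realType).
Variable mu : probability (measurableTypeR R) R.

Definition in_support (x : R) : Prop :=
  forall U : set R, open U -> U x -> (0 < mu U)%E.

Definition base_measure : Prop :=
  [/\ mu [set` `[-1, 1]] = 1%E, forall a : R, mu [set a] != 1%E,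
      in_support (-1) & in_support 1].

Definition psi (t : R) : R := ln (\int[mu]_z expR (t * z)).
Definition psi1 : R -> R := psi^`()%classic.
Definition psi2 : R -> R := psi^`(2)%classic.

Definition phi (z : R) : R := xget 0 [set t | psi1 t = z].

Definition rate0 (z : R) : R := z * phi z - psi (phi z).
Definition rate (z : R) : \bar R :=
  if z == 1 then lim ((rate0 w)%:E @[w --> 1^'-])
  else if z == -1 then lim ((rate0 w)%:E @[w --> (-1)^'+])
  else (rate0 z)%:E.

End base_measure.

Section model.
Variables (R : realType) (n : nat).
Variable mu : probability (measurableTypeR R) R.
Variable A : 'M[R]_n.
Implicit Types (c s : n.-tuple (measurableTypeR R)) (x z : 'cV[R]_n).

Definition hamiltonian c x : R := dot x (A *m x) / 2 + dot (colv c) x.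

Definition partition_function c : R :=
  \int[iid mu n]_s expR (hamiltonian c (colv s)).

(* The law of sigma given c; mu is carried by [-1, 1], so this law lives on
   the cube even though it is written on the whole space. *)
Definition gibbs c (B : set (n.-tuple (measurableTypeR R))) : \bar R :=
  (\int[iid mu n]_(s in B)
     (expR (hamiltonian c (colv s)) / partition_function c)%:E)%E.

Definition cond_law c (X : 'cV[R]_n -> R) (B : set R) : \bar R :=
  gibbs c [set s | B (X (colv s))].

Definition averaged_law (F : probability (measurableTypeR R) R)
    (X : 'cV[R]_n -> R) (B : set R) : \bar R :=
  (\int[iid F n]_c cond_law c X B)%E.

Definition cube : set 'cV[R]_n := [set z | forall i, -1 <= z i 0 <= 1].

Definition mf_objective c z : \bar R :=
  ((hamiltonian c z)%:E - \sum_(i < n) rate mu (z i 0%R))%E.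

Definition mf_opt c : 'cV[R]_n :=
  xget 0 [set z | cube z /\
                  forall w, cube w -> (mf_objective c w <= mf_objective c z)%E].

End model.

(* Centred Gaussian law with variance v.  The degenerate case needs a separate
   clause since normal_prob 0 0 is the uniform law on [0, 1]. *)
Definition gauss (R : realType) (v : R) : probability (measurableTypeR R) R :=
  if v == 0 then [the probability _ R of \d_(0 : measurableTypeR R)]
  else [the probability _ R of normal_prob 0 (Num.sqrt v)].

(* The law of the sum of independent variables with laws P and Q. *)
Definition convolution (R : realType) (P Q : probability (measurableTypeR R) R)
    (B : set R) : \bar R :=
  (P \x Q)%E [set p | B (p.1 + p.2)].

Definition dKS (R : realType) (P Q : set R -> \bar R) : R :=
  sup [set `|fine (P [set` `]-oo, t]]) - fine (Q [set` `]-oo, t]])| | t in [set: R]].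

Definition Err (R : realType) n (A : 'M[R]_n) (lambda : R) (q : 'cV[R]_n) : R :=
  Num.sqrt (alpha A) + Num.sqrt n%:R * alpha A
  + l2norm (A *m q - lambda *: q) + linfnorm q.

(* X = O_P(r) with explicit tail constants.  Applied at every n with the same C,
   this is tightness of the sequence X_n / r_n, uniformly in all data on which
   C does not depend. *)
Definition OP_with d (T : measurableType d) (R : realType) (P : probability T R)
    (C : R -> R) (X : T -> R) (r : R) : Prop :=
  forall delta : R, 0 < delta ->
    (P [set c | (C delta * r < `|X c|)%R] <= delta%:E)%E.

(* Main.v *)
(* Given c, the pair (sigma, sigma with one coordinate resampled from its
   conditional law) is exchangeable. Stein's method applied to
   T = sum_i q_i (sigma_i - u_i) needs three facts. (1) The conditional means
   E[sigma_i | rest] = psi'((A sigma)_i + c_i), linearised at u, give the drift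
   -(1 - lambda upsilon) T up to A-weighted remainders; these are small because
   fourth moments of A(sigma - u) are bounded via the l4 contraction and second
   moments of linear forms via the l2 contraction it implies. (2) The conditional
   variance sum_i q_i^2 psi''(..) is upsilon up to fluctuations. (3) The
   discontinuity of the Stein solution is absorbed by an antisymmetric kernel.
   The resulting bound is err + Q(c)/err, where Q(c) is a sum of squares of
   centred functions of the i.i.d. field with E_F Q <= C err^2, and Markov's
   inequality gives (a). For (b), the fixed-point equation expands
   (1 - lambda upsilon) q'u = q'psi'(c) + upsilon eps'u + (small), so the shift
   between the two centrings is O(err') in L1. Averaging over c and replacing
   the psi'(c_i) by Gaussians one at a time (Lindeberg) gives the last claim. *)

Require Import Defs.
From HB Require Import structures.
From mathcomp Require Import all_boot all_order all_algebra.
From mathcomp Require Import all_classical all_reals all_analysis.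
From mathcomp Require Import measurable_realfun ring lra.

Set Implicit Arguments.
Unset Strict Implicit.
Unset Printing Implicit Defensive.

Import Order.TTheory GRing.Theory Num.Theory.
Import numFieldNormedType.Exports.

Local Open Scope classical_set_scope.
Local Open Scope ring_scope.

(** * Bounded measurable functions and weighted expectations *)

(** At a fixed field everything is proved at one scale r dominating the four summands of [Err]. The
    summand sqrt n * alpha appears because q is controlled in l2 only: with w = A (sigma - u), the
    quadratic remainder obeys sum |q_i| w_i^2 <= r sum q_i^2 + r^-1 sum w_i^4, and the last sum has
    expectation of order n * alpha^2. This is what the l4 contraction is for. No functional
    inequality for the Gibbs measure is used: a linear form in the residuals sigma_i -
    E[sigma_i | rest] is compared with its copy in which spin j is set to 0, to which the j-th
    residual is orthogonal. The same abstract moment bounds serve the i.i.d. field. Square roots of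
    moments are avoided by |y| <= y^2 / r + r, which turns a second moment of order r^2 into a first
    moment of order r; this is also how Q(c)/err arises. In the averaged claim the Gaussian W_infty
    already smooths the indicator, so the replacement acts directly on its cdf. Constants see only
    rho and upsilon because 1 - lambda upsilon lies between 1 - rho and 2. *)

Definition BM d (T : measurableType d) (R : realType) (f : T -> R) : Prop :=
  measurable_fun [set: T] f /\ exists M, forall x, `|f x| <= M.

Section BM.
Context d (T : measurableType d) (R : realType).
Implicit Types f g : T -> R.

Lemma BM_cst (r : R) : BM (fun _ : T => r).
Proof. by split; [exact: measurable_cst | exists `|r|]. Qed.

Lemma BMD f g : BM f -> BM g -> BM (fun x => f x + g x).
Proof.
move=> [mf [M fM]] [mg [N gN]]; split; first exact: measurable_funD.
by exists (M + N) => x; rewrite (le_trans (ler_normD _ _))// lerD.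
Qed.

Lemma BMN f : BM f -> BM (fun x => - f x).
Proof.
move=> [mf [M fM]]; split; first exact: measurableT_comp.
by exists M => x; rewrite normrN.
Qed.

Lemma BMB f g : BM f -> BM g -> BM (fun x => f x - g x).
Proof. by move=> hf hg; apply: BMD => //; exact: BMN. Qed.

Lemma BMM f g : BM f -> BM g -> BM (fun x => f x * g x).
Proof.
move=> [mf [M fM]] [mg [N gN]]; split; first exact: measurable_funM.
by exists (M * N) => x; rewrite normrM ler_pM.
Qed.

Lemma BMX f k : BM f -> BM (fun x => f x ^+ k).
Proof.
move=> [mf [M fM]]; split; first exact: measurable_funX.
by exists (M ^+ k) => x; rewrite normrX lerXn2r ?nnegrE ?(le_trans _ (fM x)).
Qed.

Lemma BM_norm f : BM f -> BM (fun x => `|f x|).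
Proof.
move=> [mf [M fM]]; split; first exact: measurableT_comp.
by exists M => x; rewrite normr_id.
Qed.

Lemma BM_sum (I : Type) (r : seq I) (Q : pred I) (F : I -> T -> R) :
  (forall i, BM (F i)) -> BM (fun x => \sum_(i <- r | Q i) F i x).
Proof.
move=> FB; elim: r => [|i r IH].
  by under eq_fun do rewrite big_nil; exact: BM_cst.
under eq_fun do rewrite big_cons.
by case: (Q i) => //; exact: BMD.
Qed.

Lemma BM_comp (h : R -> R) f : continuous h -> BM f -> BM (fun x => h (f x)).
Proof.
move=> ch [mf [M fM]]; split.
  by apply: measurableT_comp => //; exact: continuous_measurable_fun.
(* On an empty [T] the bound [M] may be negative and the interval empty, so the extreme value
   theorem needs a point of [T]. *)
have [[x0 _]|nx] := pselect (exists x : T, True); last first.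
  by exists 0 => x; exfalso; apply: nx; exists x.
have MM : - M <= M by have := le_trans (normr_ge0 _) (fM x0); lra.
have cw : {within `[- M, M], continuous h} by apply: continuous_subspaceT.
have [a _ ha] := EVT_max MM cw.
have [b _ hb] := EVT_min MM cw.
exists (`|h a| + `|h b|) => x.
have xM : f x \in `[- M, M] by rewrite in_itv/= -ler_norml.
rewrite ler_norml; apply/andP; split.
  by have := hb _ xM; have := ler_norm (- h b); have := normr_ge0 (h a); rewrite normrN; lra.
by have := ha _ xM; have := ler_norm (h a); have := normr_ge0 (h b); lra.
Qed.

Lemma BM_le f (t : R) : measurable_fun setT f -> BM (fun x => (f x <= t)%R%:R : R).
Proof.
move=> mf; split; last first.
  by exists 1 => x; case: (f x <= t) => /=; rewrite ?mulr1n ?mulr0n ?normr1 ?normr0.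
have -> : (fun x => (f x <= t)%R%:R : R) = \1_[set x | f x <= t].
  by apply/funext => x; rewrite indicE mem_setE.
apply: measurable_indic.
have := @measurable_fun_ler _ _ _ setT _ _ mf (measurable_cst t) measurableT [set true].
by rewrite setTI preimage_true; exact.
Qed.

Lemma BM_integrable (P : probability T R) f : BM f -> P.-integrable setT (EFin \o f).
Proof.
move=> [mf [M fM]]; apply: (@measurable_bounded_integrable _ _ _ P) => //.
  by apply: (le_lt_trans (probability_le1 P measurableT)); rewrite ltry.
exists M; split; first exact: num_real.
by move=> x Mx y _ /=; apply: le_trans (fM y) _; exact: ltW.
Qed.

End BM.

(** A bounded density with respect to [P]. One notion covers the Gibbs law, the exponential tilts of
    [mu] and, with weight 1, plain expectation over the field. *)
Definition weight d (T : measurableType d) (R : realType) (P : probability T R)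
    (w : T -> R) : Prop :=
  [/\ BM w, forall x, 0 <= w x & \int[P]_x w x = 1].

Definition Ex d (T : measurableType d) (R : realType) (P : probability T R)
  (w f : T -> R) : R := \int[P]_x (w x * f x).

Section Ex.
Context d (T : measurableType d) (R : realType) (P : probability T R).
Variables (w : T -> R) (hw : weight P w).
Implicit Types f g : T -> R.

Let BMw : BM w. Proof. by case: hw. Qed.
Let w0 x : 0 <= w x. Proof. by case: hw. Qed.

Lemma weight1 : weight P (fun _ => 1).
Proof.
split=> //; first exact: BM_cst.
by rewrite Rintegral_cst// mul1r; exact: (congr1 fine (probability_setT P)).
Qed.

Lemma Ex_cst r : Ex P w (fun _ => r) = r.
Proof.
rewrite /Ex RintegralZr//; last exact: BM_integrable.
by case: hw => _ _ ->; rewrite mul1r.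
Qed.

Lemma ExD f g : BM f -> BM g -> Ex P w (fun x => f x + g x) = Ex P w f + Ex P w g.
Proof.
move=> hf hg; rewrite /Ex -RintegralD//; [|exact: BM_integrable (BMM _ _)..].
by apply: eq_Rintegral => x _; rewrite mulrDr.
Qed.

Lemma ExZ r f : BM f -> Ex P w (fun x => r * f x) = r * Ex P w f.
Proof.
move=> hf; rewrite /Ex -RintegralZl//; last exact: BM_integrable (BMM _ _).
by apply: eq_Rintegral => x _; rewrite mulrCA.
Qed.

Lemma ExZr r f : BM f -> Ex P w (fun x => f x * r) = Ex P w f * r.
Proof.
by move=> hf; under [LHS]eq_Rintegral do rewrite (mulrC (f _)); rewrite mulrC -ExZ.
Qed.

Lemma ExN f : BM f -> Ex P w (fun x => - f x) = - Ex P w f.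
Proof.
move=> hf; rewrite -mulN1r -ExZ//.
by apply: eq_Rintegral => x _; rewrite mulN1r.
Qed.

Lemma ExB f g : BM f -> BM g -> Ex P w (fun x => f x - g x) = Ex P w f - Ex P w g.
Proof. by move=> hf hg; rewrite ExD ?ExN//; exact: BMN. Qed.

Lemma Ex_sum (I : Type) (r : seq I) (Q : pred I) (F : I -> T -> R) :
  (forall i, BM (F i)) ->
  Ex P w (fun x => \sum_(i <- r | Q i) F i x) = \sum_(i <- r | Q i) Ex P w (F i).
Proof.
move=> FB; elim: r => [|i r IH].
  under [LHS]eq_Rintegral do rewrite big_nil.
  by rewrite big_nil; exact: Ex_cst.
under [LHS]eq_Rintegral do rewrite big_cons.
rewrite big_cons; case: (Q i) => //.
by rewrite -IH -ExD//; exact: BM_sum.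
Qed.

Lemma Ex_le f g : BM f -> BM g -> (forall x, f x <= g x) -> Ex P w f <= Ex P w g.
Proof.
move=> hf hg fg; apply: le_Rintegral => //; [exact: BM_integrable (BMM _ _)..|].
by move=> x _; rewrite ler_wpM2l.
Qed.

Lemma Ex_ge0 f : (forall x, 0 <= f x) -> 0 <= Ex P w f.
Proof. by move=> f0; apply: Rintegral_ge0 => x _; rewrite mulr_ge0. Qed.

Lemma Ex_norm f : BM f -> `|Ex P w f| <= Ex P w (fun x => `|f x|).
Proof.
move=> hf; apply: le_trans (le_normr_Rintegral _ _) _ => //.
  exact: BM_integrable (BMM _ _).
rewrite le_eqVlt; apply/orP; left; apply/eqP; apply: eq_Rintegral => x _.
by rewrite normrM ger0_norm.
Qed.

Lemma Ex_le_cst f r : BM f -> (forall x, f x <= r) -> Ex P w f <= r.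
Proof. by move=> hf fr; rewrite -[leRHS]Ex_cst; apply: Ex_le => //; exact: BM_cst. Qed.

Lemma Ex_ge_cst f r : BM f -> (forall x, r <= f x) -> r <= Ex P w f.
Proof. by move=> hf fr; rewrite -[leLHS]Ex_cst; apply: Ex_le => //; exact: BM_cst. Qed.

Lemma Ex_norm_le f r : BM f -> (forall x, `|f x| <= r) -> `|Ex P w f| <= r.
Proof.
by move=> hf fr; apply: le_trans (Ex_norm hf) _; apply: Ex_le_cst => //; exact: BM_norm.
Qed.

End Ex.

Lemma eq_Ex d (T : measurableType d) (R : realType) (P : probability T R)
  (w f g : T -> R) : f =1 g -> Ex P w f = Ex P w g.
Proof. by move=> fg; apply: eq_Rintegral => x _; rewrite fg. Qed.

Ltac BM := repeat first
  [ solve [trivial]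
  | exact: BM_cst
  | apply: BMD | apply: BMN | apply: BMM | apply: BMX | apply: BM_norm
  | apply: BM_sum => ? ].

(** * Resampling a coordinate of a product measure *)

Section fubini_real.
Context d1 d2 (T1 : measurableType d1) (T2 : measurableType d2) (R : realType).
Variables (P : probability T1 R) (Q : probability T2 R).

Lemma BM_curry (k : T1 * T2 -> R) x : BM k -> BM (fun y => k (x, y)).
Proof.
move=> [mk [M kM]]; split; last by exists M => y.
exact: (measurableT_comp mk (measurable_pair1 x)).
Qed.

Lemma BM_Rintegral (k : T1 * T2 -> R) :
  BM k -> BM (fun x => \int[Q]_y k (x, y)).
Proof.
move=> Bk; have ik := BM_integrable (P \x Q)%E Bk.
have Bx x : BM (fun y => k (x, y)) by exact: BM_curry.
split.
  have mF := measurable_fubini_F ik.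
  exact: (measurableT_comp (fine_measurable measurableT) mF).
case: Bk => _ [M kM]; exists M => x; rewrite ler_norml.
have h := @le_Rintegral _ _ _ Q setT.
have c r : \int[Q]_y (cst r y) = r.
  by rewrite Rintegral_cst// -[RHS]mulr1; congr (_ * _); exact: (congr1 fine (probability_setT Q)).
apply/andP; split.
  rewrite -[leLHS]c; apply: h => //; [exact: BM_integrable (BM_cst _ _)|exact: BM_integrable|].
  by move=> y _; have := kM (x, y); rewrite ler_norml => /andP[].
rewrite -[leRHS]c; apply: h => //; [exact: BM_integrable|exact: BM_integrable (BM_cst _ _)|].
by move=> y _; have := kM (x, y); rewrite ler_norml => /andP[].
Qed.

Lemma Rintegral_fineK (f : T2 -> R) : BM f ->
  (\int[Q]_y f y)%:E = (\int[Q]_y (f y)%:E)%E.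
Proof. by move=> Bf; rewrite /Rintegral fineK//; exact: integrable_fin_num (BM_integrable Q Bf). Qed.

End fubini_real.

Lemma Rintegral_swap d1 d2 (T1 : measurableType d1) (T2 : measurableType d2)
  (R : realType) (P : probability T1 R) (Q : probability T2 R) (k : T1 * T2 -> R) :
  BM k ->
  \int[P]_x \int[Q]_y k (x, y) = \int[Q]_y \int[P]_x k (x, y).
Proof.
move=> Bk; have ik := BM_integrable (P \x Q)%E Bk.
have := Fubini ik.
rewrite [X in X = _ -> _](_ : _ = (\int[P]_x (\int[Q]_y k (x, y))%:E)%E); last first.
  by apply: eq_integral => x _; rewrite Rintegral_fineK//; exact: BM_curry.
rewrite [X in _ = X -> _](_ : _ = (\int[Q]_y (\int[P]_x k (x, y))%:E)%E); last first.
  apply: eq_integral => y _; rewrite Rintegral_fineK//.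
  case: Bk => mk [M kM]; split; last by exists M => x.
  exact: (measurableT_comp mk (measurable_pair2 y)).
by move/(congr1 fine).
Qed.

Section resampling.
Context (R : realType) (P : probability (measurableTypeR R) R).
Local Notation RR := (measurableTypeR R).

Definition upd n (s : n.-tuple RR) (i : 'I_n) (z : RR) : n.-tuple RR :=
  [tuple if j == i then z else tnth s j | j < n].

Lemma tnth_upd n (s : n.-tuple RR) i z j :
  tnth (upd s i z) j = if j == i then z else tnth s j.
Proof. by rewrite tnth_mktuple. Qed.

Lemma upd_upd n (s : n.-tuple RR) i y z : upd (upd s i y) i z = upd s i z.
Proof. by apply: eq_from_tnth => j; rewrite !tnth_upd; case: eqP. Qed.

Lemma upd_tnth n (s : n.-tuple RR) i : upd s i (tnth s i) = s.
Proof. by apply: eq_from_tnth => j; rewrite !tnth_upd; case: eqP => [->|]. Qed.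

Lemma measurable_upd n (i : 'I_n) :
  measurable_fun setT (fun p : n.-tuple RR * RR => upd p.1 i p.2).
Proof.
apply/measurable_fun_tnthP => j; rewrite /comp.
under eq_fun do rewrite tnth_upd.
case: (j == i); first exact: measurable_snd.
exact: (measurableT_comp (measurable_tnth j) measurable_fst).
Qed.

Lemma upd_tcons0 n (x : RR) (s : n.-tuple RR) z :
  upd (tcons (x, s)) ord0 z = tcons (z, s).
Proof.
apply: eq_from_tnth => j; rewrite tnth_upd.
by case: (unliftP ord0 j) => [k ->|->]; rewrite ?eqxx// ?tnthS.
Qed.

Lemma upd_tconsS n (x : RR) (s : n.-tuple RR) i z :
  upd (tcons (x, s)) (lift ord0 i) z = tcons (x, upd s i z).
Proof.
apply: eq_from_tnth => j; rewrite tnth_upd.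
case: (unliftP ord0 j) => [k ->|->]; last by rewrite -(inj_eq val_inj).
by rewrite (inj_eq lift_inj) /tcons/= !tnthS tnth_upd.
Qed.

Lemma integral_iidS n (g : n.+1.-tuple RR -> \bar R) :
  measurable_fun setT g -> (forall s, 0 <= g s)%E ->
  (\int[iid P n.+1]_s g s = \int[P]_x \int[iid P n]_s g (tcons (x, s)))%E.
Proof.
move=> mg g0; rewrite /= ge0_integral_distribution//.
by rewrite (fubini_tonelli1 (g \o @tcons R n))//=; exact: (measurableT_comp mg (@measurable_tcons R n)).
Qed.

(** Induction on [n]. When the first coordinate is resampled, the right-hand integrand no longer
    depends on its old value, which integrates to total mass 1, and Tonelli exchanges the two
    remaining integrals. *)
Lemma integral_iid_resample n (i : 'I_n) (g : n.-tuple RR -> \bar R) :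
  measurable_fun setT g -> (forall s, 0 <= g s)%E ->
  (\int[iid P n]_s g s = \int[iid P n]_s \int[P]_z g (upd s i z))%E.
Proof.
elim: n i g => [[]//|n IH] i g mg g0.
have mgu : measurable_fun setT (fun p : n.+1.-tuple RR * RR => g (upd p.1 i p.2)).
  exact: (measurableT_comp mg (measurable_upd i)).
have mG : measurable_fun setT (fun s => \int[P]_z g (upd s i z))%E.
  exact: (@measurable_fun_fubini_tonelli_F _ _ _ _ _ P _ mgu).
have mgt : measurable_fun setT (fun p : RR * n.-tuple RR => g (tcons p)).
  exact: (measurableT_comp mg (@measurable_tcons R n)).
rewrite integral_iidS// [RHS]integral_iidS//; last by move=> s; exact: integral_ge0.
case: (unliftP ord0 i) => [j ij|i0].
  apply: eq_integral => x _; rewrite (IH j)//; last first.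
    exact: (measurableT_comp mgt (measurable_pair1 x)).
  by apply: eq_integral => s _; apply: eq_integral => z _; rewrite ij upd_tconsS.
have E x : (\int[iid P n]_s \int[P]_z g (upd (tcons (x, s)) i z) =
            \int[iid P n]_s \int[P]_z g (tcons (z, s)))%E.
  by apply: eq_integral => s _; apply: eq_integral => z _; rewrite i0 upd_tcons0.
under [RHS]eq_integral do rewrite E.
rewrite integral_cst// [X in (_ * X)%E](_ : _ = 1%E) ?mule1; last exact: probability_setT.
by rewrite (fubini_tonelli (fun p => g (tcons p))).
Qed.

Lemma BM_upd n (i : 'I_n) (g : n.-tuple RR -> R) :
  BM g -> BM (fun p : n.-tuple RR * RR => g (upd p.1 i p.2)).
Proof.
move=> [mg [M gM]]; split; last by exists M.
exact: (measurableT_comp mg (measurable_upd i)).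
Qed.

Lemma Rintegral_resample n (i : 'I_n) (g : n.-tuple RR -> R) : BM g ->
  \int[iid P n]_s g s = \int[iid P n]_s \int[P]_z g (upd s i z).
Proof.
move=> Bg; have [mg [M gM]] := Bg.
have Bu := BM_upd i Bg.
(* Adding the bound [M] makes the integrand nonnegative, so the extended-real version applies; the
   constant cancels at the end. *)
have Bh : BM (fun s => g s + M) by BM.
have Bhu : BM (fun p : n.-tuple RR * RR => g (upd p.1 i p.2) + M) by BM.
have h0 s : 0 <= g s + M by have := gM s; rewrite ler_norml => /andP[]; lra.
have c d (T : measurableType d) (Q : probability T R) r : \int[Q]_y (cst r y) = r.
  by rewrite Rintegral_cst// -[RHS]mulr1; congr (_ * _); exact: (congr1 fine (probability_setT Q)).
have := @integral_iid_resample n i (EFin \o (fun s => g s + M)).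
move=> /(_ _ _)/(congr1 fine) H.
have {}H : \int[iid P n]_s (g s + M) = \int[iid P n]_s (\int[P]_z (g (upd s i z) + M)).
  rewrite [LHS]H; first last.
  - by move=> s; rewrite /= lee_fin.
  - by apply/measurable_EFinP; case: Bh.
  congr fine; apply: eq_integral => s _.
  rewrite (Rintegral_fineK P)//; exact: (@BM_curry _ _ _ _ _ (fun p => g (upd p.1 i p.2) + M) s).
move: H; rewrite RintegralD//; [|exact: BM_integrable|exact: BM_integrable (BM_cst _ _)].
rewrite [X in _ = X -> _](_ : _ = \int[iid P n]_s (\int[P]_z g (upd s i z) + M)).
  rewrite RintegralD//.
  - by rewrite c; move/addIr.
  - have BI := BM_Rintegral (iid P n) P Bu; exact: (BM_integrable (iid P n) BI).
  - exact: BM_integrable (BM_cst _ _).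
apply: eq_Rintegral => s _; rewrite RintegralD ?c//.
  exact: (BM_integrable _ (BM_curry s Bu)).
exact: BM_integrable (BM_cst _ _).
Qed.

(* Detailed balance: [w s * t s z] is the density of the pair (configuration,
   resampled value at i), and it is invariant under exchanging the two values. *)
Lemma exchangeable_resampling n (i : 'I_n) (w : n.-tuple RR -> R)
    (t k : n.-tuple RR * RR -> R) :
  BM w -> BM t -> BM k ->
  (forall s y z, w (upd s i y) * t (upd s i y, z) = w (upd s i z) * t (upd s i z, y)) ->
  \int[iid P n]_s (w s * \int[P]_z (t (s, z) * k (s, z))) =
  \int[iid P n]_s (w s * \int[P]_z (t (s, z) * k (upd s i z, tnth s i))).
Proof.
move=> Bw Bt Bk bal.
have Btup (g : n.-tuple RR * RR -> R) : BM g ->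
    BM (fun p : n.-tuple RR * RR => g (upd p.1 i p.2, tnth p.1 i)).
  move=> [mg [M gM]]; split; last by exists M.
  apply: (measurableT_comp mg); apply/measurable_fun_pairP; split.
    exact: (measurable_upd i).
  exact: (measurableT_comp (measurable_tnth i) measurable_fst).
have Bw1 : BM (fun p : n.-tuple RR * RR => w p.1).
  case: Bw => mw [M wM]; split; last by exists M.
  exact: (measurableT_comp mw measurable_fst).
have pull (g : n.-tuple RR * RR -> R) : BM g ->
    \int[iid P n]_s (w s * \int[P]_z (t (s, z) * g (s, z))) =
    \int[iid P n]_s \int[P]_z (w s * t (s, z) * g (s, z)).
  move=> Bg; apply: eq_Rintegral => s _; rewrite -RintegralZl//.
    by apply: eq_Rintegral => z _; rewrite mulrA.
  exact: (BM_integrable _ (BM_curry s (BMM Bt Bg))).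
rewrite pull// (pull (fun p => k (upd p.1 i p.2, tnth p.1 i))); last exact: Btup.
have B1 (g : n.-tuple RR * RR -> R) : BM g ->
    BM (fun s => \int[P]_z (w s * t (s, z) * g (s, z))).
  by move=> Bg; exact: (BM_Rintegral (iid P n) P (BMM (BMM Bw1 Bt) Bg)).
(* Resampling coordinate [i] turns both sides into double integrals over an old value y and a new
   value z; Fubini and [bal] then identify them. *)
apply: etrans (Rintegral_resample i (B1 _ Bk)) _.
apply/esym; apply: etrans (Rintegral_resample i (B1 _ (Btup _ Bk))) _; apply/esym.
apply: eq_Rintegral => s _ /=.
pose G (p : RR * RR) := w (upd s i p.1) * t (upd s i p.1, p.2) * k (upd s i p.1, p.2).
have BG : BM G.
  have mu1 : measurable_fun setT (fun p : RR * RR => upd s i p.1).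
    have mp : measurable_fun setT (fun p : RR * RR => (s, p.1)).
      by apply/measurable_fun_pairP; split; [exact: measurable_cst | exact: measurable_fst].
    exact: (measurableT_comp (measurable_upd i) mp).
  have mup : measurable_fun setT (fun p : RR * RR => (upd s i p.1, p.2)).
    by apply/measurable_fun_pairP; split; [exact: mu1 | exact: measurable_snd].
  apply: BMM; first apply: BMM.
  - by case: Bw => mw [M wM]; split; [exact: (measurableT_comp mw mu1) | exists M].
  - by case: Bt => mw [M wM]; split; [exact: (measurableT_comp mw mup) | exists M].
  - by case: Bk => mw [M wM]; split; [exact: (measurableT_comp mw mup) | exists M].
transitivity (\int[P]_y \int[P]_z G (y, z)); first by [].
apply: etrans (Rintegral_swap P P BG) _.
apply: eq_Rintegral => z _; apply: eq_Rintegral => y _.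
by rewrite /G /= bal tnth_upd eqxx upd_upd.
Qed.

End resampling.

(** * Taylor bounds *)

Section calculus.
Context {R : realType}.
Implicit Types (f g df : R -> R) (x a b : R).

(** A quadratic remainder bound can be integrated pointwise, so this criterion replaces dominated
    convergence when differentiating under the integral sign. *)
Lemma is_derive_quadratic f x l C d : 0 < d ->
  (forall h, `|h| <= d -> `|f (x + h) - f x - h * l| <= C * h ^+ 2) ->
  is_derive x (1:R) f l.
Proof.
move=> d0 H.
have C0 : 0 <= C.
  have := H d; rewrite gtr0_norm// lexx => /(_ isT) h; have := le_trans (normr_ge0 _) h.
  by rewrite pmulr_lge0// exprn_gt0.
have cv : (fun h => h^-1 *: (f (h *: 1 + x) - f x)) @ (0 : R)^' --> l.
  apply/cvgrPdist_le => e e0.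
  near=> h.
  have h0 : h != 0 by near: h; exact: nbhs_dnbhs_neq.
  have hd : `|h| <= d.
    near: h; apply: dnbhs0_le => //.
  (* The denominator is [C + 1] because [C] may be 0. *)
  have he : `|h| <= e / (C + 1).
    near: h; apply: dnbhs0_le; rewrite divr_gt0//; lra.
  have -> : l - h^-1 *: (f (h *: 1 + x) - f x) = - h^-1 * (f (x + h) - f x - h * l).
    rewrite /GRing.scale/= mulr1 (addrC h x); by field.
  rewrite normrM normrN normfV mulrC ler_pdivrMr ?normr_gt0//.
  apply: le_trans (H _ hd) _.
  rewrite -[h ^+ 2]real_normK ?num_real// expr2 mulrA ler_wpM2r//.
  have : C * `|h| <= C * (e / (C + 1)) by rewrite ler_wpM2l.
  move=> /le_trans; apply.
  rewrite mulrA ler_pdivrMr; last lra.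
  by rewrite mulrDr mulr1 (mulrC C); lra.
apply: DeriveDef; first by apply/cvg_ex; exists l.
exact: cvg_lim.
Unshelve. all: by end_near. Qed.

Lemma is_derive_continuous f df : (forall x : R, is_derive x (1:R) f (df x)) -> continuous f.
Proof.
by move=> H x; apply: differentiable_continuous; apply/derivable1_diffP; case: (H x).
Qed.

Lemma is_derive_add f g x a b : is_derive x (1:R) f a -> is_derive x (1:R) g b ->
  is_derive x (1:R) (fun t => f t + g t) (a + b).
Proof. by move=> hf hg; exact: is_deriveD. Qed.

Lemma is_derive_sub f g x a b : is_derive x (1:R) f a -> is_derive x (1:R) g b ->
  is_derive x (1:R) (fun t => f t - g t) (a - b).
Proof. by move=> hf hg; exact: is_deriveB. Qed.

Lemma is_derive_mul f g x a b : is_derive x (1:R) f a -> is_derive x (1:R) g b ->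
  is_derive x (1:R) (fun t => f t * g t) (a * g x + f x * b).
Proof.
move=> hf hg; have := is_deriveM hf hg; rewrite /GRing.scale/=.
by rewrite addrC (mulrC (g x)).
Qed.

Lemma is_derive_inv f x a : f x != 0 -> is_derive x (1:R) f a ->
  is_derive x (1:R) (fun t => (f t)^-1) (- a / f x ^+ 2).
Proof.
move=> fx hf; have := is_deriveV fx hf.
rewrite /GRing.scale/= => h; apply: is_derive_eq h _.
by rewrite !mulNr mulrC.
Qed.

Lemma is_derive_comp f g x a b : is_derive (g x) 1 f a -> is_derive x (1:R) g b ->
  is_derive x (1:R) (fun t => f (g t)) (a * b).
Proof. by move=> hf hg; exact: is_derive1_comp. Qed.

Lemma mean_value f df a b : (forall x : R, is_derive x (1:R) f (df x)) ->
  exists2 c, Num.min a b <= c <= Num.max a b & f b - f a = df c * (b - a).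
Proof.
move=> H; have cf := is_derive_continuous H.
have [ab|ba] := leP a b.
  have [|c cab ->] := MVT_segment ab (fun x _ => H x).
    exact: continuous_subspaceT.
  by exists c.
have [|c cab e] := MVT_segment (ltW ba) (fun x _ => H x).
  exact: continuous_subspaceT.
by exists c => //; lra.
Qed.

Lemma derive_bounded_lipschitz f df M : (forall x : R, is_derive x (1:R) f (df x)) ->
  (forall x, `|df x| <= M) -> forall a b, `|f b - f a| <= M * `|b - a|.
Proof.
by move=> H dM a b; have [c _ ->] := mean_value a b H; rewrite normrM ler_wpM2r.
Qed.

Lemma taylor1 f df L : (forall x : R, is_derive x (1:R) f (df x)) ->
  (forall a b, `|df b - df a| <= L * `|b - a|) ->
  forall x h, `|f (x + h) - f x - h * df x| <= L * h ^+ 2.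
Proof.
move=> H dL x h; have [c cab e] := mean_value x (x + h) H.
have L0 : 0 <= L by have := le_trans (normr_ge0 _) (dL 0 1); rewrite subr0 normr1 mulr1.
have -> : f (x + h) - f x - h * df x = (df c - df x) * h by rewrite e; ring.
rewrite normrM -[h ^+ 2]real_normK ?num_real// expr2 mulrA ler_wpM2r//.
apply: le_trans (dL _ _) _; rewrite ler_wpM2l//.
move: cab; rewrite minEle maxEle; case: (leP x (x + h)) => xh /andP[c1 c2].
  by rewrite !ger0_norm; lra.
by rewrite !ler0_norm; lra.
Qed.

(** The mean value theorem is applied to the remainder as a function of the increment; its
    derivative is the first-order remainder of [f1], bounded by [taylor1]. *)
Lemma taylor2 f f1 f2 L : (forall x : R, is_derive x (1:R) f (f1 x)) ->
  (forall x : R, is_derive x (1:R) f1 (f2 x)) ->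
  (forall a b, `|f2 b - f2 a| <= L * `|b - a|) ->
  forall x h, `|f (x + h) - f x - h * f1 x - h ^+ 2 / 2 * f2 x| <= L * `|h| ^+ 3.
Proof.
move=> H1 H2 dL x h.
have L0 : 0 <= L by have := le_trans (normr_ge0 _) (dL 0 1); rewrite subr0 normr1 mulr1.
pose G t := f (x + t) - t * f1 x - t ^+ 2 / 2 * f2 x.
have sh (t : R) : is_derive t (1:R) (fun t => x + t) 1.
  by rewrite -[X in is_derive _ _ _ X]add0r; exact: is_derive_add.
have GD (t : R) : is_derive t (1:R) G (f1 (x + t) - f1 x - t * f2 x).
  have h1 : is_derive t (1:R) (fun t => f (x + t)) (f1 (x + t)).
    by rewrite -[X in is_derive _ _ _ X]mulr1; apply: is_derive_comp.
  have h2 : is_derive t (1:R) (fun t => t * f1 x) (f1 x).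
    rewrite -[X in is_derive _ _ _ X](_ : 1 * f1 x + t * 0 = _); last by ring.
    exact: is_derive_mul.
  have h3 : is_derive t (1:R) (fun t => t ^+ 2 / 2 * f2 x) (t * f2 x).
    rewrite -[X in is_derive _ _ _ X](_ : ((1 * t + t * 1) * 2^-1 + t * t * 0) * f2 x + t * t / 2 * 0 = _); last by field.
    have h0 : is_derive t (1:R) (fun t => t * t) (1 * t + t * 1) by exact: is_derive_mul.
    have h' : is_derive t (1:R) (fun t => t * t / 2) ((1 * t + t * 1) * 2^-1 + t * t * 0) by exact: is_derive_mul.
    exact: is_derive_mul.
  by apply: is_derive_sub => //; apply: is_derive_sub.
have [c cab e] := mean_value 0 h GD.
have -> : f (x + h) - f x - h * f1 x - h ^+ 2 / 2 * f2 x =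
          (f1 (x + c) - f1 x - c * f2 x) * (h - 0).
  by rewrite -e /G addr0 mul0r expr0n/= mul0r mul0r !subr0; ring.
rewrite subr0 normrM exprSr mulrA ler_wpM2r//.
apply: le_trans (taylor1 H2 dL _ _) _; rewrite ler_wpM2l//.
rewrite -[c ^+ 2]real_normK ?num_real// lerXn2r ?nnegrE//.
move: cab; rewrite minEle maxEle; case: (leP 0 h) => xh /andP[c1 c2].
  by rewrite !ger0_norm.
by rewrite !ler0_norm; lra.
Qed.

(** Only 1 + y <= exp y is used, at x for the lower bound and at -x, in the form exp x * (1 - x) <=
    1, for the upper one. *)
Lemma expR_taylor (x : R) : `|x| <= 1 / 2 -> `|expR x - 1 - x| <= 2 * x ^+ 2.
Proof.
rewrite ler_norml => /andP[x1 x2].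
have l1 := expR_ge1Dx x; have l2 := expR_ge1Dx (- x).
have e0 := expR_gt0 x.
have l3 : expR x * (1 - x) <= 1.
  rewrite -[leRHS](_ : expR x * expR (- x) = 1); last by rewrite expRN divff// gt_eqF.
  by rewrite ler_wpM2l// ltW.
rewrite ger0_norm; last lra.
rewrite -subr_ge0; have x3 : 0 < 1 - x by lra.
rewrite -(pmulr_rge0 _ x3).
have -> : (1 - x) * (2 * x ^+ 2 - (expR x - 1 - x)) =
  1 - expR x * (1 - x) + x ^+ 2 * (1 - 2 * x) by ring.
by rewrite addr_ge0// ?subr_ge0// mulr_ge0 ?sqr_ge0//; lra.
Qed.

End calculus.

(** * Exponential tilts of the base measure *)

Section tilt.
Context {R : realType}.
Local Notation RR := (measurableTypeR R).
Variable mu : probability RR R.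

(* [mu] is carried by [-1, 1], so clipping changes no law but makes every
   integrand bounded on the whole line. *)
Definition clip (z : R) : R := Num.max (-1) (Num.min z 1).

Lemma clip_norm z : `|clip z| <= 1.
Proof.
by rewrite /clip ler_norml le_max lexx/= ge_max ge_min lexx orbT andbT; lra.
Qed.

Lemma clip_id z : -1 <= z <= 1 -> clip z = z.
Proof. by move=> /andP[z1 z2]; rewrite /clip (min_idPl z2) (max_idPr z1). Qed.

Lemma measurable_clip : measurable_fun setT (clip : RR -> RR).
Proof.
apply: measurable_maxr; first exact: measurable_cst.
by apply: measurable_minr; [exact: measurable_id | exact: measurable_cst].
Qed.

Lemma BM_clip : BM (clip : RR -> R).
Proof. by split; [exact: measurable_clip | exists 1; exact: clip_norm]. Qed.

Lemma BM_expclip t : BM ((fun z => expR (t * clip z)) : RR -> R).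
Proof.
apply: (BM_comp (h := expR)); first exact: continuous_expR.
by apply: BMM; [exact: BM_cst | exact: BM_clip].
Qed.

Definition tilt_int (f : R -> R) (t : R) : R := \int[mu]_z (f z * expR (t * clip z)).

(** After factoring out [f z * expR (t * clip z)], the remainder is the second-order remainder of
    the exponential at [h * clip z], uniformly quadratic for |h| <= 1/2. *)
Lemma tilt_int_derive (f : RR -> R) t : BM f ->
  is_derive t (1:R) (tilt_int f) (tilt_int (fun z => f z * clip z) t).
Proof.
move=> Bf; have [_ [M fM]] := Bf.
have h20 : 0 < 1 / 2 :> R by lra.
apply: (@is_derive_quadratic _ _ _ _ (M * expR `|t| * 2) _ h20) => h h2.
have Be u := BM_expclip u.
have Bc := BM_clip.
have eI : tilt_int f (t + h) - tilt_int f t - h * tilt_int (fun z => f z * clip z) t =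
   \int[mu]_z (f z * expR ((t + h) * clip z) - f z * expR (t * clip z) -
               h * (f z * clip z * expR (t * clip z))).
  rewrite /tilt_int -RintegralZl//; last by apply: BM_integrable; BM.
  rewrite -RintegralB//; [|by apply: BM_integrable; BM..].
  by rewrite -RintegralB//; by apply: BM_integrable; BM.
rewrite eI.
have BI : BM (fun z : RR => f z * expR ((t + h) * clip z) - f z * expR (t * clip z) -
               h * (f z * clip z * expR (t * clip z))).
  by apply: BMB; [apply: BMB|]; BM.
have W1 := weight1 mu.
have := @Ex_norm_le _ _ _ mu _ W1 _ (M * expR `|t| * 2 * h ^+ 2) BI _.
rewrite /Ex; under eq_Rintegral do rewrite mul1r.
apply => z.
have cz := clip_norm z.
have -> : f z * expR ((t + h) * clip z) - f z * expR (t * clip z) -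
               h * (f z * clip z * expR (t * clip z)) =
  f z * (expR (t * clip z) * (expR (h * clip z) - 1 - h * clip z)).
  by rewrite mulrDl expRD; ring.
rewrite !normrM -!mulrA; apply: ler_pM => //.
apply: ler_pM => //.
  rewrite ger0_norm ?expR_ge0// ler_expR (le_trans (ler_norm _))// normrM.
  by rewrite -[leRHS]mulr1 ler_wpM2l.
apply: le_trans (expR_taylor _) _.
  by rewrite normrM (le_trans _ h2)// -[leRHS]mulr1 ler_wpM2l.
rewrite ler_wpM2l// exprMn -[leRHS]mulr1 ler_wpM2l ?sqr_ge0//.
by rewrite -[clip z ^+ 2]real_normK ?num_real// expr_le1.
Qed.

Definition mgf (t : R) : R := tilt_int (fun=> 1) t.

Lemma mgf_gt0 t : 0 < mgf t.
Proof.
have : expR (- `|t|) <= mgf t.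
  have := @Ex_ge_cst _ _ _ mu _ (weight1 mu) _ (expR (- `|t|)) (BM_expclip t) _.
  rewrite /Ex; apply => z; rewrite ler_expR.
  have := ler_norm (- (t * clip z)); rewrite normrN normrM.
  have : `|t| * `|clip z| <= `|t| by rewrite -[leRHS]mulr1 ler_wpM2l// clip_norm.
  lra.
exact: lt_le_trans (expR_gt0 _).
Qed.

(** The member with natural parameter [t] of the exponential family generated by [mu]: the
    conditional law of a spin whose local field is [t]. *)
Definition tilted (t : R) (z : R) : R := expR (t * clip z) / mgf t.

Lemma BM_tilted t : BM (tilted t : RR -> R).
Proof. by apply: BMM; [exact: BM_expclip | exact: BM_cst]. Qed.

Lemma weight_tilted t : weight mu (tilted t).
Proof.
split; first exact: BM_tilted.
  by move=> z; rewrite divr_ge0 ?expR_ge0// ltW// mgf_gt0.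
rewrite /tilted RintegralZr//; last exact: BM_integrable (BM_expclip _).
have -> : \int[mu]_x expR (t * clip x) = mgf t.
  by apply: eq_Rintegral => z _; rewrite mul1r.
by rewrite divff// gt_eqF// mgf_gt0.
Qed.

Definition tmean (f : R -> R) (t : R) : R := Ex mu (tilted t) f.

Lemma tmeanE (f : RR -> R) t : BM f -> tmean f t = tilt_int f t / mgf t.
Proof.
move=> Bf; rewrite /tmean /Ex /tilt_int -RintegralZr//.
  by apply: eq_Rintegral => z _; rewrite /tilted; ring.
by apply: BM_integrable; apply: BMM => //; exact: BM_expclip.
Qed.

(** The quotient rule yields the covariance of [f] and [clip] under the tilt. *)
Lemma tmean_derive (f : RR -> R) t : BM f -> is_derive t (1:R) (tmean f)
  (tmean (fun z => f z * clip z) t - tmean f t * tmean clip t).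
Proof.
move=> Bf; have Bc := BM_clip.
have -> : tmean f = fun t => tilt_int f t / mgf t.
  by apply/funext => u; exact: tmeanE.
have Z0 : mgf t != 0 by rewrite gt_eqF// mgf_gt0.
have d1 := tilt_int_derive t Bf.
have d2 : is_derive t (1:R) mgf (tilt_int clip t).
  have := tilt_int_derive t (BM_cst _ 1); rewrite (_ : tilt_int _ t = tilt_int clip t)//.
  by apply: eq_Rintegral => z _; rewrite mul1r.
have d3 := is_derive_inv Z0 d2.
apply: is_derive_eq (is_derive_mul d1 d3) _.
rewrite !tmeanE//; last exact: BMM.
by field.
Qed.

Lemma tmean_norm (f : RR -> R) t M : BM f -> (forall z, `|f z| <= M) -> `|tmean f t| <= M.
Proof. by move=> Bf fM; exact: (Ex_norm_le (weight_tilted t)). Qed.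

Lemma tmean_lipschitz (f : RR -> R) M : BM f -> (forall z, `|f z| <= M) ->
  forall a b, `|tmean f b - tmean f a| <= M * 2 * `|b - a|.
Proof.
move=> Bf fM; apply: derive_bounded_lipschitz => [t|t].
  exact: tmean_derive.
have M0 : 0 <= M by rewrite (le_trans _ (fM 0)).
have Bc := BM_clip.
rewrite (le_trans (ler_normB _ _))// mulr_natr mulr2n lerD//.
  apply: tmean_norm; first exact: BMM.
  by move=> z; rewrite normrM -[leRHS]mulr1 ler_pM// clip_norm.
rewrite normrM -[leRHS]mulr1 ler_pM//; first exact: tmean_norm.
by apply: tmean_norm => // z; exact: clip_norm.
Qed.

(* Locking keeps conversion from unfolding the integrals when comparing values
   at different arguments. *)
Definition m1 : R -> R := locked (tmean clip).
Definition tvar : R -> R :=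
  locked (fun t => tmean (fun z => clip z ^+ 2) t - m1 t ^+ 2).

Lemma m1E t : m1 t = tmean clip t. Proof. by rewrite /m1 -lock. Qed.

Lemma tvar_def t : tvar t = tmean (fun z => clip z ^+ 2) t - m1 t ^+ 2.
Proof. by rewrite /tvar -lock. Qed.

Lemma m1_derive t : is_derive t (1:R) m1 (tvar t).
Proof.
rewrite tvar_def m1E {1}/m1 -lock.
exact: (tmean_derive t BM_clip).
Qed.

Lemma m1_norm t : `|m1 t| <= 1.
Proof. by rewrite m1E; apply: tmean_norm; [exact: BM_clip | exact: clip_norm]. Qed.

Lemma clip_sqr z : clip z ^+ 2 <= 1.
Proof. by rewrite -[clip z ^+ 2]real_normK ?num_real// expr_le1 ?clip_norm. Qed.

Lemma tvarE t : tvar t = tmean (fun z => (clip z - m1 t) ^+ 2) t.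
Proof.
have Bc := BM_clip; have W := weight_tilted t.
have B2 : BM (fun z : RR => clip z ^+ 2) by BM.
rewrite /tmean [RHS](_ : _ = Ex mu (tilted t) (fun z => clip z ^+ 2 - (2 * m1 t) * clip z + m1 t ^+ 2)); last first.
  by apply: eq_Ex => z; ring.
rewrite (ExD W); [|by apply: BMB; BM|by BM].
rewrite (ExB W)//; last by BM.
rewrite (ExZ W)// Ex_cst// tvar_def m1E /tmean; move: (Ex _ _ _) (Ex _ _ _) => x y; ring.
Qed.

Lemma tvar_ge0 t : 0 <= tvar t.
Proof. by rewrite tvarE; apply: (Ex_ge0 (weight_tilted t)) => z; exact: sqr_ge0. Qed.

Lemma tvar_le1 t : tvar t <= 1.
Proof.
have : tmean (fun z => clip z ^+ 2) t <= 1.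
  apply: (Ex_le_cst (weight_tilted t)) => [|z]; last exact: clip_sqr.
  by have Bc := BM_clip; BM.
by have := sqr_ge0 (m1 t); rewrite tvar_def; lra.
Qed.

Lemma tvar_norm t : `|tvar t| <= 1.
Proof. by rewrite ger0_norm ?tvar_le1// tvar_ge0. Qed.

Lemma m1_lipschitz a b : `|m1 b - m1 a| <= `|b - a|.
Proof.
rewrite -[leRHS]mul1r; apply: derive_bounded_lipschitz; first exact: m1_derive.
exact: tvar_norm.
Qed.

Lemma tvar_lipschitz a b : `|tvar b - tvar a| <= 4 * `|b - a|.
Proof.
have h1 : `|tmean (fun z => clip z ^+ 2) b - tmean (fun z => clip z ^+ 2) a| <= 1 * 2 * `|b - a|.
  apply: tmean_lipschitz; first by have Bc := BM_clip; BM.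
  by move=> z; rewrite ger0_norm ?sqr_ge0// clip_sqr.
have h2 : `|m1 b ^+ 2 - m1 a ^+ 2| <= 2 * `|b - a|.
  rewrite subr_sqr mulrC normrM ler_pM// ?m1_lipschitz//.
  by rewrite (le_trans (ler_normD _ _))// (_ : 2 = 1 + 1)// lerD// m1_norm.
have gen (x y p q r : R) :
    `|x - y| <= 1 * 2 * r -> `|p - q| <= 2 * r -> `|(x - p) - (y - q)| <= 4 * r.
  by rewrite !ler_norml => /andP[? ?] /andP[? ?]; apply/andP; split; lra.
rewrite !tvar_def; exact: gen h1 h2.
Qed.

Lemma m1_taylor x h : `|m1 (x + h) - m1 x - h * tvar x| <= 4 * h ^+ 2.
Proof. by apply: taylor1; [exact: m1_derive | exact: tvar_lipschitz]. Qed.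

Lemma continuous_m1 : continuous m1.
Proof. exact: is_derive_continuous m1_derive. Qed.

Lemma continuous_tvar : continuous tvar.
Proof.
have Bc := BM_clip.
have : forall x : R, is_derive x (1:R) (tmean (fun z => clip z ^+ 2))
  (tmean (fun z => clip z ^+ 2 * clip z) x - tmean (fun z => clip z ^+ 2) x * tmean clip x).
  by move=> x; apply: tmean_derive; BM.
move=> /is_derive_continuous c2.
rewrite (_ : tvar = fun t => tmean (fun z => clip z ^+ 2) t - m1 t ^+ 2).
  move=> x.
  by apply: continuousB; [exact: c2 | apply: continuousM; exact: continuous_m1].
by apply/funext => t; exact: tvar_def.
Qed.

End tilt.

Section base_measure.
Context {R : realType}.
Local Notation RR := (measurableTypeR R).
Variable mu : probability RR R.
Hypothesis bmu : base_measure mu.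

Lemma ae_clip : {ae mu, forall z, clip z = z}.
Proof.
exists (~` [set` `[-1, 1]]); split.
- by apply: measurableC; exact: measurable_itv.
- rewrite probability_setC; last exact: measurable_itv.
  by case: bmu => -> _ _ _; rewrite subee.
- move=> z /=; apply: contra_not; rewrite in_itv/= => h; exact: clip_id.
Qed.

(** Clipping is invisible here because [mu] gives no mass to the complement of [-1, 1]. *)
Lemma psiE t : psi mu t = ln (mgf mu t).
Proof.
rewrite /psi /mgf /tilt_int; congr (ln (fine _)); apply: ae_eq_integral => //.
- by apply/measurable_EFinP; apply: measurableT_comp => //; exact: measurable_funM.
- apply/measurable_EFinP; case: (BM_expclip t) => + _.
  by move=> h; under eq_fun do rewrite mul1r.
- have [N [mN N0 sub]] := ae_clip; exists N; split=> // z /= h; apply: sub => /= zc.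
  by apply: h => _; rewrite zc mul1r.
Qed.

Lemma psi_derive t : is_derive t (1:R) (psi mu) (m1 mu t).
Proof.
have -> : psi mu = fun t => ln (mgf mu t) by apply/funext => u; exact: psiE.
have d2 : is_derive t (1:R) (mgf mu) (tilt_int mu clip t).
  have := tilt_int_derive mu t (BM_cst _ 1); rewrite (_ : tilt_int _ _ t = tilt_int mu clip t)//.
  by apply: eq_Rintegral => z _; rewrite mul1r.
apply: is_derive_eq (is_derive_comp (is_derive1_ln (mgf_gt0 mu t)) d2) _.
by rewrite m1E (tmeanE _ _ BM_clip); exact: mulrC.
Qed.

Lemma psi1E : psi1 mu = m1 mu.
Proof. by apply/funext => t; rewrite /psi1 derive1E; case: (psi_derive t). Qed.

Lemma psi2E : psi2 mu = tvar mu.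
Proof.
apply/funext => t; rewrite /psi2 /derive1n/= (_ : (psi mu)^`()%classic = m1 mu); last exact: psi1E.
by rewrite derive1E; case: (m1_derive mu t).
Qed.

End base_measure.

(** * Coupling matrices as operators *)

Section inequalities.
Context {R : realType}.

(** Convexity of the square with weights 1 - rho and rho. With these weights a term b of norm at
    most rho |x| contributes rho |x|^2 and can be absorbed. *)
Lemma sqrrD_convex (rho a b : R) : 0 < rho < 1 ->
  (a + b) ^+ 2 <= a ^+ 2 / (1 - rho) + b ^+ 2 / rho.
Proof.
move=> /andP[r0 r1]; have s0 : 0 < 1 - rho by lra.
rewrite -subr_ge0.
have -> : a ^+ 2 / (1 - rho) + b ^+ 2 / rho - (a + b) ^+ 2 =
  (rho * a - (1 - rho) * b) ^+ 2 / (rho * (1 - rho)).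
  by field; rewrite !gt_eqF.
by rewrite divr_ge0 ?sqr_ge0// mulr_ge0// ltW.
Qed.

Lemma expr4D_convex (rho a b : R) : 0 < rho < 1 ->
  (a + b) ^+ 4 <= a ^+ 4 / (1 - rho) ^+ 3 + b ^+ 4 / rho ^+ 3.
Proof.
move=> h; have /andP[r0 r1] := h; have s0 : 0 < 1 - rho by lra.
have h1 := sqrrD_convex a b h.
have h2 := sqrrD_convex (a ^+ 2 / (1 - rho)) (b ^+ 2 / rho) h.
have -> : (a + b) ^+ 4 = ((a + b) ^+ 2) ^+ 2 by ring.
apply: (le_trans (y := (a ^+ 2 / (1 - rho) + b ^+ 2 / rho) ^+ 2)).
  by rewrite lerXn2r ?nnegrE ?sqr_ge0// (le_trans _ h1) ?sqr_ge0.
apply: (le_trans h2); rewrite le_eqVlt; apply/orP; left; apply/eqP.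
by field; rewrite !gt_eqF.
Qed.

Variable n : nat.
Implicit Types x y z v : 'I_n -> R.

(** Lagrange's identity. *)
Lemma cauchy_schwarz_sum x y :
  (\sum_i x i * y i) ^+ 2 <= (\sum_i x i ^+ 2) * (\sum_i y i ^+ 2).
Proof.
rewrite -subr_ge0.
have -> : (\sum_i x i ^+ 2) * (\sum_i y i ^+ 2) - (\sum_i x i * y i) ^+ 2 =
   (\sum_i \sum_j (x i * y j - x j * y i) ^+ 2) / 2.
  have e1 : \sum_i \sum_j (x i * y j - x j * y i) ^+ 2 =
     \sum_i \sum_j (x i ^+ 2 * y j ^+ 2) + \sum_i \sum_j (y i ^+ 2 * x j ^+ 2)
     - 2 * \sum_i \sum_j ((x i * y i) * (x j * y j)).
    rewrite -big_split/= mulr_sumr -sumrB; apply: eq_bigr => i _.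
    rewrite -big_split/= mulr_sumr -sumrB; apply: eq_bigr => j _; ring.
  have p (f g : 'I_n -> R) : \sum_i \sum_j f i * g j = (\sum_i f i) * (\sum_j g j).
    by rewrite mulr_suml; apply: eq_bigr => i _; rewrite mulr_sumr.
  by rewrite e1 !p; field.
by rewrite divr_ge0//; apply: sumr_ge0 => i _; apply: sumr_ge0 => j _; exact: sqr_ge0.
Qed.

Lemma sum_mul_le x y a b : 0 <= a -> 0 <= b ->
  \sum_i x i ^+ 2 <= a ^+ 2 -> \sum_i y i ^+ 2 <= b ^+ 2 ->
  \sum_i `|x i| * `|y i| <= a * b.
Proof.
move=> a0 b0 xa yb.
have S0 : 0 <= \sum_i `|x i| * `|y i| by apply: sumr_ge0 => i _; rewrite mulr_ge0.
rewrite -[leLHS]ger0_norm// -[leRHS]ger0_norm ?mulr_ge0// -ler_sqr ?nnegrE//.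
rewrite !real_normK ?num_real// exprMn.
apply: le_trans (cauchy_schwarz_sum _ _) _.
have e z : \sum_i `|z i| ^+ 2 = \sum_i z i ^+ 2.
  by apply: eq_bigr => i _; rewrite real_normK ?num_real.
by rewrite !e ler_pM//; apply: sumr_ge0 => i _; exact: sqr_ge0.
Qed.

Lemma sum_sqr_le_max x i : x i ^+ 2 <= \sum_j x j ^+ 2.
Proof.
rewrite (bigD1 i)//= lerDl; apply: sumr_ge0 => j _; exact: sqr_ge0.
Qed.

(** The triangle inequality |x| <= |v| + rho |x|, solved for |x| without taking roots; [z] is
    typically the image under [A] of something dominated by [x]. *)
Lemma sum_contraction2 (rho : R) x v z : 0 < rho < 1 ->
  (forall i, x i = v i + z i) ->
  \sum_i z i ^+ 2 <= rho ^+ 2 * \sum_i x i ^+ 2 ->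
  (1 - rho) ^+ 2 * \sum_i x i ^+ 2 <= \sum_i v i ^+ 2.
Proof.
move=> h; have /andP[r0 r1] := h; have s0 : 0 < 1 - rho by lra.
move=> xe zx.
have : \sum_i x i ^+ 2 <= (\sum_i v i ^+ 2) / (1 - rho) + (\sum_i z i ^+ 2) / rho.
  rewrite !mulr_suml -big_split/=; apply: ler_sum => i _.
  by rewrite xe; exact: sqrrD_convex.
have : (\sum_i z i ^+ 2) / rho <= rho * \sum_i x i ^+ 2.
  by rewrite ler_pdivrMr// mulrAC -expr2.
move: (\sum_i x i ^+ 2) (\sum_i v i ^+ 2) (_ / rho) => X V Z h1 h2.
have : (1 - rho) * X <= V / (1 - rho) by lra.
by rewrite ler_pdivlMr// expr2; lra.
Qed.

Lemma sum_contraction4 (rho : R) x v z : 0 < rho < 1 ->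
  (forall i, x i = v i + z i) ->
  \sum_i z i ^+ 4 <= rho ^+ 4 * \sum_i x i ^+ 4 ->
  (1 - rho) ^+ 4 * \sum_i x i ^+ 4 <= \sum_i v i ^+ 4.
Proof.
move=> h; have /andP[r0 r1] := h; have s0 : 0 < 1 - rho by lra.
move=> xe zx.
have : \sum_i x i ^+ 4 <= (\sum_i v i ^+ 4) / (1 - rho) ^+ 3 + (\sum_i z i ^+ 4) / rho ^+ 3.
  rewrite !mulr_suml -big_split/=; apply: ler_sum => i _.
  by rewrite xe; exact: expr4D_convex.
have : (\sum_i z i ^+ 4) / rho ^+ 3 <= rho * \sum_i x i ^+ 4.
  by rewrite ler_pdivrMr ?exprn_gt0// mulrAC -exprS.
move: (\sum_i x i ^+ 4) (\sum_i v i ^+ 4) (_ / rho ^+ 3) => X V Z h1 h2.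
have : (1 - rho) * X <= V / (1 - rho) ^+ 3 by lra.
rewrite ler_pdivlMr ?exprn_gt0//.
by have -> : (1 - rho) * X * (1 - rho) ^+ 3 = (1 - rho) ^+ 4 * X by ring.
Qed.

End inequalities.

Lemma exp_not_bounded (R : realType) (k C : R) : 1 < k -> ~ (forall m, k ^+ m <= C).
Proof.
move=> k1 H.
have B m : 1 + m%:R * (k - 1) <= k ^+ m.
  elim: m => [|m IH]; first by rewrite mul0r addr0 expr0.
  rewrite exprS.
  have : k * (1 + m%:R * (k - 1)) <= k * k ^+ m by rewrite ler_wpM2l//; lra.
  apply: le_trans; rewrite -natr1.
  have : 0 <= m%:R * (k - 1) ^+ 2 by rewrite mulr_ge0 ?sqr_ge0.
  nra.
have k0 : 0 < k - 1 by lra.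
have [m hm] : exists m : nat, C / (k - 1) < m%:R.
  exists (Num.bound `|C / (k - 1)|).
  by apply: le_lt_trans (ler_norm _) _; exact: archi_boundP.
have := le_trans (B m) (H m).
by rewrite ltr_pdivrMr// in hm; lra.
Qed.

Section matrices.
Context {R : realType} (n : nat) (A : 'M[R]_n) (rho : R).
Hypothesis hrho : 0 < rho < 1.
Hypothesis cA : coupling A.
Hypothesis oA : opnorm4 A <= rho.
Implicit Types x y z v : 'I_n -> R.

Definition mv x (i : 'I_n) : R := \sum_j A i j * x j.

Lemma coupling_sym i j : A i j = A j i.
Proof. by case: cA => h _; rewrite -[in RHS]h mxE. Qed.

Lemma mv_mulmx x : (fun i => (A *m \col_j x j) i 0) = mv x.
Proof. by apply/funext => i; rewrite mxE; apply: eq_bigr => j _; rewrite mxE. Qed.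

Lemma l4norm_exp4 (x : 'cV[R]_n) : l4norm x ^+ 4 = \sum_i x i 0 ^+ 4.
Proof.
have S0 : 0 <= \sum_i x i 0 ^+ 4.
  apply: sumr_ge0 => i _; rewrite (_ : 4 = 2 * 2)%N// exprM; exact: sqr_ge0.
rewrite /l4norm -powR_mulrn ?powR_ge0// -powRrM mulVf ?powRr1//.
Qed.

Lemma l4norm_ge0 (x : 'cV[R]_n) : 0 <= l4norm x.
Proof. exact: powR_ge0. Qed.

Lemma expr4_ge0 (a : R) : 0 <= a ^+ 4.
Proof. by rewrite (_ : 4 = 2 * 2)%N// exprM; exact: sqr_ge0. Qed.

(** A supremum of reals is meaningful only for a nonempty bounded set; a crude entrywise bound
    suffices. *)
Lemma opnorm4_has_sup :
  has_sup [set l4norm (A *m x) | x in [set x | l4norm x <= 1]].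
Proof.
split.
  exists (l4norm (A *m 0)); exists 0 => //=.
  rewrite -(@ler_pXn2r _ 4)// ?nnegrE ?l4norm_ge0// l4norm_exp4 expr1n.
  by rewrite big1// => i _; rewrite mxE expr0n.
pose K := \sum_i \sum_j `|A i j|.
have K0 : 0 <= K by apply: sumr_ge0 => i _; apply: sumr_ge0.
exists (1 + n%:R * K ^+ 4) => _ [x /= x1 <-].
have S1 : \sum_i x i 0 ^+ 4 <= 1.
  by rewrite -l4norm_exp4 -(expr1n _ 4) lerXn2r ?nnegrE ?l4norm_ge0.
have xi i : `|x i 0| <= 1.
  rewrite -(@ler_pXn2r _ 4)// ?nnegrE// expr1n -normrX ger0_norm ?expr4_ge0//.
  apply: le_trans S1; rewrite (bigD1 i)//= lerDl.
  by apply: sumr_ge0 => j _; exact: expr4_ge0.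
have Ai i : `|(A *m x) i 0| <= K.
  rewrite mxE (le_trans (ler_norm_sum _ _ _))//.
  apply: (le_trans (y := \sum_j `|A i j|)); last first.
    rewrite /K [leRHS](bigD1 i)//= lerDl.
    by apply: sumr_ge0 => k _; apply: sumr_ge0.
  by apply: ler_sum => j _; rewrite normrM -[leRHS]mulr1 ler_wpM2l.
have S2 : \sum_i (A *m x) i 0 ^+ 4 <= n%:R * K ^+ 4.
  have -> : n%:R * K ^+ 4 = \sum_(i < n) K ^+ 4 by rewrite sumr_const card_ord mulr_natl.
  apply: ler_sum => i _; rewrite -[leLHS]ger0_norm ?expr4_ge0// normrX.
  by rewrite lerXn2r ?nnegrE.
rewrite -l4norm_exp4 in S2.
have N0 := l4norm_ge0 (A *m x).
(* The bound at hand is on the fourth power, which dominates the norm itself only when the norm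
   exceeds 1. *)
have [l1|l1] := leP (l4norm (A *m x)) 1.
  by rewrite (le_trans l1)// lerDl mulr_ge0// expr4_ge0.
apply: (le_trans _ (y := l4norm (A *m x) ^+ 4)); last by lra.
by rewrite -[leLHS]expr1; apply: ler_weXn2l => //; exact: ltW.
Qed.

Lemma mv_l4 x : \sum_i mv x i ^+ 4 <= rho ^+ 4 * \sum_i x i ^+ 4.
Proof.
have /andP[r0 r1] := hrho.
set S := \sum_i x i ^+ 4.
have S0 : 0 <= S by apply: sumr_ge0 => i _; exact: expr4_ge0.
pose X : 'cV[R]_n := \col_j x j.
have eS : S = l4norm X ^+ 4 by rewrite l4norm_exp4; apply: eq_bigr => i _; rewrite mxE.
have eA : \sum_i mv x i ^+ 4 = l4norm (A *m X) ^+ 4.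
  by rewrite l4norm_exp4; apply: eq_bigr => i _; rewrite -mv_mulmx.
have [X0|X0] := eqVneq (l4norm X) 0.
  have x0 i : x i = 0.
    suff /eqP : x i ^+ 4 = 0 by rewrite expf_eq0/= => /eqP.
    apply/eqP; have : S <= 0 by rewrite eS X0 expr0n.
    rewrite /S (bigD1 i)//= => h; rewrite eq_le expr4_ge0 andbT.
    apply: le_trans h; rewrite lerDl.
    by apply: sumr_ge0 => j _; exact: expr4_ge0.
  rewrite [leLHS]big1; first by apply: mulr_ge0 => //; exact: expr4_ge0.
  move=> i _; by rewrite /mv big1 ?expr0n// => j _; rewrite x0 mulr0.
have Np : 0 < l4norm X by rewrite lt_def X0 l4norm_ge0.
pose Y := (l4norm X)^-1 *: X.
have Y1 : l4norm Y <= 1.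
  rewrite -(@ler_pXn2r _ 4)// ?nnegrE ?l4norm_ge0// expr1n l4norm_exp4.
  rewrite (eq_bigr (fun i => (l4norm X)^-1 ^+ 4 * X i 0 ^+ 4)); last first.
    by move=> i _; rewrite mxE exprMn.
  by rewrite -mulr_sumr -l4norm_exp4 -exprMn mulVf// expr1n.
have : l4norm (A *m Y) <= rho.
  apply: le_trans oA; apply: (ub_le_sup opnorm4_has_sup.2).
  by exists Y.
move=> hY; have {hY} : l4norm (A *m Y) ^+ 4 <= rho ^+ 4.
  by rewrite lerXn2r ?nnegrE ?l4norm_ge0// ltW.
rewrite l4norm_exp4 (eq_bigr (fun i => (l4norm X)^-1 ^+ 4 * (A *m X) i 0 ^+ 4)); last first.
  by move=> i _; rewrite -scalemxAr mxE exprMn.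
rewrite -mulr_sumr -l4norm_exp4 exprVn mulrC ler_pdivrMr ?exprn_gt0//.
by rewrite -eA -eS.
Qed.

Lemma mv_sym x y : \sum_i mv x i * y i = \sum_i x i * mv y i.
Proof.
rewrite /mv (eq_bigr (fun i => \sum_j A i j * x j * y i)); last by move=> i _; rewrite mulr_suml.
rewrite exchange_big/=; apply: eq_bigr => i _; rewrite mulr_sumr.
by apply: eq_bigr => j _; rewrite coupling_sym; ring.
Qed.

(* The norms of the iterates [A^k x] are log-convex in [k], so a stretching by
   more than [rho] in l2 would persist and contradict the l4 contraction. *)
Lemma mv_l2 x : \sum_i mv x i ^+ 2 <= rho ^+ 2 * \sum_i x i ^+ 2.
Proof.
have /andP[r0 r1] := hrho.
pose v k := iter k mv x.
pose a k := \sum_i v k i ^+ 2.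
have a0 k : 0 <= a k by apply: sumr_ge0 => i _; exact: sqr_ge0.
(* By symmetry of [A], the squared norm of A^(k+1) x is the inner product of A^k x and A^(k+2) x. *)
have lc k : a k.+1 ^+ 2 <= a k * a k.+2.
  have -> : a k.+1 = \sum_i v k i * v k.+2 i.
    have := mv_sym (v k) (v k.+1); rewrite /a /v /= => <-.
    by apply: eq_bigr => i _; rewrite expr2.
  exact: cauchy_schwarz_sum.
rewrite leNgt; apply/negP => h.
have ap : 0 < a 0%N.
  rewrite lt_def a0 andbT; apply/negP => /eqP a00.
  have : a 1%N ^+ 2 <= 0 by rewrite (le_trans (lc 0%N))// a00 mul0r.
  rewrite le_eqVlt ltNge sqr_ge0 orbF expf_eq0/= => /eqP a10.
  by move: h; rewrite -/(a 0%N) a00 mulr0 -[ltRHS]/(a 1%N) a10 ltxx.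
pose k := a 1%N / a 0%N.
have kr : rho ^+ 2 < k by rewrite ltr_pdivlMr.
have k0 : 0 < k by apply: lt_trans kr; rewrite exprn_gt0.
have stp m : 0 < a m /\ k * a m <= a m.+1.
  elim: m => [|m [am hm]]; first by split=> //; rewrite /k divfK// gt_eqF.
  have am1 : 0 < a m.+1 by apply: lt_le_trans hm; rewrite mulr_gt0.
  split=> //; rewrite -(ler_pM2l am); apply: le_trans (lc m).
  by rewrite mulrCA mulrA expr2 ler_wpM2r// ltW.
have gr m : k ^+ m * a 0%N <= a m.
  elim: m => [|m IH]; first by rewrite expr0 mul1r.
  by rewrite exprS -mulrA (le_trans _ (stp m).2)// ler_wpM2l// ltW.
pose S := \sum_i x i ^+ 4.
(* Passing from l4 to l2 costs a factor depending on [n], harmless against the geometric growth in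
   [m]. *)
have up m : a m ^+ 2 <= n%:R * (rho ^+ 4) ^+ m * S.
  have s4 : \sum_i v m i ^+ 4 <= (rho ^+ 4) ^+ m * S.
    elim: m => [|m IH]; first by rewrite expr0 mul1r.
    rewrite exprS -mulrA; apply: le_trans (mv_l4 (v m)) _.
    by rewrite ler_wpM2l// expr4_ge0.
  have := cauchy_schwarz_sum (fun=> 1) (fun i => v m i ^+ 2).
  rewrite (eq_bigr (fun i => v m i ^+ 2)); last by move=> i _; rewrite mul1r.
  move=> /le_trans; apply; rewrite expr1n sumr_const card_ord -mulrA ler_wpM2l//.
  by apply: le_trans s4; apply: ler_sum => i _; rewrite -exprM.
apply: (@exp_not_bounded R (k ^+ 2 / rho ^+ 4) (n%:R * S / a 0%N ^+ 2)).
  rewrite ltr_pdivlMr ?exprn_gt0// mul1r (_ : rho ^+ 4 = (rho ^+ 2) ^+ 2); last by rewrite -exprM.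
  by rewrite ltrXn2r ?nnegrE ?sqr_ge0// ltW.
move=> m; rewrite expr_div_n ler_pdivrMr ?exprn_gt0// mulrAC ler_pdivlMr ?exprn_gt0//.
rewrite -exprM mulnC exprM -exprMn mulrAC; apply: le_trans (up m).
by rewrite lerXn2r ?nnegrE ?mulr_ge0// exprn_ge0// ltW.
Qed.

Lemma alpha_row i : \sum_j A i j ^+ 2 <= alpha A.
Proof. exact: le_bigmax. Qed.

Lemma alpha_ge0 : 0 <= alpha A.
Proof. exact: bigmax_ge_id. Qed.

Lemma alpha_le : alpha A <= rho ^+ 2.
Proof.
apply: bigmax_le; first exact: sqr_ge0.
move=> i _; have := mv_l2 (fun j => (j == i)%:R).
rewrite [X in _ * X](_ : _ = 1) ?mulr1; last first.
  by rewrite (bigD1 i)//= eqxx expr1n big1 ?addr0// => j /negPf ->; rewrite expr0n.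
apply: le_trans; apply: ler_sum => j _; rewrite /mv (bigD1 i)//= eqxx mulr1 big1 ?addr0 1?coupling_sym//.
by move=> k /negPf ->; rewrite mulr0.
Qed.

(** Schur's test for the matrix of squared entries, whose row and column sums are at most
    [alpha A]. *)
Lemma mv_sqr_l2 x :
  \sum_j (\sum_k A j k ^+ 2 * `|x k|) ^+ 2 <= alpha A ^+ 2 * \sum_k x k ^+ 2.
Proof.
have al0 := alpha_ge0.
have h j : (\sum_k A j k ^+ 2 * `|x k|) ^+ 2 <= alpha A * \sum_k A j k ^+ 2 * x k ^+ 2.
  have := cauchy_schwarz_sum (fun k => A j k) (fun k => A j k * `|x k|).
  rewrite (eq_bigr (fun k => A j k ^+ 2 * `|x k|)); last by move=> k _; rewrite mulrA -expr2.
  move=> /le_trans; apply; apply: ler_pM => //.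
  - by apply: sumr_ge0 => k _; exact: sqr_ge0.
  - by apply: sumr_ge0 => k _; exact: sqr_ge0.
  - exact: alpha_row.
  - by apply: ler_sum => k _; rewrite exprMn real_normK ?num_real.
apply: (le_trans (y := \sum_j alpha A * \sum_k A j k ^+ 2 * x k ^+ 2)).
  exact: ler_sum.
rewrite -mulr_sumr expr2 -mulrA ler_wpM2l// exchange_big/= mulr_sumr.
apply: ler_sum => k _; rewrite -mulr_suml ler_wpM2r ?sqr_ge0//.
by apply: le_trans (alpha_row k); apply: ler_sum => j _; rewrite coupling_sym.
Qed.

(** Solves v = (1 - A D) w with control of w. Testing the linearised mean-field equation against w
    then produces the linear form with coefficients v. *)
Lemma resolvent (D v : 'I_n -> R) : (forall i, `|D i| <= 1) ->
  exists2 w : 'I_n -> R, forall j, v j = w j - \sum_i A j i * (D i * w i) &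
    (1 - rho) ^+ 2 * \sum_i w i ^+ 2 <= \sum_i v i ^+ 2.
Proof.
have /andP[r0 r1] := hrho.
move=> D1; pose M : 'M[R]_n := 1%:M - A *m diag_mx (\row_i D i).
have Mw (w : 'cV[R]_n) j : (M *m w) j 0 = w j 0 - \sum_i A j i * (D i * w i 0).
  rewrite mulmxBl mul1mx -mulmxA mxE [in X in _ + X]mxE [in X in _ - X]mxE.
  congr (_ - _).
  by apply: eq_bigr => i _; rewrite mul_diag_mx !mxE.
have D2 i : D i ^+ 2 <= 1 by rewrite -[D i ^+ 2]real_normK ?num_real// expr_le1.
have Mu : M \in unitmx.
  rewrite -row_free_unit -kermx_eq0; apply/eqP/row_matrixP => k; rewrite row0.
  set r := row k (kermx M).
  have : r *m M = 0 by rewrite -row_mul mulmx_ker row0.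
  (* A left kernel vector r satisfies r = D A r, which contracts the l2 norm by rho < 1, so r
     vanishes. *)
  rewrite mulmxBr mulmx1 => /eqP; rewrite subr_eq0 => /eqP rE.
  have re j : r 0 j = D j * mv (fun i => r 0 i) j.
    rewrite {1}rE mulmxA mul_mx_diag mxE mulrC mxE [in RHS]/mv mxE; congr (_ * _).
    by apply: eq_bigr => i _; rewrite coupling_sym mulrC.
  have S0 : 0 <= \sum_j r 0 j ^+ 2 by apply: sumr_ge0 => j _; exact: sqr_ge0.
  have : \sum_j r 0 j ^+ 2 <= rho ^+ 2 * \sum_j r 0 j ^+ 2.
    apply: le_trans (mv_l2 _); apply: ler_sum => j _; rewrite {1}re exprMn.
    by rewrite -[leRHS]mul1r ler_wpM2r ?sqr_ge0.
  have r2 : rho ^+ 2 < 1 by rewrite expr_lt1// ltW.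
  move=> h; have Sz : \sum_j r 0 j ^+ 2 <= 0 by nra.
  apply/rowP => j; rewrite [RHS]mxE; apply/eqP; rewrite -sqrf_eq0 eq_le sqr_ge0 andbT.
  by apply: le_trans Sz; exact: (sum_sqr_le_max (fun j => r 0 j)).
pose w := invmx M *m (\col_i v i).
have vE j : v j = w j 0 - \sum_i A j i * (D i * w i 0).
  by rewrite -Mw /w mulKVmx// mxE.
exists (fun i => w i 0) => //.
apply: (sum_contraction2 (z := mv (fun i => D i * w i 0)) hrho).
  by move=> i; rewrite vE subrK.
apply: le_trans (mv_l2 _) _; rewrite ler_wpM2l ?sqr_ge0//; apply: ler_sum => i _.
by rewrite exprMn -[leRHS]mul1r ler_wpM2r ?sqr_ge0.
Qed.

End matrices.

(** * Moments under the Gibbs measure *)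

Section moments.
Context d (T : measurableType d) (R : realType) (P : probability T R).
Variables (w : T -> R) (hw : weight P w) (n : nat).
Variables (a : 'I_n -> R) (Y fi : 'I_n -> T -> R) (C : R).
Hypothesis BY : forall j, BM (Y j).
Hypothesis Bfi : forall j, BM (fi j).
Hypothesis Y2 : forall j x, `|Y j x| <= 2.
Let f x := \sum_j a j * Y j x.
Let N := \sum_j a j ^+ 2.
Hypothesis C0 : 0 <= C.
Hypothesis fi2 : forall x, \sum_j (f x - fi j x) ^+ 2 <= C ^+ 2 * N.
Hypothesis orth1 : forall j, Ex P w (fun x => Y j x * fi j x) = 0.
Hypothesis orth3 : forall j, Ex P w (fun x => Y j x * fi j x ^+ 3) = 0.

Let N0 : 0 <= N. Proof. by apply: sumr_ge0 => j _; exact: sqr_ge0. Qed.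
Let Bf : BM f. Proof. by BM. Qed.

Let dev x : \sum_j `|a j| * `|f x - fi j x| <= C * N.
Proof.
have := @sum_mul_le R n a (fun j => f x - fi j x) (Num.sqrt N) (C * Num.sqrt N) (sqrtr_ge0 _) _ _ _.
rewrite mulrCA -expr2 sqr_sqrtr//; apply.
- by rewrite mulr_ge0// sqrtr_ge0.
- by [].
- by rewrite exprMn sqr_sqrtr.
Qed.

(** Here [fi j] is a surrogate of [f] orthogonal to [Y j]. Expanding one factor of f^2 as a sum of
    [a j * Y j], the other factor may be replaced by [f - fi j], which is small in l2 over j. *)
Lemma moment2 : Ex P w (fun x => f x ^+ 2) <= 2 * C * N.
Proof.
have -> : Ex P w (fun x => f x ^+ 2) = Ex P w (fun x => \sum_j a j * (Y j x * (f x - fi j x))).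
  transitivity (Ex P w (fun x => \sum_j a j * (Y j x * f x))).
    by apply: eq_Ex => x; rewrite expr2 {1}/f mulr_suml; apply: eq_bigr => j _; rewrite mulrA.
  rewrite !(Ex_sum hw); [|by move=> j; apply: BMM; BM|by move=> j; BM].
  apply: eq_bigr => j _; rewrite !(ExZ hw); [|by BM..]; congr (_ * _).
  rewrite [RHS](_ : _ = Ex P w (fun x => Y j x * f x - Y j x * fi j x)).
    by rewrite (ExB hw) ?orth1 ?subr0//; BM.
  by apply: eq_Ex => x; rewrite mulrBr.
apply: (Ex_le_cst hw) => [|x]; first by BM.
apply: le_trans (ler_norm _) _; apply: le_trans (ler_norm_sum _ _ _) _.
rewrite -mulrA; apply: le_trans (ler_wpM2l _ (dev x)) => //.
rewrite mulr_sumr; apply: ler_sum => j _.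
by rewrite !normrM mulrCA ler_wpM2r// mulr_ge0.
Qed.

(** As for the second moment, with f^3 - (fi j)^3 as increment: the factor f - fi j is summed by
    Cauchy-Schwarz and what remains is controlled by f^2, hence by [moment2]. *)
Lemma moment4 : Ex P w (fun x => f x ^+ 4) <= (20 * C ^+ 2 + 6 * C ^+ 3) * N ^+ 2.
Proof.
have -> : Ex P w (fun x => f x ^+ 4) = Ex P w (fun x => \sum_j a j * (Y j x * (f x ^+ 3 - fi j x ^+ 3))).
  transitivity (Ex P w (fun x => \sum_j a j * (Y j x * f x ^+ 3))).
    by apply: eq_Ex => x; rewrite exprS {1}/f mulr_suml; apply: eq_bigr => j _; rewrite mulrA.
  rewrite !(Ex_sum hw); [|by move=> j; apply: BMM; BM|by move=> j; BM].
  apply: eq_bigr => j _; rewrite !(ExZ hw); [|by BM..]; congr (_ * _).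
  rewrite [RHS](_ : _ = Ex P w (fun x => Y j x * f x ^+ 3 - Y j x * fi j x ^+ 3)).
    by rewrite (ExB hw) ?orth3 ?subr0//; BM.
  by apply: eq_Ex => x; rewrite mulrBr.
have Bf2 : BM (fun x => f x ^+ 2) by BM.
apply: (le_trans (y := Ex P w (fun x => 2 * (C * N) * (5 * f x ^+ 2 + 3 * (C ^+ 2 * N))))); last first.
  rewrite (ExZ hw); last by BM.
  rewrite (ExD hw); [|by BM..]; rewrite (ExZ hw)// (Ex_cst hw).
  have h := moment2; have CN : 0 <= C * N by rewrite mulr_ge0.
  have -> : (20 * C ^+ 2 + 6 * C ^+ 3) * N ^+ 2 = 2 * (C * N) * (5 * (2 * C * N) + 3 * (C ^+ 2 * N)) by ring.
  by rewrite ler_wpM2l ?mulr_ge0// lerD2r ler_wpM2l.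
apply: (Ex_le hw) => [||x]; [by BM|by BM|].
apply: le_trans (ler_norm _) _; apply: le_trans (ler_norm_sum _ _ _) _.
have K0 : 0 <= 5 * f x ^+ 2 + 3 * (C ^+ 2 * N).
  by rewrite addr_ge0// mulr_ge0// ?sqr_ge0// mulr_ge0// sqr_ge0.
apply: (le_trans (y := 2 * (\sum_j `|a j| * `|f x - fi j x|) * (5 * f x ^+ 2 + 3 * (C ^+ 2 * N)))); last first.
  by rewrite ler_wpM2r// ler_wpM2l.
rewrite mulr_sumr mulr_suml; apply: ler_sum => j _.
set D := f x - fi j x.
have D2 : D ^+ 2 <= C ^+ 2 * N.
  by apply: le_trans (fi2 x); exact: (sum_sqr_le_max (fun j => f x - fi j x)).
have -> : f x ^+ 3 - fi j x ^+ 3 = D * (3 * f x ^+ 2 - 3 * f x * D + D ^+ 2) by rewrite /D; ring.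
rewrite !normrM.
have -> : `|a j| * (`|Y j x| * (`|D| * `|3 * f x ^+ 2 - 3 * f x * D + D ^+ 2|)) =
  (`|Y j x| * (`|a j| * `|D|)) * `|3 * f x ^+ 2 - 3 * f x * D + D ^+ 2| by ring.
apply: ler_pM => //.
- by rewrite ler_wpM2r// mulr_ge0.
- have := sqr_ge0 (f x - D); have := sqr_ge0 (f x + D); have := sqr_ge0 (f x); have := sqr_ge0 D.
  have -> : (f x - D) ^+ 2 = f x ^+ 2 - 2 * (f x * D) + D ^+ 2 by ring.
  have -> : (f x + D) ^+ 2 = f x ^+ 2 + 2 * (f x * D) + D ^+ 2 by ring.
  rewrite (_ : 3 * f x * D = 3 * (f x * D)); last by ring.
  move: D2; move: (f x ^+ 2) (D ^+ 2) (f x * D) (C ^+ 2 * N) => p q r m *.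
  by rewrite ler_norml; apply/andP; split; lra.
Qed.

End moments.

(** * The Gibbs measure: conditional laws, detailed balance and moments *)

Section gibbs.
Context {R : realType}.
Local Notation RR := (measurableTypeR R).
Variables (mu : probability RR R) (n : nat) (A : 'M[R]_n) (rho : R).
Hypothesis hrho : 0 < rho < 1.
Hypothesis cA : coupling A.
Hypothesis oA : opnorm4 A <= rho.
Variable c : 'I_n -> R.
Local Notation cfg := (n.-tuple RR).

Definition spin (s : cfg) (i : 'I_n) : R := clip (tnth s i).
Definition ham (s : cfg) : R :=
  (\sum_i spin s i * mv A (spin s) i) / 2 + \sum_i c i * spin s i.
Definition gibbs_norm : R := \int[iid mu n]_s expR (ham s).
Definition gw (s : cfg) : R := expR (ham s) / gibbs_norm.
(** The local field at i. Since [A] has zero diagonal it does not involve spin i, so [bm i] below is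
    the conditional mean of that spin given the others. *)
Definition th (i : 'I_n) (s : cfg) : R := mv A (spin s) i + c i.
Definition bm (i : 'I_n) (s : cfg) : R := m1 mu (th i s).

Local Notation E := (Ex (iid mu n) gw).

Lemma spin_norm s i : `|spin s i| <= 1. Proof. exact: clip_norm. Qed.

Lemma spin_sqr s i : spin s i ^+ 2 <= 1. Proof. exact: clip_sqr. Qed.

Lemma BM_spin i : BM (fun s : cfg => spin s i).
Proof.
split; last by exists 1 => s; exact: spin_norm.
exact: (measurableT_comp measurable_clip (measurable_tnth i)).
Qed.

Lemma BM_mv_spin i : BM (fun s : cfg => mv A (spin s) i).
Proof. by apply: BM_sum => j; apply: BMM; [exact: BM_cst | exact: BM_spin]. Qed.

Lemma BM_th i : BM (th i).
Proof. by apply: BMD; [exact: BM_mv_spin | exact: BM_cst]. Qed.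

Lemma BM_bm i : BM (bm i).
Proof. by apply: BM_comp (BM_th i); exact: continuous_m1. Qed.

Lemma BM_tvar_th i : BM (fun s => tvar mu (th i s)).
Proof. by apply: BM_comp (BM_th i); exact: continuous_tvar. Qed.

Lemma BM_ham : BM ham.
Proof.
apply: BMD; last by apply: BM_sum => i; apply: BMM; [exact: BM_cst | exact: BM_spin].
apply: BMM; last exact: BM_cst.
by apply: BM_sum => i; apply: BMM; [exact: BM_spin | exact: BM_mv_spin].
Qed.

Lemma BM_expham : BM (fun s : cfg => expR (ham s)).
Proof. by apply: (BM_comp (h := expR)); [exact: continuous_expR | exact: BM_ham]. Qed.

Lemma gibbs_norm_gt0 : 0 < gibbs_norm.
Proof.
have [_ [K hK]] := BM_ham.
apply: (lt_le_trans (expR_gt0 (- K))).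
have := @Ex_ge_cst _ _ _ _ _ (weight1 (iid mu n)) _ (expR (- K)) BM_expham _.
rewrite /Ex; under eq_Rintegral do rewrite mul1r; apply => s.
by rewrite ler_expR; have := hK s; rewrite ler_norml => /andP[].
Qed.

Lemma BM_gw : BM gw.
Proof. by apply: BMM; [exact: BM_expham | exact: BM_cst]. Qed.

Lemma weight_gw : weight (iid mu n) gw.
Proof.
split; first exact: BM_gw.
  by move=> s; rewrite divr_ge0 ?expR_ge0// ltW// gibbs_norm_gt0.
rewrite /gw RintegralZr//; last exact: BM_integrable BM_expham.
by rewrite divff// gt_eqF// gibbs_norm_gt0.
Qed.

Lemma spin_upd s i z j : spin (upd s i z) j = if j == i then clip z else spin s j.
Proof. by rewrite /spin tnth_upd; case: (j == i). Qed.

Lemma spin_updE s i z j : spin (upd s i z) j = spin s j + (j == i)%:R * (clip z - spin s i).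
Proof. by rewrite spin_upd; case: eqP => [->|_]; rewrite ?mul1r ?mul0r; ring. Qed.

Lemma mv_spin_upd s i z k :
  mv A (spin (upd s i z)) k = mv A (spin s) k + A k i * (clip z - spin s i).
Proof.
rewrite /mv (eq_bigr (fun j => A k j * spin s j + A k j * ((j == i)%:R * (clip z - spin s i)))); last first.
  by move=> j _; rewrite spin_updE mulrDr.
rewrite big_split/=; congr (_ + _).
by rewrite (bigD1 i)//= eqxx mul1r big1 ?addr0// => j /negPf ->; rewrite mul0r mulr0.
Qed.

Lemma th_upd s i z k : th k (upd s i z) = th k s + A k i * (clip z - spin s i).
Proof. by rewrite /th mv_spin_upd addrAC. Qed.

Lemma th_upd_same s i z : th i (upd s i z) = th i s.
Proof. by case: cA => _ d0; rewrite th_upd d0 mul0r addr0. Qed.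

(** The zero diagonal removes the quadratic term in the increment, so the Hamiltonian is affine in
    each spin with slope the local field. This identifies the conditional laws as tilts of [mu]. *)
Lemma ham_upd s i z : ham (upd s i z) = ham s + th i s * (clip z - spin s i).
Proof.
have delta (f : 'I_n -> R) : \sum_j (j == i)%:R * f j = f i.
  by rewrite (bigD1 i)//= eqxx mul1r big1 ?addr0// => j /negPf ->; rewrite mul0r.
rewrite /ham; set d := clip z - spin s i.
have -> : \sum_j c j * spin (upd s i z) j = \sum_j c j * spin s j + c i * d.
  rewrite -(delta (fun j => c j * d)) -big_split/=; apply: eq_bigr => j _.
  by rewrite spin_updE -/d; ring.
have -> : \sum_j spin (upd s i z) j * mv A (spin (upd s i z)) j =
    \sum_j spin s j * mv A (spin s) j + d * (\sum_j A j i * spin s j) + d * mv A (spin s) i + d ^+ 2 * A i i.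
  rewrite -(delta (fun j => d * mv A (spin s) j)) -(delta (fun j => d ^+ 2 * A j i)).
  rewrite mulr_sumr -!big_split/=; apply: eq_bigr => j _.
  by rewrite spin_updE mv_spin_upd -/d; ring.
have -> : \sum_j A j i * spin s j = mv A (spin s) i.
  by apply: eq_bigr => j _; rewrite (coupling_sym cA).
case: cA => _ d0; rewrite d0 /th; by field.
Qed.

Lemma BM_tilted_th i : BM (fun p : cfg * RR => tilted mu (th i p.1) p.2).
Proof.
have B1 : BM (fun p : cfg * RR => th i p.1).
  case: (BM_th i) => mt [M hM]; split; last by exists M.
  exact: (measurableT_comp mt measurable_fst).
have B2 : BM (fun p : cfg * RR => clip p.2).
  split; last by exists 1 => p; exact: clip_norm.
  exact: (measurableT_comp measurable_clip measurable_snd).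
apply: BMM.
  by apply: (BM_comp (h := expR)); [exact: continuous_expR | exact: BMM].
apply: (BM_comp (h := fun t => (mgf mu t)^-1)) B1 => t.
apply: continuousV; first by rewrite gt_eqF// mgf_gt0.
by apply: (is_derive_continuous (fun t => tilt_int_derive mu t (BM_cst _ 1))).
Qed.

(* [E2 i k] is the expectation of [k (s, z)], where [z] is resampled from the
   conditional law of the [i]-th spin. *)
Definition E2 i (k : cfg * RR -> R) : R := E (fun s => tmean mu (fun z => k (s, z)) (th i s)).

Lemma BM_tmean i k : BM k -> BM (fun s => tmean mu (fun z => k (s, z)) (th i s)).
Proof. by move=> Bk; exact: (BM_Rintegral (iid mu n) mu (BMM (BM_tilted_th i) Bk)). Qed.

(** Exchangeability of the pair (configuration, resampled value): the local field is the same before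
    and after resampling, so the product of the Gibbs and tilt densities is symmetric in the two
    values. *)
Lemma E2_swap i k : BM k -> E2 i k = E2 i (fun p => k (upd p.1 i p.2, tnth p.1 i)).
Proof.
move=> Bk.
have := @exchangeable_resampling _ mu _ i _ _ _ BM_gw (BM_tilted_th i) Bk.
rewrite /E2 /Ex /tmean /Ex /=; apply => s y z.
rewrite /= /gw /tilted !th_upd_same !ham_upd.
rewrite mulrACA [RHS]mulrACA -!expRD; congr (expR _ * _); ring.
Qed.

Lemma E2_le i k k' : BM k -> BM k' -> (forall p, k p <= k' p) -> E2 i k <= E2 i k'.
Proof.
move=> Bk Bk' kk'; apply: (Ex_le weight_gw); [exact: BM_tmean..|move=> s].
by apply: (Ex_le (weight_tilted _ _)) => //; exact: BM_curry.
Qed.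

Lemma E2B i k k' : BM k -> BM k' -> E2 i (fun p => k p - k' p) = E2 i k - E2 i k'.
Proof.
move=> Bk Bk'; rewrite /E2 -(ExB weight_gw); [|exact: BM_tmean..].
apply: eq_Ex => s; apply: (ExB (weight_tilted _ _)); exact: BM_curry.
Qed.

Lemma E2Z i r k : BM k -> E2 i (fun p => r * k p) = r * E2 i k.
Proof.
move=> Bk; rewrite /E2 -(ExZ weight_gw); last exact: BM_tmean.
apply: eq_Ex => s; apply: (ExZ (weight_tilted _ _)); exact: BM_curry.
Qed.

Lemma BM_fst (h : cfg -> R) : BM h -> BM (fun p : cfg * RR => h p.1).
Proof.
move=> [mt [M hM]]; split; last by exists M.
exact: (measurableT_comp mt measurable_fst).
Qed.

Lemma E2_fst i (h : cfg -> R) : E2 i (fun p => h p.1) = E h.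
Proof. by apply: eq_Ex => s; exact: (Ex_cst (weight_tilted mu (th i s)) (h s)). Qed.

Lemma E2_mul i (h : cfg -> R) k : BM k ->
  E2 i (fun p => h p.1 * k p) = E (fun s => h s * tmean mu (fun z => k (s, z)) (th i s)).
Proof.
move=> Bk; apply: eq_Ex => s.
exact: (ExZ (weight_tilted mu (th i s)) (h s) (BM_curry s Bk)).
Qed.

(** Conditioning on the spins other than i: [g] has conditional mean zero and [h] is a function of
    those spins. *)
Lemma E_orthogonal i (g h : cfg -> R) : BM g -> BM h ->
  (forall s z, h (upd s i z) = h s) ->
  (forall s, tmean mu (fun z => g (upd s i z)) (th i s) = 0) ->
  E (fun s => g s * h s) = 0.
Proof.
move=> Bg Bh hi g0.
have Bk : BM (fun p : cfg * RR => h p.1 * g (upd p.1 i p.2)).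
  by apply: BMM; [exact: BM_fst | exact: BM_upd].
have := E2_swap i Bk; rewrite /E2 /=.
have -> : E (fun s => tmean mu (fun z => h s * g (upd s i z)) (th i s)) = 0.
  transitivity (E (fun _ => 0)); last exact: (Ex_cst weight_gw).
  apply: eq_Ex => s; apply: etrans (ExZ (weight_tilted mu (th i s)) (h s) (BM_curry s (BM_upd i Bg))) _.
  by rewrite /= -/(tmean mu _ (th i s)) g0 mulr0.
move=> e; rewrite [RHS]e; apply: eq_Ex => s.
rewrite /tmean -[LHS](Ex_cst (weight_tilted mu (th i s))).
by apply: eq_Ex => z; rewrite hi upd_upd upd_tnth mulrC.
Qed.

Definition resid (i : 'I_n) (s : cfg) : R := spin s i - bm i s.

Lemma BM_resid i : BM (resid i).
Proof. by apply: BMB; [exact: BM_spin | exact: BM_bm]. Qed.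

Lemma bm_norm i s : `|bm i s| <= 1.
Proof. exact: m1_norm. Qed.

Lemma resid_norm i s : `|resid i s| <= 2.
Proof.
by rewrite (le_trans (ler_normB _ _))// (_ : 2 = 1 + 1)// lerD// ?spin_norm// bm_norm.
Qed.

Lemma resid_upd i s z : resid i (upd s i z) = clip z - bm i s.
Proof. by rewrite /resid /bm th_upd_same spin_upd eqxx. Qed.

Lemma resid_centered i s : tmean mu (fun z => resid i (upd s i z)) (th i s) = 0.
Proof.
have W := weight_tilted mu (th i s).
transitivity (Ex mu (tilted mu (th i s)) (fun z => clip z - bm i s)).
  by apply: eq_Ex => z; rewrite resid_upd.
by rewrite (ExB W BM_clip (BM_cst _ _)) (Ex_cst W) /bm m1E subrr.
Qed.

Lemma E_resid i (h : cfg -> R) : BM h -> (forall s z, h (upd s i z) = h s) ->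
  E (fun s => resid i s * h s) = 0.
Proof.
move=> Bh hi; apply: (@E_orthogonal i) => //; first exact: BM_resid.
exact: resid_centered.
Qed.

Lemma BM_freeze i (h : cfg -> R) z : BM h -> BM (fun s => h (upd s i z)).
Proof.
move=> [mt [M hM]]; split; last by exists M.
have mp : measurable_fun setT (fun s : cfg => (s, z : RR)).
  by apply/measurable_fun_pairP; split; [exact: measurable_id | exact: measurable_cst].
exact: (measurableT_comp mt (measurableT_comp (measurable_upd i) mp)).
Qed.

Section linear_forms.
Variable a : 'I_n -> R.
Let N := \sum_j a j ^+ 2.
Let f (s : cfg) := \sum_j a j * resid j s.

Lemma clip0 : clip (0 : R) = 0.
Proof. by apply: clip_id; apply/andP; split; lra. Qed.

(** Setting spin j to 0 changes its own residual directly and all others through their conditional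
    means. To first order this gives a - A D a, an l2-bounded operation; the second-order part is
    handled by [mv_sqr_l2]. *)
Lemma resid_form_increments s : \sum_j (f s - f (upd s j 0)) ^+ 2 <= 8 ^+ 2 * N.
Proof.
have /andP[r0 r1] := hrho.
have N0 : 0 <= N by apply: sumr_ge0 => j _; exact: sqr_ge0.
pose D k := tvar mu (th k s).
pose r j k := m1 mu (th k s + A k j * (0 - spin s j)) - m1 mu (th k s) - A k j * (0 - spin s j) * D k.
have r4 j k : `|r j k| <= 4 * A j k ^+ 2.
  apply: le_trans (m1_taylor _ _ _) _; rewrite ler_wpM2l// sub0r mulrN sqrrN exprMn.
  by rewrite (coupling_sym cA) -[leRHS]mulr1 ler_wpM2l ?sqr_ge0// spin_sqr.
have fE j : f s - f (upd s j 0) = spin s j * (a j - mv A (fun k => D k * a k) j) + \sum_k a k * r j k.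
  have -> : f s - f (upd s j 0) = \sum_k (a k * ((k == j)%:R * spin s j)
       - spin s j * (A j k * (D k * a k)) + a k * r j k).
    rewrite /f -sumrB; apply: eq_bigr => k _.
    rewrite /resid /bm th_upd spin_updE clip0 /r /D (coupling_sym cA j k).
    move: (m1 mu (th k s)) (m1 mu (th k s + A k j * (0 - spin s j))) (tvar mu (th k s)) => x y z.
    by ring.
  rewrite big_split sumrB/= mulrBr; congr (_ - _ + _); last by rewrite /mv mulr_sumr.
  rewrite (bigD1 j)//= eqxx mul1r big1 ?addr0; first by rewrite mulrC.
  by move=> k /negPf ->; rewrite mul0r mulr0.
have al0 := alpha_ge0 A.
have al1 : alpha A <= 1.
  by rewrite (le_trans (alpha_le hrho cA oA))// expr_le1// ltW.
have D2 k : D k ^+ 2 <= 1 by rewrite -[D k ^+ 2]real_normK ?num_real// expr_le1 ?tvar_norm.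
pose B j := \sum_k A j k ^+ 2 * `|a k|.
(* The three sums are each at most [N] up to these factors, and 3 + 3 + 48 <= 8 ^ 2. *)
apply: (le_trans (y := \sum_j (3 * a j ^+ 2 + 3 * mv A (fun k => D k * a k) j ^+ 2 + 48 * B j ^+ 2))).
  apply: ler_sum => j _; rewrite fE.
  set p := a j; set q := mv A _ j; set e := \sum_k _.
  have e4 : e ^+ 2 <= 16 * B j ^+ 2.
    have -> : 16 * B j ^+ 2 = (4 * B j) ^+ 2 by ring.
    rewrite -[e ^+ 2]real_normK ?num_real// lerXn2r ?nnegrE//.
      by rewrite mulr_ge0//; apply: sumr_ge0 => k _; rewrite mulr_ge0// sqr_ge0.
    rewrite (le_trans (ler_norm_sum _ _ _))// /B mulr_sumr; apply: ler_sum => k _.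
    by rewrite normrM mulrA (mulrC `|a k|) ler_wpM2r.
  have s2 : (spin s j * (p - q)) ^+ 2 <= (p - q) ^+ 2.
    by rewrite exprMn -[leRHS]mul1r ler_wpM2r ?sqr_ge0// spin_sqr.
  move: s2 e4; move: (spin s j * (p - q)) => x x1 e4.
  have h1 : (x + e) ^+ 2 <= (3 / 2) * x ^+ 2 + 3 * e ^+ 2.
    rewrite -subr_ge0 (_ : _ - _ = (x - 2 * e) ^+ 2 / 2); last by field.
    by rewrite divr_ge0 ?sqr_ge0.
  have h2 : (p - q) ^+ 2 <= 2 * p ^+ 2 + 2 * q ^+ 2.
    rewrite -subr_ge0 (_ : _ - _ = (p + q) ^+ 2); last by ring.
    exact: sqr_ge0.
  by lra.
rewrite !big_split/= -!mulr_sumr -/N.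
have h1 : \sum_j mv A (fun k => D k * a k) j ^+ 2 <= N.
  apply: le_trans (mv_l2 hrho cA oA _) _.
  rewrite -[leRHS]mul1r ler_pM ?sqr_ge0//.
  - by apply: sumr_ge0 => j _; exact: sqr_ge0.
  - by rewrite expr_le1// ltW.
  - by apply: ler_sum => k _; rewrite exprMn -[leRHS]mul1r ler_wpM2r ?sqr_ge0.
have h2 : \sum_j B j ^+ 2 <= N.
  apply: le_trans (mv_sqr_l2 cA a) _.
  by rewrite -[leRHS]mul1r ler_wpM2r// expr_le1.
by lra.
Qed.

Lemma BM_resid_form : BM f.
Proof. by apply: BM_sum => j; apply: BMM; [exact: BM_cst | exact: BM_resid]. Qed.

Let orth k j : E (fun s => resid j s * f (upd s j 0) ^+ k) = 0.
Proof.
apply: E_resid; first by apply: BMX; exact: (BM_freeze j 0 BM_resid_form).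
by move=> s z; rewrite upd_upd.
Qed.

Lemma resid_moment2 : E (fun s => f s ^+ 2) <= 16 * N.
Proof.
have h := @moment2 _ _ _ _ _ weight_gw n a resid (fun j s => f (upd s j 0)) 8
  BM_resid (fun j => BM_freeze j 0 BM_resid_form) resid_norm _ resid_form_increments _.
rewrite (_ : 16 = 2 * 8); last by ring.
by apply: h => // j; have := orth 1 j; under eq_Ex do rewrite expr1.
Qed.

Lemma resid_moment4 : E (fun s => f s ^+ 4) <= 17 * 16 ^+ 2 * N ^+ 2.
Proof.
have h := @moment4 _ _ _ _ _ weight_gw n a resid (fun j s => f (upd s j 0)) 8
  BM_resid (fun j => BM_freeze j 0 BM_resid_form) resid_norm _ resid_form_increments _ _.
rewrite (_ : 17 * 16 ^+ 2 = 20 * 8 ^+ 2 + 6 * 8 ^+ 3); last by ring.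
apply: h => // j.
by have := orth 1 j; under eq_Ex do rewrite expr1.
Qed.

End linear_forms.

(** * Fluctuations of the spins around a solution u of the mean-field equation *)

Section mean_field.
Variable u : 'I_n -> R.
Hypothesis uE : forall i, u i = m1 mu (mv A u i + c i).

Definition fluct (i : 'I_n) (s : cfg) : R := mv A (spin s) i - mv A u i.

Lemma fluctE i s : fluct i s = mv A (fun j => spin s j - u j) i.
Proof. by rewrite /fluct /mv -sumrB; apply: eq_bigr => j _; rewrite mulrBr. Qed.

Lemma BM_fluct i : BM (fluct i).
Proof. by apply: BMB; [exact: BM_mv_spin | exact: BM_cst]. Qed.

Lemma th_fluct i s : th i s = (mv A u i + c i) + fluct i s.
Proof. by rewrite /th /fluct; ring. Qed.

Lemma bm_sub_u i s : `|bm i s - u i| <= `|fluct i s|.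
Proof.
rewrite uE /bm th_fluct; apply: le_trans (m1_lipschitz _ _ _) _.
by rewrite addrC addKr.
Qed.

Let K4 := 17 * 16 ^+ 2 * (n%:R * alpha A ^+ 2) / (1 - rho) ^+ 4.

Let c0 : 0 <= 17 * 16 ^+ 2 :> R.
Proof. by apply: mulr_ge0 => //; exact: sqr_ge0. Qed.

Lemma K4_ge0 : 0 <= K4.
Proof.
have /andP[r0 r1] := hrho.
apply: divr_ge0; last by apply: exprn_ge0; lra.
by apply: mulr_ge0; [exact: c0 | apply: mulr_ge0 => //; exact: sqr_ge0].
Qed.

(** Split A (sigma - u) into A applied to the residuals and A applied to bm - u. Since |bm - u| <=
    |fluct| coordinatewise, the l4 contraction absorbs the second part; row i of the first has
    fourth moment of order alpha^2. *)
Lemma E_fluct4 : E (fun s => \sum_i fluct i s ^+ 4) <= K4.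
Proof.
have /andP[r0 r1] := hrho; have s0 : 0 < 1 - rho by lra.
have Bf i := BM_fluct i; have Br i := BM_resid i.
pose g i s := \sum_j A i j * resid j s.
have Bg i : BM (g i) by apply: BM_sum => j; BM.
rewrite /K4 ler_pdivlMr ?exprn_gt0// mulrC.
rewrite -(ExZ weight_gw); last by BM.
apply: (le_trans (y := E (fun s => \sum_i g i s ^+ 4))).
  apply: (Ex_le weight_gw) => [||s]; [by BM|by BM|].
  apply: (sum_contraction4 (z := mv A (fun j => bm j s - u j)) hrho).
    move=> i; rewrite fluctE /g /mv -big_split/=; apply: eq_bigr => j _.
    by rewrite /resid; ring.
  apply: le_trans (mv_l4 hrho oA _) _; rewrite ler_wpM2l ?expr4_ge0//.
  apply: ler_sum => i _; rewrite -[leLHS]ger0_norm ?expr4_ge0// -[leRHS]ger0_norm ?expr4_ge0//.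
  by rewrite !normrX lerXn2r ?nnegrE// bm_sub_u.
rewrite (Ex_sum weight_gw); last by move=> i; BM.
apply: (le_trans (y := \sum_(i < n) 17 * 16 ^+ 2 * alpha A ^+ 2)).
  apply: ler_sum => i _; apply: le_trans (resid_moment4 (fun j => A i j)) _.
  apply: (ler_wpM2l c0); rewrite lerXn2r ?nnegrE ?alpha_ge0//; last exact: alpha_row.
  by apply: sumr_ge0 => j _; exact: sqr_ge0.
rewrite sumr_const card_ord le_eqVlt; apply/orP; left; apply/eqP; ring.
Qed.

(** Writing v = (1 - A D) w cancels the linear part of bm - u: the form equals w tested against the
    residuals plus w tested against a remainder quadratic in [fluct], whose l2 norm is a fourth
    moment. *)
Lemma E_linear2 (v : 'I_n -> R) :
  E (fun s => (\sum_j v j * (spin s j - u j)) ^+ 2) <=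
  32 / (1 - rho) ^+ 2 * (1 + K4) * \sum_j v j ^+ 2.
Proof.
have /andP[r0 r1] := hrho; have s0 : 0 < 1 - rho by lra.
have Bf i := BM_fluct i; have Br i := BM_resid i; have Bs i := BM_spin i.
pose D i := tvar mu (mv A u i + c i).
have [w vE w2] := @resolvent _ _ _ _ hrho cA oA D v (fun i => tvar_norm _ _).
pose r j s := bm j s - u j - fluct j s * D j.
have r4 j s : `|r j s| <= 4 * fluct j s ^+ 2.
  by rewrite /r uE /bm th_fluct; exact: m1_taylor.
have e s : \sum_j v j * (spin s j - u j) = \sum_j w j * resid j s + \sum_j w j * r j s.
  have -> : \sum_j v j * (spin s j - u j) =
    \sum_j w j * (spin s j - u j) - \sum_j mv A (fun i => D i * w i) j * (spin s j - u j).
    by rewrite -sumrB; apply: eq_bigr => j _; rewrite vE /mv; ring.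
  rewrite (mv_sym cA) -sumrB -big_split/=; apply: eq_bigr => j _.
  rewrite -fluctE /r /resid; move: (fluct j s) (bm j s) (D j) => x y z; by ring.
have w0 : 0 <= \sum_j w j ^+ 2 by apply: sumr_ge0 => j _; exact: sqr_ge0.
have Brs : BM (fun s => \sum_j w j * resid j s) by BM.
apply: (le_trans (y := E (fun s => 2 * (\sum_j w j * resid j s) ^+ 2 +
     (32 * \sum_j w j ^+ 2) * (\sum_j fluct j s ^+ 4)))).
  apply: (Ex_le weight_gw) => [||s].
  - apply: BMX; apply: BM_sum => j; apply: BMM; first exact: BM_cst.
    by apply: BMB; [exact: Bs | exact: BM_cst].
  - by BM.
  rewrite e; set x := \sum_j w j * resid j s; set y := \sum_j w j * r j s.
  have y2 : y ^+ 2 <= 16 * (\sum_j w j ^+ 2) * (\sum_j fluct j s ^+ 4).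
    apply: le_trans (cauchy_schwarz_sum _ _) _.
    rewrite [leRHS](_ : _ = (\sum_j w j ^+ 2) * (16 * \sum_j fluct j s ^+ 4)); last by ring.
    rewrite ler_wpM2l// mulr_sumr; apply: ler_sum => j _.
    rewrite -[leLHS]real_normK ?num_real//.
    have -> : 16 * fluct j s ^+ 4 = (4 * fluct j s ^+ 2) ^+ 2 by ring.
    by rewrite lerXn2r ?nnegrE// mulr_ge0// sqr_ge0.
  have := sqr_ge0 (x - y).
  have -> : (x - y) ^+ 2 = 2 * x ^+ 2 + 2 * y ^+ 2 - (x + y) ^+ 2 by ring.
  by lra.
rewrite (ExD weight_gw); [|by BM..].
rewrite !(ExZ weight_gw); [|by BM..].
have h2 := resid_moment2 w; have h4 := E_fluct4; have k0 := K4_ge0.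
have -> : 32 / (1 - rho) ^+ 2 * (1 + K4) * \sum_j v j ^+ 2 =
  32 * (1 + K4) * ((\sum_j v j ^+ 2) / (1 - rho) ^+ 2) by ring.
apply: (le_trans (y := 32 * (1 + K4) * \sum_j w j ^+ 2)).
  have : (32 * \sum_j w j ^+ 2) * E (fun s => \sum_i fluct i s ^+ 4) <= (32 * \sum_j w j ^+ 2) * K4.
    by rewrite ler_wpM2l// mulr_ge0.
  move: h2; set W := \sum_j _; set a := E _; set b := E _; lra.
rewrite ler_wpM2l//; first by rewrite mulr_ge0// addr_ge0.
by rewrite ler_pdivlMr ?exprn_gt0// mulrC.
Qed.

End mean_field.

End gibbs.

(** * The normal distribution and Stein's equation *)

Lemma is_derive_opp (R : realType) (f : R -> R) (x a : R) : is_derive x (1:R) f a ->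
  is_derive x (1:R) (fun t => - f t) (- a).
Proof. by move=> hf; exact: is_deriveN. Qed.

Section normal_cdf.
Context {R : realType}.
Implicit Types m s t x y : R.

Definition ncdf m s t : R := fine (normal_prob m s [set` `]-oo, t]]).

Lemma ncdf_derive m s t : s != 0 -> is_derive t (1:R) (ncdf m s) (normal_pdf m s t).
Proof.
move=> s0; have t1 : t < t + 1 by rewrite ltrDl.
have ip : (@lebesgue_measure R).-integrable setT (EFin \o normal_pdf m s).
  exact: integrable_normal_pdf.
have ip' : (@lebesgue_measure R).-integrable [set` Interval -oo%O (BRight (t + 1))]
    (EFin \o normal_pdf m s) by exact: (integrableS _ _ (@subsetT _ _) ip).
have cp : {for t, continuous (normal_pdf m s)} by exact: continuous_normal_pdf.
have [d1 d2] := continuous_FTC1 t1 ip' (ltNyr t) cp.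
by rewrite derive1E in d2; exact: DeriveDef.
Qed.

(** The identity viewed as a random variable, so that the limits of distribution functions apply to
    [ncdf]. *)
Let idR : measurableTypeR R -> R := idfun.

#[local] HB.instance Definition _ :=
  @isMeasurableFun.Build _ _ _ _ idR (@measurable_id _ _ setT).

Lemma ncdf_Ny0 m s : ncdf m s x @[x --> -oo] --> (0 : R).
Proof.
have := cvg_cdfNy0 (idR : {RV (normal_prob m s : probability (measurableTypeR R) R) >-> R}).
by move/fine_cvgP => [_].
Qed.

Lemma ncdf_y1 m s : ncdf m s x @[x --> +oo] --> (1 : R).
Proof.
have := cvg_cdfy1 (idR : {RV (normal_prob m s : probability (measurableTypeR R) R) >-> R}).
by move/fine_cvgP => [_].
Qed.

Lemma antiderivative_unique (F G f : R -> R) :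
  (forall x : R, is_derive x (1:R) F (f x)) -> (forall x : R, is_derive x (1:R) G (f x)) ->
  F x @[x --> -oo] --> (0 : R) -> G x @[x --> -oo] --> (0 : R) -> F =1 G.
Proof.
move=> hF hG F0 G0 x.
have H y : F y - G y = F x - G x.
  apply: (@is_derive_0_is_cst R (fun z => F z - G z)) => z.
  by have := is_derive_sub (hF z) (hG z); rewrite subrr.
have l1 : (fun y => F y - G y) y @[y --> -oo] --> 0 - (0 : R) by exact: cvgB.
have l2 : (fun y => F y - G y) y @[y --> -oo] --> F x - G x.
  rewrite (_ : (fun y => F y - G y) = cst (F x - G x)); first exact: cvg_cst.
  by apply/funext => y; rewrite H.
apply/eqP; rewrite -subr_eq0; apply/eqP.
by rewrite -[RHS]subr0; apply: cvg_unique l2 l1.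
Qed.

Definition phi1 : R -> R := normal_pdf 0 1.
Definition Phi : R -> R := ncdf 0 1.

Lemma phi1E x : phi1 x = normal_peak 1 * expR (- (x ^+ 2 / 2)).
Proof. by rewrite /phi1 normal_pdfE ?oner_eq0// /normal_fun subr0 expr1n mulNr. Qed.

Lemma normal_pdf_scale m s x : 0 < s -> normal_pdf m s x = phi1 ((x - m) / s) * s^-1.
Proof.
move=> s0; rewrite phi1E normal_pdfE ?gt_eqF//.
have -> : normal_peak s = normal_peak 1 * s^-1.
  rewrite /normal_peak expr1n mul1r -mulrnAr sqrtrM ?sqr_ge0// sqrtr_sqr gtr0_norm//.
  by rewrite invfM mulrC.
rewrite mulrAC; congr (_ * _ * _); rewrite /normal_fun; congr expR.
rewrite -mulr_natr; by field; rewrite gt_eqF.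
Qed.

Lemma phi1_gt0 x : 0 < phi1 x.
Proof. by rewrite phi1E mulr_gt0 ?expR_gt0// normal_peak_gt0 ?oner_eq0. Qed.

Lemma phi1_le_peak x : phi1 x <= normal_peak 1.
Proof. by apply: normal_pdf_ub; rewrite oner_eq0. Qed.

Lemma Phi_derive x : is_derive x (1:R) Phi (phi1 x).
Proof. by apply: ncdf_derive; rewrite oner_eq0. Qed.

Lemma phi1_derive x : is_derive x (1:R) phi1 (- x * phi1 x).
Proof.
have -> : phi1 = fun x => normal_peak 1 * expR (- (x ^+ 2 / 2)).
  by apply/funext => y; exact: phi1E.
have h1 : is_derive x (1:R) (fun y => - (y ^+ 2 / 2)) (- x).
  have h : is_derive x (1:R) (fun y => y * y) (1 * x + x * 1) by exact: is_derive_mul.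
  have h' : is_derive x (1:R) (fun y => y * y / 2) ((1 * x + x * 1) * 2^-1 + x * x * 0) by exact: is_derive_mul.
  apply: is_derive_eq (is_derive_opp h') _; by field.
have h2 := @is_derive_comp _ expR (fun y => - (y ^+ 2 / 2)) _ _ _ (is_derive_expR _) h1.
have h3 : is_derive x (1:R) (fun y => normal_peak 1 * expR (- (y ^+ 2 / 2)))
   (0 * expR (- (x ^+ 2 / 2)) + normal_peak 1 * (expR (- (x ^+ 2 / 2)) * - x)) by exact: is_derive_mul.
by apply: is_derive_eq h3 _; ring.
Qed.

(** Both sides are antiderivatives of the same density vanishing at minus infinity; no change of
    variables in the integral is needed. *)
Lemma ncdf_scale m s t : 0 < s -> ncdf m s t = Phi ((t - m) / s).
Proof.
move=> s0; apply: (@antiderivative_unique _ (fun t => Phi ((t - m) / s)) (normal_pdf m s)).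
- by move=> x; apply: ncdf_derive; rewrite gt_eqF.
- move=> x; rewrite normal_pdf_scale//.
  have h : is_derive x (1:R) (fun y => (y - m) / s) ((1 - 0) * s^-1 + (x - m) * 0).
    by apply: is_derive_mul; apply: is_derive_sub.
  by apply: is_derive_eq (is_derive_comp (Phi_derive _) h) _; ring.
- exact: ncdf_Ny0.
- apply: (@cvg_comp _ _ _ (fun t => (t - m) / s) Phi _ -oo%R); last exact: ncdf_Ny0.
  apply/cvgrNyPle => B; near=> y; rewrite ler_pdivrMr// lerBlDr.
  by near: y; apply: nbhs_ninfty_le; rewrite num_real.
Unshelve. all: by end_near. Qed.

Lemma ncdf_ge0 m s t : 0 <= ncdf m s t.
Proof. by rewrite fine_ge0// measure_ge0. Qed.

Lemma ncdf_le1 m s t : ncdf m s t <= 1.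
Proof.
rewrite -lee_fin fineK; first exact: probability_le1.
exact: fin_num_measure.
Qed.

Lemma Phi_mono x y : x <= y -> Phi x <= Phi y.
Proof.
move=> xy; have [c _ e] := mean_value x y Phi_derive.
by rewrite -subr_ge0 e mulr_ge0 ?subr_ge0// ltW// phi1_gt0.
Qed.

Lemma Phi_ge0 x : 0 <= Phi x. Proof. exact: ncdf_ge0. Qed.

Lemma Phi_le1 x : Phi x <= 1. Proof. exact: ncdf_le1. Qed.

Lemma Phi_left_tail x e : 0 < e -> exists2 y, y <= x & Phi y < e.
Proof.
move=> e0; have /cvgrPdist_lt /(_ e e0) h := ncdf_Ny0 0 1.
near (-oo%R : set_system R) => y; exists y.
  by near: y; apply: nbhs_ninfty_le; rewrite num_real.
have : `|0 - Phi y| < e by near: y.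
by rewrite sub0r normrN ger0_norm ?Phi_ge0.
Unshelve. all: by end_near. Qed.

Lemma Phi_right_tail x e : 0 < e -> exists2 y, x <= y & 1 - Phi y < e.
Proof.
move=> e0; have /cvgrPdist_lt /(_ e e0) h := ncdf_y1 0 1.
near (+oo%R : set_system R) => y; exists y.
  by near: y; apply: nbhs_pinfty_ge; rewrite num_real.
have : `|1 - Phi y| < e by near: y.
by rewrite ger0_norm ?subr_ge0 ?Phi_le1.
Unshelve. all: by end_near. Qed.

(* On each side of [x], [z |-> x * Phi z + phi1 z] is monotone, its derivative
   being [(x - z) * phi1 z]. *)
Lemma Mills_increment x z : x * Phi z + phi1 z <= x * Phi x + phi1 x.
Proof.
have GD (y : R) : is_derive y (1:R) (fun y => x * Phi y + phi1 y) ((x - y) * phi1 y).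
  have h : is_derive y (1:R) (fun y => x * Phi y) (0 * Phi y + x * phi1 y).
    by apply: is_derive_mul; exact: Phi_derive.
  by apply: is_derive_eq (is_derive_add h (phi1_derive y)) _; ring.
have [c cxz e] := mean_value z x GD.
rewrite -subr_ge0 e mulrAC mulr_ge0//; last by rewrite ltW// phi1_gt0.
move: cxz; rewrite minEle maxEle; case: (leP z x) => zx /andP[c1 c2].
  by rewrite mulr_ge0// subr_ge0.
by rewrite mulr_le0// subr_le0// ltW.
Qed.

(** Let the second argument of [Mills_increment] tend to minus infinity; the upper version uses plus
    infinity. *)
Lemma Mills_lower x : x < 0 -> - x * Phi x <= phi1 x.
Proof.
move=> x0; apply/ler_addgt0Pr => e e0.
have ex : 0 < e / - x by rewrite divr_gt0// oppr_gt0.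
have [y yx ye] := Phi_left_tail x ex.
rewrite ltr_pdivlMr ?oppr_gt0// in ye.
by have := Mills_increment x y; have := phi1_gt0 y; lra.
Qed.

Lemma Mills_upper x : 0 < x -> x * (1 - Phi x) <= phi1 x.
Proof.
move=> x0; apply/ler_addgt0Pr => e e0.
have ex : 0 < e / x by rewrite divr_gt0.
have [y yx ye] := Phi_right_tail x ex.
rewrite ltr_pdivlMr// in ye.
by have := Mills_increment x y; have := phi1_gt0 y; lra.
Qed.

End normal_cdf.

(** * The bounded solution of Stein's equation for a half-line indicator *)

Section stein_solution.
Context {R : realType}.
Implicit Types t x y : R.

Definition steinK : R := 1 + (phi1 1)^-1.

Lemma steinK_ge1 : 1 <= steinK.
Proof. by rewrite lerDl invr_ge0 ltW// phi1_gt0. Qed.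

(** [steinl] and [steinr] are the smooth branches, to the left and right of t, of the bounded
    solution of f' = x f + 1(x <= t) - Phi t. [steing] is f' as read off from the equation, so it
    has a value at the kink too. *)
Definition steinl t x := (1 - Phi t) * (Phi x / phi1 x).
Definition steinr t x := Phi t * ((1 - Phi x) / phi1 x).
Definition steinf t x := if x <= t then steinl t x else steinr t x.
Definition steing t x := x * steinf t x + (x <= t)%R%:R - Phi t.

Lemma steinl_derive t x : is_derive x (1:R) (steinl t) (x * steinl t x + (1 - Phi t)).
Proof.
have p0 : phi1 x != 0 by rewrite gt_eqF// phi1_gt0.
have h : is_derive x (1:R) (fun x => Phi x / phi1 x)
   (phi1 x * (phi1 x)^-1 + Phi x * (- (- x * phi1 x) / phi1 x ^+ 2)).
  by apply: is_derive_mul; [exact: Phi_derive | apply: is_derive_inv => //; exact: phi1_derive].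
have h2 : is_derive x (1:R) (steinl t) (0 * (Phi x / phi1 x) + (1 - Phi t) * (phi1 x * (phi1 x)^-1 + Phi x * (- (- x * phi1 x) / phi1 x ^+ 2))).
  exact: is_derive_mul.
by apply: is_derive_eq h2 _; rewrite /steinl; move: (Phi x) (Phi t) (phi1 x) p0 => a b p p0; field.
Qed.

Lemma steinr_derive t x : is_derive x (1:R) (steinr t) (x * steinr t x - Phi t).
Proof.
have p0 : phi1 x != 0 by rewrite gt_eqF// phi1_gt0.
have h : is_derive x (1:R) (fun x => (1 - Phi x) / phi1 x)
   ((0 - phi1 x) * (phi1 x)^-1 + (1 - Phi x) * (- (- x * phi1 x) / phi1 x ^+ 2)).
  apply: is_derive_mul; last by apply: is_derive_inv => //; exact: phi1_derive.
  by apply: is_derive_sub; exact: Phi_derive.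
have h2 : is_derive x (1:R) (steinr t) (0 * ((1 - Phi x) / phi1 x) + Phi t * ((0 - phi1 x) * (phi1 x)^-1 + (1 - Phi x) * (- (- x * phi1 x) / phi1 x ^+ 2))).
  exact: is_derive_mul.
by apply: is_derive_eq h2 _; rewrite /steinr; move: (Phi x) (Phi t) (phi1 x) p0 => a b p p0; field.
Qed.

Lemma steinl_ge0 t x : 0 <= steinl t x.
Proof. by rewrite mulr_ge0 ?subr_ge0 ?Phi_le1// divr_ge0 ?Phi_ge0// ltW// phi1_gt0. Qed.

Lemma steinr_ge0 t x : 0 <= steinr t x.
Proof. by rewrite mulr_ge0 ?Phi_ge0// divr_ge0 ?subr_ge0 ?Phi_le1// ltW// phi1_gt0. Qed.

Lemma phi1_ge_unit x : `|x| <= 1 -> phi1 1 <= phi1 x.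
Proof.
move=> x1; rewrite !phi1E ler_pM2l ?normal_peak_gt0 ?oner_eq0// ler_expR lerN2.
by rewrite ler_pM2r ?invr_gt0// -[x ^+ 2]real_normK ?num_real// expr1n expr_le1.
Qed.

(** Both branches are dominated by this product. The Mills bounds give 1/|x|, which suffices outside
    the unit interval; inside it the density is at least [phi1 1], whence the form of [steinK]. *)
Lemma mills_product x : 0 <= Phi x * (1 - Phi x) / phi1 x <= steinK /\
  `|x| * (Phi x * (1 - Phi x) / phi1 x) <= 1.
Proof.
have p0 := phi1_gt0 x; have F0 := Phi_ge0 x; have F1 := Phi_le1 x.
have h0 : 0 <= Phi x * (1 - Phi x) / phi1 x.
  by rewrite divr_ge0 ?mulr_ge0 ?subr_ge0// ltW.
have hx : `|x| * (Phi x * (1 - Phi x) / phi1 x) <= 1.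
  rewrite mulrA ler_pdivrMr// mul1r; have [x0|x0] := ltP x 0.
    rewrite ltr0_norm// mulrA; have := Mills_lower x0.
    have : 0 <= - x * Phi x by rewrite mulr_ge0// oppr_ge0 ltW.
    move: (- x * Phi x) => m m0 h; apply: le_trans h; rewrite -[leRHS]mulr1 ler_wpM2l//; lra.
  have [->|xn] := eqVneq x 0; first by rewrite normr0 mul0r ltW// phi1_gt0.
  have xp : 0 < x by rewrite lt_def xn.
  rewrite gtr0_norm// mulrCA; have := Mills_upper xp.
  have : 0 <= x * (1 - Phi x) by rewrite mulr_ge0 ?subr_ge0// ltW.
  by move: (x * (1 - Phi x)) => m m0 h; apply: le_trans h; rewrite -[leRHS]mul1r ler_wpM2r.
split=> //; rewrite h0/=; have [x1|x1] := leP `|x| 1.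
  have q0 : 0 < phi1 1 :> R by exact: phi1_gt0.
  have qx := phi1_ge_unit x1.
  apply: (le_trans (y := (phi1 1)^-1)); last by rewrite /steinK; lra.
  rewrite ler_pdivrMr// [leRHS]mulrC ler_pdivlMr//.
  apply: le_trans qx; rewrite -[leRHS]mul1r ler_wpM2r//; first exact: ltW.
  by rewrite -[leRHS]mulr1 ler_pM ?subr_ge0// gerBl.
apply: le_trans steinK_ge1; apply: le_trans hx.
by rewrite -[leLHS]mul1r ler_wpM2r// ltW.
Qed.

Lemma steinl_bound t x : x <= t -> steinl t x <= steinK /\ `|x * steinl t x| <= 1.
Proof.
move=> xt; have [/andP[h0 h1] h2] := mills_product x.
have h : steinl t x <= Phi x * (1 - Phi x) / phi1 x.
  rewrite /steinl mulrA ler_pM2r ?invr_gt0 ?phi1_gt0// mulrC ler_wpM2l ?Phi_ge0//.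
  by have := Phi_mono xt; lra.
split; first exact: le_trans h1.
by rewrite normrM (ger0_norm (steinl_ge0 _ _)) (le_trans _ h2)// ler_wpM2l.
Qed.

Lemma steinr_bound t x : t <= x -> steinr t x <= steinK /\ `|x * steinr t x| <= 1.
Proof.
move=> xt; have [/andP[h0 h1] h2] := mills_product x.
have h : steinr t x <= Phi x * (1 - Phi x) / phi1 x.
  rewrite /steinr mulrA ler_pM2r ?invr_gt0 ?phi1_gt0// ler_wpM2r ?subr_ge0 ?Phi_le1//.
  exact: Phi_mono.
split; first exact: le_trans h1.
by rewrite normrM (ger0_norm (steinr_ge0 _ _)) (le_trans _ h2)// ler_wpM2l.
Qed.

Lemma steinf_ge0 t x : 0 <= steinf t x.
Proof. by rewrite /steinf; case: ifP => _; rewrite ?steinl_ge0 ?steinr_ge0. Qed.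

Lemma steinf_le t x : steinf t x <= steinK.
Proof.
rewrite /steinf; case: (leP x t) => xt; first by case: (steinl_bound xt).
by case: (steinr_bound (ltW xt)).
Qed.

Lemma steinf_norm t x : `|steinf t x| <= steinK.
Proof. by rewrite ger0_norm ?steinf_le// steinf_ge0. Qed.

Lemma steinf_mul t x : `|x * steinf t x| <= 1.
Proof.
rewrite /steinf; case: (leP x t) => xt; first by case: (steinl_bound xt).
by case: (steinr_bound (ltW xt)).
Qed.

Lemma steing_norm t x : `|steing t x| <= 2.
Proof.
have := steinf_mul t x; have := Phi_ge0 t; have := Phi_le1 t.
rewrite /steing; case: (x <= t) => /=; rewrite !ler_norml => p1 p2 /andP[p3 p4];
  apply/andP; split; lra.
Qed.

Lemma steinf_left t x y : x <= t -> y <= t -> exists2 c, Num.min x y <= c <= Num.max x y &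
  steinf t y - steinf t x = (c * steinf t c + (1 - Phi t)) * (y - x).
Proof.
move=> xt yt; have [c cxy e] := mean_value x y (steinl_derive t).
have ct : c <= t.
  by move: cxy => /andP[_ h]; apply: le_trans h _; rewrite ge_max xt.
by exists c => //; rewrite /steinf xt yt ct.
Qed.

Lemma steinf_right t x y : t <= x -> t <= y -> exists2 c, Num.min x y <= c <= Num.max x y &
  steinf t y - steinf t x = (c * steinf t c - Phi t) * (y - x).
Proof.
have fE z : t <= z -> steinf t z = steinr t z.
  move=> tz; rewrite /steinf; case: (leP z t) => // zt.
  have -> : z = t by apply/eqP; rewrite eq_le zt.
  by rewrite /steinl /steinr; ring.
move=> xt yt; have [c cxy e] := mean_value x y (steinr_derive t).
have ct : t <= c.
  by move: cxy => /andP[h _]; apply: le_trans h; rewrite le_min xt.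
by exists c => //; rewrite !fE.
Qed.

Lemma steinf_lipschitz t x y : `|steinf t y - steinf t x| <= 2 * `|y - x|.
Proof.
have P0 := Phi_ge0 t; have P1 := Phi_le1 t.
have hl a b : a <= t -> b <= t -> `|steinf t b - steinf t a| <= 2 * `|b - a|.
  move=> at_ bt; have [c _ ->] := steinf_left at_ bt; rewrite normrM ler_wpM2r//.
  by have := steinf_mul t c; rewrite !ler_norml => /andP[? ?]; apply/andP; split; lra.
have hr a b : t <= a -> t <= b -> `|steinf t b - steinf t a| <= 2 * `|b - a|.
  move=> at_ bt; have [c _ ->] := steinf_right at_ bt; rewrite normrM ler_wpM2r//.
  by have := steinf_mul t c; rewrite !ler_norml => /andP[? ?]; apply/andP; split; lra.
wlog xy : x y / x <= y.
  move=> H; have [|/ltW yx] := leP x y; first exact: H.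
  by rewrite distrC (distrC y); exact: H.
have [yt|ty] := leP y t; first by apply: hl => //; exact: le_trans yt.
have [xt|tx] := leP x t; last by apply: hr; exact: ltW.
(* When t separates the points, the two branches are glued at t. *)
have := hl x t xt (lexx t); have := hr t y (lexx t) (ltW ty).
have -> : `|t - x| = t - x by rewrite ger0_norm ?subr_ge0.
have -> : `|y - t| = y - t by rewrite ger0_norm ?subr_ge0// ltW.
have -> : `|y - x| = y - x by rewrite ger0_norm ?subr_ge0.
move=> h1 h2; have -> : steinf t y - steinf t x = (steinf t y - steinf t t) + (steinf t t - steinf t x) by ring.
by rewrite (le_trans (ler_normD _ _))//; lra.
Qed.

Lemma continuous_steinf t : continuous (steinf t).
Proof.
move=> x; apply/cvgrPdist_lt => e e0; near=> y.
rewrite distrC; apply: (le_lt_trans (steinf_lipschitz t x y)).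
rewrite -ltr_pdivlMl// distrC; near: y.
by apply: cvgr_dist_lt; rewrite ?mulr_gt0// invr_gt0.
Unshelve. all: by end_near. Qed.

(** On one side of t the derivative f' has increments controlled by f and x f. Across t it jumps:
    both the increment of f and the linear term are at most 2 |x - y|, and these 4 |x - y| are
    charged to the change of the indicator. *)
Lemma stein_increment t x y :
  `|steinf t x - steinf t y - (x - y) * steing t x| <=
  `|x - y| * (`|x - y| * (steinK + 2 * `|x|) +
              4 * `|(x <= t)%R%:R - (y <= t)%R%:R|).
Proof.
have K1 := steinK_ge1.
have same c : Num.min y x <= c <= Num.max y x ->
    `|(c * steinf t c - x * steinf t x) * (x - y)| <= `|x - y| * (`|x - y| * (steinK + 2 * `|x|)).
  move=> cyx; rewrite normrM mulrC ler_wpM2l//.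
  have cx : `|c - x| <= `|x - y|.
    move: cyx; rewrite minEle maxEle; case: (leP y x) => yx /andP[c1 c2].
      by rewrite ler0_norm ?subr_le0// ger0_norm ?subr_ge0//; lra.
    by rewrite ger0_norm ?subr_ge0// ltr0_norm ?subr_lt0//; lra.
  have -> : c * steinf t c - x * steinf t x = (c - x) * steinf t c + x * (steinf t c - steinf t x) by ring.
  rewrite (le_trans (ler_normD _ _))// [leRHS]mulrDr lerD// normrM.
    by rewrite ler_pM// steinf_norm.
  have -> : `|x - y| * (2 * `|x|) = `|x| * (2 * `|x - y|) by ring.
  rewrite ler_wpM2l// (le_trans (steinf_lipschitz _ _ _))// ler_wpM2l//.
have r0 : 0 <= `|x - y| * (`|x - y| * (steinK + 2 * `|x|)).
  by rewrite !mulr_ge0// addr_ge0 ?mulr_ge0//; lra.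
rewrite [leRHS]mulrDr /steing; case: (leP x t) => xt; case: (leP y t) => yt /=.
- have [c cxy e] := steinf_left yt xt; rewrite subrr normr0 mulr0 mulr0 addr0.
  rewrite e (_ : _ - _ = (c * steinf t c - x * steinf t x) * (x - y)); last by ring.
  exact: same.
- have := steing_norm t x; rewrite /steing xt /= => hg.
  rewrite subr0 normr1 mulr1.
  have := steinf_lipschitz t y x.
  have : `|(x - y) * (x * steinf t x + 1 - Phi t)| <= `|x - y| * 2 by rewrite normrM ler_wpM2l.
  have := ler_normB (steinf t x - steinf t y) ((x - y) * (x * steinf t x + 1 - Phi t)).
  by lra.
- have := steing_norm t x; rewrite /steing (leNgt x t) xt /= => hg.
  rewrite sub0r normrN1 mulr1.
  have := steinf_lipschitz t y x.
  have : `|(x - y) * (x * steinf t x + 0 - Phi t)| <= `|x - y| * 2 by rewrite normrM ler_wpM2l.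
  have := ler_normB (steinf t x - steinf t y) ((x - y) * (x * steinf t x + 0 - Phi t)).
  by lra.
- have [c cxy e] := steinf_right (ltW yt) (ltW xt); rewrite subrr normr0 mulr0 mulr0 addr0.
  rewrite e (_ : _ - _ = (c * steinf t c - x * steinf t x) * (x - y)); last by ring.
  by rewrite addr0; exact: same.
Qed.

End stein_solution.

(** * Stein's method for the Gibbs measure *)

Lemma le_sqr_div_add (R : realType) (y r : R) : 0 < r -> `|y| <= y ^+ 2 / r + r.
Proof.
move=> r0; rewrite -subr_ge0.
have -> : y ^+ 2 / r + r - `|y| = ((`|y| - r) ^+ 2 + r * `|y|) / r.
  by rewrite -[y ^+ 2]real_normK ?num_real//; field; rewrite gt_eqF.
by rewrite divr_ge0 ?addr_ge0 ?sqr_ge0 ?mulr_ge0// ltW.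
Qed.

Section gibbs_stein.
Context {R : realType}.
Local Notation RR := (measurableTypeR R).
Variables (mu : probability RR R) (n : nat) (A : 'M[R]_n) (rho : R).
Hypothesis hrho : 0 < rho < 1.
Hypothesis cA : coupling A.
Hypothesis oA : opnorm4 A <= rho.
Variable c : 'I_n -> R.
Local Notation cfg := (n.-tuple RR).
Local Notation E := (Ex (iid mu n) (gw mu A c)).
Local Notation E2 := (E2 mu A c).
Local Notation th := (th A c).
Local Notation W := (weight_gw mu A c).

(** With [B] of order r^2 the conclusion is of order r. The same [r] is used for all error terms. *)
Lemma E_norm_le_sqr (Y : cfg -> R) r B : 0 < r -> BM Y ->
  E (fun s => Y s ^+ 2) <= B -> E (fun s => `|Y s|) <= B / r + r.
Proof.
move=> r0 BY h; apply: (le_trans (y := E (fun s => r^-1 * Y s ^+ 2 + r))).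
  apply: (Ex_le W) => [||s]; [by BM|by BM|].
  by rewrite mulrC; exact: le_sqr_div_add.
have B2 : BM (fun s => Y s ^+ 2) by BM.
rewrite (ExD W); [|by BM..]; rewrite (ExZ W)// (Ex_cst W) lerD2r mulrC.
by rewrite ler_wpM2r// invr_ge0 ltW.
Qed.

Section centered_sums.
Variables (G : 'I_n -> cfg -> R) (M : R) (a : 'I_n -> R).
Hypothesis BG : forall i, BM (G i).
Hypothesis GM : forall i s, `|G i s| <= M.
Hypothesis Gc : forall i s, tmean mu (fun z => G i (upd s i z)) (th i s) = 0.
Hypothesis GL : forall i j s, i != j -> `|G i s - G i (upd s j 0)| <= M * `|A i j|.

(** [G j] is centred given the other spins, hence orthogonal to [G i] with spin j frozen. An
    off-diagonal correlation thus sees only the influence of j on [G i], at most M |A i j|. *)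
Lemma E_centered_sum2 :
  E (fun s => (\sum_i a i * G i s) ^+ 2) <=
  M ^+ 2 * (\sum_i a i ^+ 2 + \sum_i \sum_j `|a i| * `|a j| * `|A i j|).
Proof.
have M0 (i : 'I_n) : 0 <= M by apply: le_trans (GM i [tuple 0 | j < n]).
have -> : E (fun s => (\sum_i a i * G i s) ^+ 2) =
    \sum_i \sum_j a i * a j * E (fun s => G j s * G i s).
  transitivity (E (fun s => \sum_i \sum_j a i * a j * (G j s * G i s))).
    apply: eq_Ex => s; rewrite expr2 mulr_suml; apply: eq_bigr => i _.
    by rewrite mulr_sumr; apply: eq_bigr => j _; ring.
  rewrite (Ex_sum W); last by move=> i; BM.
  apply: eq_bigr => i _; rewrite (Ex_sum W); last by move=> j; BM.
  by apply: eq_bigr => j _; rewrite (ExZ W)//; BM.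
rewrite mulrDr !mulr_sumr -big_split/=; apply: ler_sum => i _.
rewrite (bigD1 i)//=; apply: lerD.
  rewrite -expr2 mulrC ler_wpM2r ?sqr_ge0//.
  apply: (Ex_le_cst W) => [|s]; first by BM.
  rewrite -expr2 -[G i s ^+ 2]real_normK ?num_real// lerXn2r ?nnegrE//; exact: (M0 i).
rewrite mulr_sumr [leRHS](bigD1 i)//=; apply: ler_wpDl.
  by apply: mulr_ge0; [exact: sqr_ge0 | apply: mulr_ge0 => //; exact: mulr_ge0].
apply: ler_sum => j ji.
have e : E (fun s => G j s * G i s) = E (fun s => G j s * (G i s - G i (upd s j 0))).
  have Bf := BM_freeze j 0 (BG i).
  have o : E (fun s => G j s * G i (upd s j 0)) = 0.
    by apply: (E_orthogonal cA (i := j)) => // s z; rewrite upd_upd.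
  rewrite [RHS](_ : _ = E (fun s => G j s * G i s - G j s * G i (upd s j 0))).
    by rewrite (ExB W) ?o ?subr0//; BM.
  by apply: eq_Ex => s; rewrite mulrBr.
apply: le_trans (ler_norm _) _; rewrite !normrM.
have -> : M ^+ 2 * (`|a i| * `|a j| * `|A i j|) = `|a i| * `|a j| * (M ^+ 2 * `|A i j|) by ring.
rewrite ler_wpM2l ?mulr_ge0// e.
have Bf := BM_freeze j 0 (BG i).
apply: (Ex_norm_le W) => [|s]; first by BM.
by rewrite normrM expr2 -mulrA ler_pM// GL// eq_sym.
Qed.

End centered_sums.

Lemma th_upd_le i j s z : -1 <= z <= 1 -> `|th i (upd s j z) - th i s| <= 2 * `|A i j|.
Proof.
move=> z1; rewrite th_upd addrAC subrr add0r normrM mulrC ler_wpM2r//.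
by rewrite (le_trans (ler_normB _ _))// (_ : 2 = 1 + 1)// lerD// ?clip_norm// spin_norm.
Qed.

Let z01 : -1 <= (0 : R) <= 1. Proof. by apply/andP; split; lra. Qed.

Lemma spin_upd_neq i j (s : cfg) z : i != j -> spin (upd s j z) i = spin s i.
Proof. by move=> /negPf ij; rewrite spin_upd ij. Qed.

(** Squared residual minus its conditional expectation, so that the sum is of the centred type
    above. *)
Definition Lsq i (s : cfg) : R := resid mu A c i s ^+ 2 - tvar mu (th i s).

Lemma BM_Lsq i : BM (Lsq i).
Proof. by apply: BMB; [apply: BMX; exact: BM_resid | exact: BM_tvar_th]. Qed.

Lemma resid_sqr i s : resid mu A c i s ^+ 2 <= 4.
Proof.
rewrite -[leLHS]real_normK ?num_real// (_ : 4 = 2 ^+ 2); last by ring.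
by rewrite lerXn2r ?nnegrE// resid_norm.
Qed.

Lemma E_Lsq2 (a : 'I_n -> R) : E (fun s => (\sum_i a i * Lsq i s) ^+ 2) <=
  16 ^+ 2 * (\sum_i a i ^+ 2 + \sum_i \sum_j `|a i| * `|a j| * `|A i j|).
Proof.
apply: E_centered_sum2 => [i|i s|i s|i j s ij]; first exact: BM_Lsq.
- have := resid_sqr i s; have := sqr_ge0 (resid mu A c i s).
  have := tvar_ge0 mu (th i s); have := tvar_le1 mu (th i s); rewrite /Lsq.
  move: (resid mu A c i s ^+ 2) (tvar mu (th i s)) => x y *.
  by rewrite ler_norml; apply/andP; split; lra.
- transitivity (tmean mu (fun z => (clip z - m1 mu (th i s)) ^+ 2 - tvar mu (th i s)) (th i s)).
    by apply: eq_Ex => z; rewrite /Lsq (resid_upd _ cA) (th_upd_same cA).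
  have Wt := weight_tilted mu (th i s); have Bc := @BM_clip R.
  have B1 : BM (fun z : RR => (clip z - m1 mu (th i s)) ^+ 2) by apply: BMX; apply: BMB => //; exact: BM_cst.
  rewrite /tmean (ExB Wt B1 (BM_cst _ _)) (Ex_cst Wt).
  by rewrite -/(tmean mu _ (th i s)) -tvarE subrr.
rewrite /Lsq.
have h1 : `|tvar mu (th i (upd s j 0)) - tvar mu (th i s)| <= 8 * `|A i j|.
  apply: le_trans (tvar_lipschitz _ _ _) _.
  rewrite (_ : 8 * `|A i j| = 4 * (2 * `|A i j|)); last by ring.
  by rewrite ler_wpM2l// th_upd_le.
have h2 : `|resid mu A c i s ^+ 2 - resid mu A c i (upd s j 0) ^+ 2| <= 8 * `|A i j|.
  rewrite subr_sqr normrM (_ : 8 * `|A i j| = (2 * `|A i j|) * 4); last by ring.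
  rewrite ler_pM//.
    have -> : resid mu A c i s - resid mu A c i (upd s j 0) = bm mu A c i (upd s j 0) - bm mu A c i s.
      rewrite /resid spin_upd_neq//.
      by move: (bm _ _ _ i s) (bm _ _ _ i (upd s j 0)) (spin s i) => x y p; ring.
    by rewrite /bm (le_trans (m1_lipschitz _ _ _))//; exact: th_upd_le.
  rewrite (le_trans (ler_normD _ _))// (_ : 4 = 2 + 2); last by ring.
  by rewrite lerD// resid_norm.
have gen (x y p q k : R) : `|y - x| <= 8 * k -> `|p - q| <= 8 * k -> `|p - x - (q - y)| <= 16 * k.
  by rewrite !ler_norml => /andP[? ?] /andP[? ?]; apply/andP; split; lra.
exact: gen h1 h2.
Qed.

(* Resampling changes T by [T - T' = d = q i * (x - clip z)]. With I the indicator
   of T <= t, the remainder [d ^+ 2 * |I - I'|] in Stein's equation is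
   [d * |d| * (I' - I)]; exchangeability replaces it by [- 2 * d * |d| * I], which
   has this antisymmetric kernel and hence conditional mean zero. *)
Definition Hker (x z : R) : R := (x - clip z) * `|x - clip z|.
Definition Hanti i (s : cfg) : R := tmean mu (Hker (spin s i)) (th i s).

Lemma Hker_norm x z : `|x| <= 1 -> `|Hker x z| <= 4.
Proof.
move=> x1; rewrite /Hker normrM normr_id -expr2 (_ : 4 = 2 ^+ 2); last by ring.
rewrite lerXn2r ?nnegrE//.
by rewrite (le_trans (ler_normB _ _))// (_ : 2 = 1 + 1)// lerD// clip_norm.
Qed.

Lemma BM_Hker x : BM (Hker x : RR -> R).
Proof.
have Bc := @BM_clip R.
by apply: BMM; [|apply: BM_norm]; apply: BMB => //; exact: BM_cst.
Qed.

Lemma BM_spin_clip i : BM (fun p : cfg * RR => spin p.1 i - clip p.2).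
Proof.
apply: BMB; first exact: (BM_fst (BM_spin i)).
split; last by exists 1 => p; exact: clip_norm.
exact: (measurableT_comp measurable_clip measurable_snd).
Qed.

Lemma BM_Hanti i : BM (Hanti i).
Proof.
have Bd := BM_spin_clip i.
apply: (@BM_tmean _ mu n A c i (fun p => Hker (spin p.1 i) p.2)).
by apply: BMM => //; exact: BM_norm.
Qed.

Lemma E_Hanti2 (a : 'I_n -> R) : E (fun s => (\sum_i a i * Hanti i s) ^+ 2) <=
  16 ^+ 2 * (\sum_i a i ^+ 2 + \sum_i \sum_j `|a i| * `|a j| * `|A i j|).
Proof.
apply: E_centered_sum2 => [i|i s|i s|i j s ij]; first exact: BM_Hanti.
- apply: (le_trans (y := 4)); last by lra.
  apply: tmean_norm; first exact: BM_Hker.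
  by move=> z; apply: Hker_norm; exact: spin_norm.
- set t := th i s.
  transitivity (\int[mu]_x \int[mu]_y (tilted mu t x * (tilted mu t y * Hker (clip x) y))).
    apply: eq_Rintegral => x _; rewrite /Hanti (th_upd_same cA) spin_upd eqxx /tmean /Ex -RintegralZl//.
    by apply: BM_integrable; apply: BMM; [exact: BM_tilted | exact: BM_Hker].
  set I := LHS.
  have Bp : BM (fun p : RR * RR => tilted mu t p.1 * (tilted mu t p.2 * Hker (clip p.1) p.2)).
    have B1 (f : RR -> R) : BM f -> BM (fun p : RR * RR => f p.1).
      by move=> [mf [M fM]]; split; [exact: (measurableT_comp mf measurable_fst) | exists M].
    have B2 (f : RR -> R) : BM f -> BM (fun p : RR * RR => f p.2).
      by move=> [mf [M fM]]; split; [exact: (measurableT_comp mf measurable_snd) | exists M].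
    have Bd : BM (fun p : RR * RR => clip p.1 - clip p.2).
      by apply: BMB; [apply: (B1 clip) | apply: (B2 clip)]; exact: BM_clip.
    apply: BMM; first by apply: (B1 (tilted mu t)); exact: BM_tilted.
    apply: BMM; first by apply: (B2 (tilted mu t)); exact: BM_tilted.
    by apply: BMM => //; exact: BM_norm.
  (* Spin i and its resampled value are conditionally i.i.d. and the kernel is antisymmetric;
     exchanging them gives the sign. *)
  have IE : I = - I.
    rewrite {1}/I; apply: etrans (Rintegral_swap mu mu Bp) _.
    rewrite -mulN1r /I -RintegralZl//; last exact: (BM_integrable _ (BM_Rintegral mu mu Bp)).
    apply: eq_Rintegral => x _; rewrite -RintegralZl//; last exact: (BM_integrable _ (BM_curry x Bp)).
    apply: eq_Rintegral => y _ /=; rewrite /Hker (distrC (clip y)).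
    by move: (tilted mu t x) (tilted mu t y) `|clip x - clip y| => p q m; ring.
  by move: IE; move: I => I IE; lra.
rewrite /Hanti spin_upd_neq//.
apply: (le_trans (y := 4 * 2 * (2 * `|A i j|))); last first.
  by rewrite mulrA ler_wpM2r//; lra.
apply: le_trans (tmean_lipschitz mu (BM_Hker _) _ _ _) _.
  by move=> z; apply: Hker_norm; exact: spin_norm.
by rewrite ler_wpM2l ?mulr_ge0// distrC th_upd_le.
Qed.

End gibbs_stein.

(** * The Kolmogorov bound at a fixed field *)

Section stein_bound.
Context {R : realType}.
Local Notation RR := (measurableTypeR R).
Variables (mu : probability RR R) (n : nat) (A : 'M[R]_n) (rho : R).
Hypothesis hrho : 0 < rho < 1.
Hypothesis cA : coupling A.
Hypothesis oA : opnorm4 A <= rho.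
Variable c u : 'I_n -> R.
Hypothesis uE : forall i, u i = m1 mu (mv A u i + c i).
Local Notation cfg := (n.-tuple RR).
Local Notation E := (Ex (iid mu n) (gw mu A c)).
Local Notation E2 := (E2 mu A c).
Local Notation th := (th A c).
Local Notation W := (weight_gw mu A c).
Local Notation resid := (resid mu A c).
Local Notation fluct := (fluct A u).

Variables (q : 'I_n -> R) (lambda ups r : R).
Hypothesis hl : `|lambda| <= rho.
Hypothesis hups : 0 < ups <= 1.
Hypothesis hq : \sum_i q i ^+ 2 = 1.
Hypothesis hqr : forall i, `|q i| <= r.
Hypothesis r0 : 0 < r.
Hypothesis r1 : r <= 1.
Hypothesis har : alpha A <= r ^+ 2.
Hypothesis hnar : n%:R * alpha A ^+ 2 <= r ^+ 2.
Let e i := mv A q i - lambda * q i.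
Hypothesis her : \sum_i e i ^+ 2 <= r ^+ 2.

Let theta := 1 - lambda * ups.
Let sd := Num.sqrt (ups / theta).
Let kap := (1 - rho)^-1.
Let D i := tvar mu (mv A u i + c i).
(** Replacing the local variances D_i = psi'' by their mean [ups] costs [v] in the drift and [Q1] in
    the variance. [Y] collects these field-dependent errors at scale [r]. *)
Let v := mv A (fun i => q i * (D i - ups)).
Let Q1 := \sum_i q i ^+ 2 * (D i - ups).
Let Y := r + (\sum_j v j ^+ 2 + Q1 ^+ 2) / r.

Definition stein_K0 (kap : R) := 17 * 16 ^+ 2 * kap ^+ 4.
Definition stein_C1 (kap : R) := 32 * kap ^+ 2 * (1 + stein_K0 kap).
Let K0 := stein_K0 kap.
Let C1 := stein_C1 kap.

Let rho01 : 0 < rho /\ rho < 1. Proof. by apply/andP. Qed.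
Let ups01 : 0 < ups /\ ups <= 1. Proof. by apply/andP. Qed.
Let kap0 : 0 < kap. Proof. by rewrite invr_gt0; case: rho01; lra. Qed.
Let K00 : 0 <= K0.
Proof. by apply: mulr_ge0; [apply: mulr_ge0 => //; exact: sqr_ge0 | rewrite exprn_ge0// ltW]. Qed.
Let C10 : 0 <= C1.
Proof. by apply: mulr_ge0; [apply: mulr_ge0 => //; exact: sqr_ge0 | rewrite addr_ge0]. Qed.

Let lups : `|lambda * ups| <= rho.
Proof.
case: ups01 => u0 u1; rewrite normrM (gtr0_norm u0); apply: le_trans hl.
by rewrite -[leRHS]mulr1 ler_wpM2l.
Qed.

Let theta_ge : 1 - rho <= theta.
Proof. by have := lups; rewrite ler_norml /theta => /andP[]; lra. Qed.
Let theta_le : theta <= 2.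
Proof. by have := lups; case: rho01 => _ ?; rewrite ler_norml /theta => /andP[]; lra. Qed.
Let theta0 : 0 < theta. Proof. by apply: lt_le_trans theta_ge; case: rho01; lra. Qed.

Let sd0 : 0 < sd. Proof. by rewrite sqrtr_gt0 divr_gt0//; case: ups01. Qed.
Let sd2 : sd ^+ 2 = ups / theta.
Proof. by rewrite sqr_sqrtr// divr_ge0// ltW//; case: ups01. Qed.
Let sdV : theta * sd = ups / sd.
Proof.
apply: (mulIf (x := sd)); first by rewrite gt_eqF.
by rewrite divfK ?gt_eqF// -mulrA -expr2 sd2 mulrC divfK// gt_eqF.
Qed.

Let al0 := alpha_ge0 A.

Let K4_le : 17 * 16 ^+ 2 * (n%:R * alpha A ^+ 2) / (1 - rho) ^+ 4 <= K0 * r ^+ 2.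
Proof.
rewrite /K0 /stein_K0 /kap exprVn.
have -> : 17 * 16 ^+ 2 / (1 - rho) ^+ 4 * r ^+ 2 = 17 * 16 ^+ 2 * r ^+ 2 / (1 - rho) ^+ 4 by ring.
rewrite ler_wpM2r//; first by rewrite invr_ge0 exprn_ge0// subr_ge0 ltW//; case: rho01.
by apply: ler_wpM2l hnar; apply: mulr_ge0 => //; exact: sqr_ge0.
Qed.

Let r21 : r ^+ 2 <= 1. Proof. by rewrite expr_le1// ltW. Qed.

Lemma stein_fluct4 : E (fun s => \sum_i fluct i s ^+ 4) <= K0 * r ^+ 2.
Proof. exact: le_trans (E_fluct4 hrho cA oA uE) K4_le. Qed.

Lemma stein_linear2 (x : 'I_n -> R) :
  E (fun s => (\sum_j x j * (spin s j - u j)) ^+ 2) <= C1 * \sum_j x j ^+ 2.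
Proof.
apply: le_trans (E_linear2 hrho cA oA uE x) _.
apply: ler_wpM2r; first by apply: sumr_ge0 => j _; exact: sqr_ge0.
rewrite /C1 /stein_C1 /kap exprVn ler_wpM2l//.
  by rewrite divr_ge0// sqr_ge0.
rewrite lerD2l; apply: le_trans K4_le _.
by rewrite -[leRHS]mulr1 ler_wpM2l.
Qed.

Let BM_lin (x : 'I_n -> R) : BM (fun s : cfg => \sum_j x j * (spin s j - u j)).
Proof.
apply: BM_sum => j; apply: BMM; first exact: BM_cst.
by apply: BMB; [exact: BM_spin | exact: BM_cst].
Qed.

Let T (s : cfg) := \sum_j q j * (spin s j - u j).
Variable t : R.
(** [F], [I] and [G] are the Stein solution, the indicator and the derivative f' evaluated at the
    normalised statistic T / sd. *)
Let F (s : cfg) := steinf t (T s / sd).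
Let I (s : cfg) : R := (T s / sd <= t)%R%:R.
Let G (s : cfg) := T s / sd * F s + I s - Phi t.

Let BT : BM T. Proof. exact: BM_lin. Qed.
Let BTs : BM (fun s => T s / sd). Proof. by BM. Qed.
Let BF : BM F. Proof. by apply: (BM_comp _ BTs); exact: continuous_steinf. Qed.
Let BI : BM I. Proof. by apply: BM_le; case: BTs. Qed.
Let BG : BM G. Proof. by apply: BMB; [apply: BMD => //; BM | exact: BM_cst]. Qed.
Let Bres i : BM (resid i). Proof. exact: BM_resid. Qed.
Let Bfl i : BM (fluct i). Proof. exact: BM_fluct. Qed.

Let E_abs1 : E (fun s => `|\sum_j e j * (spin s j - u j)|) <= (1 + C1) * r.
Proof.
apply: le_trans (E_norm_le_sqr r0 (BM_lin e) (stein_linear2 e)) _.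
have : C1 * (\sum_j e j ^+ 2) / r <= C1 * r.
  by rewrite ler_pdivrMr// -[leRHS]mulrA -expr2 ler_wpM2l.
by rewrite mulrDl mul1r addrC lerD2l.
Qed.

Let Y_ge_r : r <= Y.
Proof.
rewrite /Y lerDl; apply: divr_ge0; last exact: ltW.
by apply: addr_ge0; [apply: sumr_ge0 => j _ | ]; exact: sqr_ge0.
Qed.
Let Y0 : 0 <= Y. Proof. exact: le_trans (ltW r0) Y_ge_r. Qed.

Let E_abs2 : E (fun s => `|\sum_j v j * (spin s j - u j)|) <= (1 + C1) * Y.
Proof.
apply: le_trans (E_norm_le_sqr r0 (BM_lin v) (stein_linear2 v)) _.
have Q0 : 0 <= Q1 ^+ 2 / r by rewrite divr_ge0 ?sqr_ge0// ltW.
have V0 : 0 <= (\sum_j v j ^+ 2) / r.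
  by apply: divr_ge0; [apply: sumr_ge0 => j _; exact: sqr_ge0 | exact: ltW].
rewrite /Y mulrDl (mulrDl (\sum_j v j ^+ 2)) -mulrA.
by have := mulr_ge0 C10 Q0; have := mulr_ge0 C10 (ltW r0); lra.
Qed.

(** The Taylor remainder is weighted by |q_i|, known only in l2, so it is split by the
    arithmetic-geometric inequality into r q_i^2 and a fourth power of the fluctuation. *)
Let E_abs3 : E (fun s => \sum_i `|q i| * fluct i s ^+ 2) <= (1 + K0) * r.
Proof.
apply: (le_trans (y := E (fun s => r + r^-1 * \sum_i fluct i s ^+ 4))).
  apply: (Ex_le W) => [||s]; [by BM|by BM|].
  apply: (le_trans (y := \sum_i (r * q i ^+ 2 + r^-1 * fluct i s ^+ 4))).
    apply: ler_sum => i _.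
    have -> : fluct i s ^+ 4 = (fluct i s ^+ 2) ^+ 2 by ring.
    rewrite -[q i ^+ 2]real_normK ?num_real//.
    move: (fluct i s ^+ 2) (`|q i|) => x y; rewrite -subr_ge0.
    have -> : r * y ^+ 2 + r^-1 * x ^+ 2 - y * x = ((r * y - x / 2) ^+ 2 + 3 / 4 * x ^+ 2) / r.
      by field; rewrite gt_eqF.
    apply: divr_ge0; last exact: ltW.
    by apply: addr_ge0; [exact: sqr_ge0 | apply: mulr_ge0; [lra | exact: sqr_ge0]].
  by rewrite big_split/= -!mulr_sumr hq mulr1.
have B4 : BM (fun s : cfg => \sum_i fluct i s ^+ 4) by BM.
rewrite (ExD W); [|by BM..]; rewrite (ExZ W)// (Ex_cst W) mulrDl mul1r lerD2l.
rewrite ler_pdivrMl// mulrCA -expr2; exact: stein_fluct4.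
Qed.

Let q2r i : q i ^+ 2 <= r * `|q i|.
Proof. by rewrite -[q i ^+ 2]real_normK ?num_real// expr2 ler_wpM2r. Qed.

Let E_abs4 : E (fun s => \sum_i q i ^+ 2 * `|fluct i s|) <= (2 + K0) * r.
Proof.
apply: (le_trans (y := E (fun s => r + \sum_i `|q i| * fluct i s ^+ 2))).
  apply: (Ex_le W) => [||s]; [by BM|by BM|].
  apply: (le_trans (y := \sum_i (r * q i ^+ 2 + `|q i| * fluct i s ^+ 2))).
    apply: ler_sum => i _.
    have h := le_sqr_div_add (fluct i s) r0.
    apply: (le_trans (y := q i ^+ 2 * (fluct i s ^+ 2 / r + r))); first by rewrite ler_wpM2l ?sqr_ge0.
    rewrite mulrDr addrC lerD//; first by rewrite mulrC.
    rewrite mulrA ler_pdivrMr//.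
    have -> : `|q i| * fluct i s ^+ 2 * r = r * `|q i| * fluct i s ^+ 2 by ring.
    by apply: ler_wpM2r; [exact: sqr_ge0 | exact: q2r].
  by rewrite big_split/= -mulr_sumr hq mulr1.
have B4 : BM (fun s : cfg => \sum_i `|q i| * fluct i s ^+ 2) by BM.
rewrite (ExD W); [|by BM..]; rewrite (Ex_cst W).
have := E_abs3; lra.
Qed.

Let E_abs5 : E (fun s => `|T s|) <= 1 + C1.
Proof.
apply: le_trans (E_norm_le_sqr ltr01 BT (stein_linear2 q)) _.
by rewrite hq mulr1 divr1 addrC.
Qed.

(** In each row |a_j| |A i j| <= (a_j^2 + A i j^2) / 2 sums to at most r^2; the remaining weights
    |a_i| = q_i^2 sum to 1. *)
Let q2sum (a : 'I_n -> R) : (forall i, `|a i| = q i ^+ 2) ->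
  \sum_i a i ^+ 2 + \sum_i \sum_j `|a i| * `|a j| * `|A i j| <= 2 * r ^+ 2.
Proof.
move=> aE.
have r20 : 0 <= r ^+ 2 by exact: sqr_ge0.
have q4 : \sum_i a i ^+ 2 <= r ^+ 2.
  rewrite -[leRHS]mulr1 -hq mulr_sumr; apply: ler_sum => i _.
  rewrite -[a i ^+ 2]real_normK ?num_real// aE expr2 ler_wpM2r ?sqr_ge0//.
  by rewrite -[q i ^+ 2]real_normK ?num_real// lerXn2r ?nnegrE// ltW.
suff : \sum_i \sum_j `|a i| * `|a j| * `|A i j| <= r ^+ 2 by lra.
rewrite -[leRHS]mul1r -hq mulr_suml; apply: ler_sum => i _.
rewrite (eq_bigr (fun j => `|a i| * (`|a j| * `|A i j|))); last by move=> j _; rewrite mulrA.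
rewrite -mulr_sumr -(aE i) ler_wpM2l//.
apply: (le_trans (y := \sum_j (a j ^+ 2 / 2 + A i j ^+ 2 / 2))).
  apply: ler_sum => j _; rewrite -[a j ^+ 2]real_normK ?num_real// -[A i j ^+ 2]real_normK ?num_real//.
  rewrite -subr_ge0 (_ : _ - _ = (`|a j| - `|A i j|) ^+ 2 / 2); last by field.
  by rewrite divr_ge0 ?sqr_ge0.
rewrite big_split/= -!mulr_suml.
rewrite [leRHS](_ : _ = r ^+ 2 * 2^-1 + r ^+ 2 * 2^-1); last by field.
by apply: lerD; rewrite ler_wpM2r//; exact: le_trans (alpha_row A i) har.
Qed.

Let E_abs6 : E (fun s => `|\sum_i (q i * `|q i|) * Hanti mu A c i s|) <= 513 * r.
Proof.
have aE i : `|q i * `|q i| | = q i ^+ 2.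
  by rewrite normrM normr_id -expr2 real_normK ?num_real.
(* 512 = 16 ^ 2 * 2 from [E_Hanti2] and [q2sum]; passing to a first moment adds one more r. *)
have BH i := BM_Hanti mu A c i.
apply: le_trans (E_norm_le_sqr r0 _ (B := 512 * r ^+ 2) _) _; first by BM.
  apply: le_trans (E_Hanti2 mu cA c _) _.
  have := q2sum aE; set S := (X in X <= _ -> _) => h.
  have -> : 512 * r ^+ 2 = 16 ^+ 2 * (2 * r ^+ 2) by ring.
  by rewrite ler_wpM2l ?sqr_ge0.
by rewrite expr2 mulrA mulfK ?gt_eqF//; lra.
Qed.

Let E_abs7 : E (fun s => `|\sum_i q i ^+ 2 * Lsq mu A c i s|) <= 513 * r.
Proof.
have aE i : `|q i ^+ 2| = q i ^+ 2 by rewrite ger0_norm ?sqr_ge0.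
have BL i := BM_Lsq mu A c i.
apply: le_trans (E_norm_le_sqr r0 _ (B := 512 * r ^+ 2) _) _; first by BM.
  apply: le_trans (E_Lsq2 mu cA c _) _.
  have := q2sum aE; set S := (X in X <= _ -> _) => h.
  have -> : 512 * r ^+ 2 = 16 ^+ 2 * (2 * r ^+ 2) by ring.
  by rewrite ler_wpM2l ?sqr_ge0.
by rewrite expr2 mulrA mulfK ?gt_eqF//; lra.
Qed.

Let T_upd s i z : T (upd s i z) = T s - q i * (spin s i - clip z).
Proof.
rewrite /T (eq_bigr (fun j => q j * (spin s j - u j) - (j == i)%:R * (q j * (spin s i - clip z)))); last first.
  by move=> j _; rewrite spin_updE; ring.
rewrite sumrB; congr (_ - _).
by rewrite (bigD1 i)//= eqxx mul1r big1 ?addr0// => j /negPf ->; rewrite mul0r.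
Qed.

(** Since |d| <= 2 |q_i|, a cube of |d| is at most 8 r q_i^2. The indicator of T <= t decreases in
    T, so the sign of d matches that of I' - I and d^2 |I - I'| equals d |d| (I' - I). *)
Let stein_pointwise i s z d : d = q i * (spin s i - clip z) ->
  `|d * (F s - F (upd s i z)) - d ^+ 2 / sd * G s| <=
  8 * r * q i ^+ 2 / sd ^+ 2 * (steinK + 2 * `|T s / sd|) +
  4 / sd * (d * `|d| * (I (upd s i z) - I s)).
Proof.
move=> dE.
have d2 : `|d| <= 2 * `|q i|.
  rewrite dE normrM mulrC ler_wpM2r//.
  by rewrite (le_trans (ler_normB _ _))// (_ : 2 = 1 + 1)// lerD// ?spin_norm// clip_norm.
have K1 := @steinK_ge1 R.
set x := T s / sd; set y := T (upd s i z) / sd.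
have xy : x - y = d / sd by rewrite /x /y T_upd -dE -mulrBl; congr (_ / _); ring.
have -> : d * (F s - F (upd s i z)) - d ^+ 2 / sd * G s =
  d * (steinf t x - steinf t y - (x - y) * steing t x).
  rewrite xy (_ : F s = steinf t x)// (_ : F (upd s i z) = steinf t y)// (_ : G s = steing t x)//.
  by move: (steinf t x) (steinf t y) (steing t x) => a b g; ring.
rewrite normrM.
apply: le_trans (ler_wpM2l (normr_ge0 _) (stein_increment t x y)) _.
rewrite xy normrM (gtr0_norm (x := sd^-1)) ?invr_gt0//.
have -> : `|d| * (`|d| / sd * (`|d| / sd * (steinK + 2 * `|x|) + 4 * `|(x <= t)%R%:R - (y <= t)%R%:R|)) =
   `|d| ^+ 3 / sd ^+ 2 * (steinK + 2 * `|x|) +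
   4 / sd * (`|d| ^+ 2 * `|(x <= t)%R%:R - (y <= t)%R%:R|).
  by field; rewrite gt_eqF.
apply: lerD.
  apply: ler_wpM2r; first by rewrite addr_ge0 ?mulr_ge0//; lra.
  apply: ler_wpM2r; first by rewrite invr_ge0 sqr_ge0.
  apply: (le_trans (y := (2 * `|q i|) ^+ 3)); first by rewrite lerXn2r ?nnegrE// mulr_ge0.
  rewrite exprMn -mulrA (_ : 2 ^+ 3 = 8 :> R); last by ring.
  by rewrite ler_wpM2l// exprSr real_normK ?num_real// mulrC ler_wpM2r ?sqr_ge0.
apply: ler_wpM2l; first by rewrite divr_ge0// ltW.
rewrite /I -/x -/y; move: xy.
have [d0|d0] := leP 0 d.
  rewrite (ger0_norm d0) => xy.
  have yx : y <= x by rewrite -subr_ge0 xy divr_ge0// ltW.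
  rewrite expr2; apply: ler_wpM2l; first exact: mulr_ge0.
  case: (leP x t) => xt; case: (leP y t) => yt /=; rewrite ?subrr ?normr0//.
    by have := le_trans yx xt; rewrite leNgt yt.
  by rewrite sub0r normrN1 subr0.
rewrite (ltr0_norm d0) => xy.
have yx : x <= y by rewrite -subr_le0 xy mulr_le0_ge0 ?invr_ge0// ltW.
have -> : d * - d = - (d ^+ 2) by ring.
rewrite sqrrN mulNr -mulrN opprB; apply: ler_wpM2l; first exact: sqr_ge0.
case: (leP x t) => xt; case: (leP y t) => yt /=; rewrite ?subrr ?normr0//.
  by rewrite subr0 normr1.
by have := le_trans yx yt; rewrite leNgt xt.
Qed.

Let Jsq i s := tmean mu (fun z => (spin s i - clip z) ^+ 2) (th i s).

(** The mean square distance of a point to an independent draw is its squared distance to the mean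
    plus the variance; relative to [Lsq] the variance thus enters twice. *)
Let JsqE i s : Jsq i s = Lsq mu A c i s + 2 * tvar mu (th i s).
Proof.
have Wt := weight_tilted mu (th i s); have Bc := @BM_clip R.
have B2 : BM (fun z : RR => clip z ^+ 2) by BM.
transitivity (Ex mu (tilted mu (th i s)) (fun z => spin s i ^+ 2 - 2 * spin s i * clip z + clip z ^+ 2)).
  by apply: eq_Ex => z; ring.
rewrite (ExD Wt); [|by apply: BMB; BM|by []].
rewrite (ExB Wt); [|by BM..].
rewrite (ExZ Wt)// (Ex_cst Wt) /Lsq /resid /bm.
have -> : Ex mu (tilted mu (th i s)) (fun z => clip z ^+ 2) = tvar mu (th i s) + m1 mu (th i s) ^+ 2.
  have h : tvar mu (th i s) = tmean mu (fun z => clip z ^+ 2) (th i s) - m1 mu (th i s) ^+ 2 by exact: tvar_def.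
  by rewrite h subrK.
have -> : Ex mu (tilted mu (th i s)) clip = m1 mu (th i s) by rewrite m1E.
by move: (m1 mu (th i s)) (tvar mu (th i s)) (spin s i) => a b x; ring.
Qed.

(** Averaging [stein_pointwise] over the exchangeable pair: d changes sign under the swap, so E d (F
    - F') = 2 E d F, and the indicator term becomes -2 E d |d| I, with conditional kernel
    [Hanti]. *)
Let stein_coord i :
  `|2 * E (fun s => q i * resid i s * F s) - sd^-1 * E (fun s => q i ^+ 2 * Jsq i s * G s)| <=
  8 * r * q i ^+ 2 / sd ^+ 2 * E (fun s => steinK + 2 * `|T s / sd|)
  - 8 / sd * E (fun s => I s * ((q i * `|q i|) * Hanti mu A c i s)).
Proof.
have Bd : BM (fun p : cfg * RR => spin p.1 i - clip p.2) by exact: BM_spin_clip.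
pose d (p : cfg * RR) := q i * (spin p.1 i - clip p.2).
have Bdd : BM d by apply: BMM => //; exact: BM_cst.
have BF1 : BM (fun p : cfg * RR => F p.1) by exact: BM_fst.
have BF2 : BM (fun p : cfg * RR => F (upd p.1 i p.2)) by exact: BM_upd.
have BG1 : BM (fun p : cfg * RR => G p.1) by exact: BM_fst.
have BI1 : BM (fun p : cfg * RR => I p.1) by exact: BM_fst.
have BI2 : BM (fun p : cfg * RR => I (upd p.1 i p.2)) by exact: BM_upd.
have BT1 : BM (fun p : cfg * RR => T p.1 / sd) by exact: (BM_fst BTs).
have BdF1 : BM (fun p => d p * F p.1) by exact: BMM.
have BdF2 : BM (fun p => d p * F (upd p.1 i p.2)) by exact: BMM.
have BddG : BM (fun p => d p ^+ 2 / sd * G p.1) by exact: (BMM (BMM (BMX 2 Bdd) (BM_cst _ _)) BG1).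
have BK : BM (fun p : cfg * RR => steinK + 2 * `|T p.1 / sd|) by BM.
have BdI1 : BM (fun p => d p * `|d p| * I p.1) by exact: (BMM (BMM Bdd (BM_norm Bdd)) BI1).
have BdI2 : BM (fun p => d p * `|d p| * I (upd p.1 i p.2)) by exact: (BMM (BMM Bdd (BM_norm Bdd)) BI2).
have swapd p : d (upd p.1 i p.2, tnth p.1 i) = - d p.
  by rewrite /d /= spin_upd eqxx /spin; ring.
have a1 : E2 i (fun p => d p * F p.1) = E (fun s => q i * resid i s * F s).
  transitivity (E2 i (fun p => F p.1 * d p)); first by apply: eq_Ex => s; apply: eq_Ex => z; rewrite mulrC.
  rewrite (E2_mul mu A c i F Bdd); apply: eq_Ex => s; rewrite mulrC; congr (_ * _).
  have Wt := weight_tilted mu (th i s); have Bc := @BM_clip R.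
  have Bsc : BM (fun z : RR => spin s i - clip z) by apply: BMB => //; exact: BM_cst.
  rewrite /tmean /d/= (ExZ Wt)// (ExB Wt)//; last exact: BM_cst.
  by rewrite (Ex_cst Wt) /resid /bm m1E.
have a2 : E2 i (fun p => d p * F (upd p.1 i p.2)) = - E2 i (fun p => d p * F p.1).
  apply: etrans (E2_swap mu cA c i BdF2) _.
  transitivity (E2 i (fun p => -1 * (d p * F p.1))).
    by apply: eq_Ex => s; apply: eq_Ex => z; rewrite swapd /= upd_upd upd_tnth; ring.
  by apply: etrans (E2Z mu A c i (-1) BdF1) _; exact: mulN1r.
have a3 : E2 i (fun p => d p ^+ 2 / sd * G p.1) = sd^-1 * E (fun s => q i ^+ 2 * Jsq i s * G s).
  have B2 : BM (fun p : cfg * RR => (spin p.1 i - clip p.2) ^+ 2) by BM.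
  have BJ : BM (Jsq i) by exact: (BM_tmean mu A c i B2).
  rewrite -(ExZ W); last by BM.
  transitivity (E2 i (fun p => (q i ^+ 2 / sd * G p.1) * (spin p.1 i - clip p.2) ^+ 2)).
    by apply: eq_Ex => s; apply: eq_Ex => z; rewrite /d /=; ring.
  rewrite (E2_mul mu A c i (fun s => q i ^+ 2 / sd * G s) B2); apply: eq_Ex => s.
  by rewrite -/(Jsq i s); ring.
have a4 : E2 i (fun p => d p * `|d p| * I (upd p.1 i p.2)) = - E2 i (fun p => d p * `|d p| * I p.1).
  apply: etrans (E2_swap mu cA c i BdI2) _.
  transitivity (E2 i (fun p => -1 * (d p * `|d p| * I p.1))).
    by apply: eq_Ex => s; apply: eq_Ex => z; rewrite swapd /= upd_upd upd_tnth normrN; ring.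
  by apply: etrans (E2Z mu A c i (-1) BdI1) _; exact: mulN1r.
have a5 : E2 i (fun p => d p * `|d p| * I p.1) = E (fun s => I s * ((q i * `|q i|) * Hanti mu A c i s)).
  have BHk : BM (fun p : cfg * RR => Hker (spin p.1 i) p.2) by apply: BMM => //; exact: BM_norm.
  transitivity (E2 i (fun p => (I p.1 * (q i * `|q i|)) * Hker (spin p.1 i) p.2)).
    by apply: eq_Ex => s; apply: eq_Ex => z; rewrite /d /Hker /= normrM; ring.
  rewrite (E2_mul mu A c i (fun s => I s * (q i * `|q i|)) BHk); apply: eq_Ex => s.
  by rewrite -/(Hanti mu A c i s); ring.
pose k p := d p * F p.1 - d p * F (upd p.1 i p.2) - d p ^+ 2 / sd * G p.1.
have Bk : BM k by exact: (BMB (BMB BdF1 BdF2) BddG).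
pose h p := 8 * r * q i ^+ 2 / sd ^+ 2 * (steinK + 2 * `|T p.1 / sd|) +
  4 / sd * (d p * `|d p| * I (upd p.1 i p.2) - d p * `|d p| * I p.1).
have Bh : BM h.
  by apply: BMD; apply: BMM; [exact: BM_cst|by []|exact: BM_cst|exact: BMB].
have kh p : `|k p| <= h p.
  have := @stein_pointwise i p.1 p.2 (d p) (erefl _); rewrite /k /h.
  by rewrite !mulrBr.
have e1 : E2 i k = 2 * E (fun s => q i * resid i s * F s) - sd^-1 * E (fun s => q i ^+ 2 * Jsq i s * G s).
  apply: etrans (E2B mu A c i (BMB BdF1 BdF2) BddG) _.
  rewrite a3 -a1; congr (_ - _); apply: etrans (E2B mu A c i BdF1 BdF2) _.
  by rewrite a2; ring.
pose m p := d p * `|d p| * I (upd p.1 i p.2) - d p * `|d p| * I p.1.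
have Bm : BM m by exact: BMB.
have e2 : E2 i h = 8 * r * q i ^+ 2 / sd ^+ 2 * E (fun s => steinK + 2 * `|T s / sd|)
  - 8 / sd * E (fun s => I s * ((q i * `|q i|) * Hanti mu A c i s)).
  set y := 8 * r * q i ^+ 2 / sd ^+ 2.
  transitivity (E2 i (fun p => y * (steinK + 2 * `|T p.1 / sd|) - (- (4 / sd)) * m p)).
    by apply: eq_Ex => s; apply: eq_Ex => z; rewrite /h mulNr opprK.
  apply: etrans (E2B mu A c i (BMM (BM_cst _ y) BK) (BMM (BM_cst _ (- (4 / sd))) Bm)) _.
  congr (_ - _).
    apply: etrans (E2Z mu A c i y BK) _; congr (_ * _).
    exact: (E2_fst mu A c i (fun s => steinK + 2 * `|T s / sd|)).
  apply: etrans (E2Z mu A c i (- (4 / sd)) Bm) _.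
  rewrite -a5; have -> : E2 i m = - 2 * E2 i (fun p => d p * `|d p| * I p.1).
    by apply: etrans (E2B mu A c i BdI2 BdI1) _; rewrite a4; ring.
  by ring.
rewrite -e1 -e2 ler_norml; apply/andP; split.
  rewrite lerNl -mulN1r; apply: le_trans (_ : E2 i (fun p => -1 * k p) <= _).
    by rewrite le_eqVlt; apply/orP; left; apply/eqP; exact: esym (E2Z mu A c i (-1) Bk).
  apply: (E2_le mu A c i (BMM (BM_cst _ (-1)) Bk) Bh) => p.
  by have := kh p; rewrite ler_norml mulN1r => /andP[h1 h2]; rewrite lerNl.
apply: (E2_le mu A c i Bk Bh) => p.
by have := kh p; rewrite ler_norml => /andP[].
Qed.

Let S1 := E (fun s => (\sum_i q i * resid i s) * F s).
Let SJ := E (fun s => (\sum_i q i ^+ 2 * Jsq i s) * G s).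
Let iota := sd^-1.
Let iota0 : 0 < iota. Proof. by rewrite invr_gt0. Qed.

Let BJ i : BM (Jsq i).
Proof.
have B2 : BM (fun p : cfg * RR => (spin p.1 i - clip p.2) ^+ 2).
  by apply: BMX; exact: BM_spin_clip.
exact: (BM_tmean mu A c i B2).
Qed.

Let E_abs8 : E (fun s => steinK + 2 * `|T s / sd|) <= steinK + 2 * (iota * (1 + C1)).
Proof.
have BTn : BM (fun s => `|T s|) by exact: BM_norm.
apply: (le_trans (y := E (fun s => steinK + 2 * iota * `|T s|))).
  by rewrite le_eqVlt; apply/orP; left; apply/eqP; apply: eq_Ex => s; rewrite normrM (gtr0_norm iota0); ring.
rewrite (ExD W (BM_cst _ _) (BMM (BM_cst _ _) BTn)) (Ex_cst W) (ExZ W _ BTn) lerD2l -mulrA.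
by rewrite ler_wpM2l// ler_wpM2l// ltW.
Qed.

Let stein_sum1 : `|2 * S1 - iota * SJ| <=
  8 * r * iota ^+ 2 * (steinK + 2 * (iota * (1 + C1))) + 8 * iota * (513 * r).
Proof.
have B1 i : BM (fun s => q i * resid i s * F s).
  by apply: BMM => //; apply: BMM => //; exact: BM_cst.
have B2 i : BM (fun s => q i ^+ 2 * Jsq i s * G s).
  by apply: BMM => //; apply: BMM => //; exact: BM_cst.
have BHi i : BM (fun s => (q i * `|q i|) * Hanti mu A c i s).
  by apply: BMM; [exact: BM_cst | exact: BM_Hanti].
have B3 i : BM (fun s => I s * ((q i * `|q i|) * Hanti mu A c i s)) by exact: BMM.
have -> : S1 = \sum_i E (fun s => q i * resid i s * F s).
  by rewrite -(Ex_sum W _ _ B1); apply: eq_Ex => s; rewrite mulr_suml.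
have -> : SJ = \sum_i E (fun s => q i ^+ 2 * Jsq i s * G s).
  by rewrite -(Ex_sum W _ _ B2); apply: eq_Ex => s; rewrite mulr_suml.
rewrite !mulr_sumr -sumrB; apply: le_trans (ler_norm_sum _ _ _) _.
apply: le_trans (ler_sum _ (fun i _ => stein_coord i)) _.
rewrite sumrB -mulr_sumr; set e3 := \sum_i E _.
have he3 : - e3 <= 513 * r.
  have -> : e3 = E (fun s => I s * \sum_i (q i * `|q i|) * Hanti mu A c i s).
    by rewrite /e3 -(Ex_sum W _ _ B3); apply: eq_Ex => s; rewrite mulr_sumr.
  have BS : BM (fun s => \sum_i (q i * `|q i|) * Hanti mu A c i s) by exact: BM_sum.
  apply: le_trans E_abs6; apply: le_trans (ler_norm _) _; rewrite normrN.
  apply: le_trans (Ex_norm W (BMM BI BS)) _.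
  apply: (Ex_le W (BM_norm (BMM BI BS)) (BM_norm BS)) => s; rewrite normrM.
  rewrite -[leRHS]mul1r ler_wpM2r//.
  by rewrite /I; case: (T s / sd <= t); rewrite ?normr1 ?normr0.
apply: lerD.
  rewrite -mulr_suml -mulr_suml -mulr_sumr hq mulr1 -exprVn -/iota.
  apply: ler_wpM2l; first by rewrite mulr_ge0 ?sqr_ge0// mulr_ge0// ltW.
  exact: E_abs8.
rewrite -mulrN -/iota; apply: ler_wpM2l he3.
by rewrite mulr_ge0// ltW.
Qed.

Let Q1_le : `|Q1| <= Y.
Proof.
apply: le_trans (le_sqr_div_add Q1 r0) _; rewrite /Y addrC lerD2l ler_wpM2r//.
  by rewrite invr_ge0 ltW.
by rewrite lerDr; apply: sumr_ge0 => j _; exact: sqr_ge0.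
Qed.

Let Gn s : `|G s| <= 2. Proof. exact: (steing_norm t (T s / sd)). Qed.

(** The conditional variance of the jump is 2 ups plus three errors: the centred squares [Lsq], the
    change of psi'' between th and the mean field, and [Q1]. *)
Let stein_sum2 : `|SJ - 2 * ups * E G| <= 2 * (513 * r + 8 * ((2 + K0) * r) + 2 * Y).
Proof.
have BL i : BM (Lsq mu A c i) by exact: BM_Lsq.
have BSL : BM (fun s => \sum_i q i ^+ 2 * Lsq mu A c i s).
  by apply: BM_sum => i; apply: BMM => //; exact: BM_cst.
have BSF : BM (fun s => \sum_i q i ^+ 2 * `|fluct i s|).
  by apply: BM_sum => i; apply: BMM; [exact: BM_cst | exact: BM_norm].
have BSJ : BM (fun s => \sum_i q i ^+ 2 * Jsq i s).
  by apply: BM_sum => i; apply: BMM => //; exact: BM_cst.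
have BX : BM (fun s => (\sum_i q i ^+ 2 * Jsq i s - 2 * ups) * G s).
  by apply: BMM => //; apply: BMB => //; exact: BM_cst.
have -> : SJ - 2 * ups * E G = E (fun s => (\sum_i q i ^+ 2 * Jsq i s - 2 * ups) * G s).
  rewrite -(ExZ W _ BG) -(ExB W (BMM BSJ BG) (BMM (BM_cst _ _) BG)).
  by apply: eq_Ex => s; rewrite mulrBl.
apply: le_trans (Ex_norm W BX) _.
pose b s := 2 * (`|\sum_i q i ^+ 2 * Lsq mu A c i s| + 8 * \sum_i q i ^+ 2 * `|fluct i s| + 2 * Y).
have BB : BM b.
  apply: BMM; first exact: BM_cst.
  apply: BMD; last exact: BM_cst.
  by apply: BMD; [exact: BM_norm | apply: BMM => //; exact: BM_cst].
apply: (le_trans (y := E b)).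
  apply: (Ex_le W (BM_norm BX) BB) => s; rewrite normrM mulrC.
  apply: ler_pM => //.
  have -> : \sum_i q i ^+ 2 * Jsq i s - 2 * ups =
    \sum_i q i ^+ 2 * Lsq mu A c i s + 2 * \sum_i q i ^+ 2 * (tvar mu (th i s) - D i) + 2 * Q1.
    have us : \sum_i q i ^+ 2 * ups = ups by rewrite -mulr_suml hq mul1r.
    rewrite -{1}us /Q1 !mulr_sumr -sumrB -!big_split/=; apply: eq_bigr => i _.
    rewrite JsqE; move: (Lsq _ _ _ i s) (tvar mu (th i s)) (D i) => x y z; ring.
  have h2 : `|\sum_i q i ^+ 2 * (tvar mu (th i s) - D i)| <= 4 * \sum_i q i ^+ 2 * `|fluct i s|.
    apply: le_trans (ler_norm_sum _ _ _) _; rewrite mulr_sumr; apply: ler_sum => i _.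
    rewrite normrM ger0_norm ?sqr_ge0// mulrCA ler_wpM2l ?sqr_ge0//.
    rewrite /D (th_fluct A c u); apply: le_trans (tvar_lipschitz _ _ _) _.
    by rewrite addrC addKr.
  apply: le_trans (ler_normD _ _) _; apply: lerD.
    apply: le_trans (ler_normD _ _) _; rewrite lerD2l normrM ger0_norm//.
    have -> : 8 * \sum_i q i ^+ 2 * `|fluct i s| = 2 * (4 * \sum_i q i ^+ 2 * `|fluct i s|) by ring.
    by rewrite ler_wpM2l.
  by rewrite normrM ger0_norm// ler_wpM2l.
rewrite /b (ExZ W); last first.
  apply: BMD; last exact: BM_cst.
  by apply: BMD; [exact: BM_norm | apply: BMM => //; exact: BM_cst].
rewrite (ExD W _ (BM_cst _ _)); last by apply: BMD; [exact: BM_norm | apply: BMM => //; exact: BM_cst].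
rewrite (ExD W (BM_norm BSL) (BMM (BM_cst _ _) BSF)) (ExZ W _ BSF) (Ex_cst W).
rewrite ler_wpM2l// lerD2r lerD// ler_wpM2l//.
Qed.

(** The drift: sum q_i resid_i = theta T - ups e.(sigma - u) - v.(sigma - u) minus a quadratic
    Taylor remainder, by symmetry of [A] and A q = lambda q + e. *)
Let stein_sum3 : `|S1 - theta * E (fun s => T s * F s)| <=
  steinK * ((1 + C1) * r + (1 + C1) * Y + 4 * ((1 + K0) * r)).
Proof.
have K1 := @steinK_ge1 R.
have BS : BM (fun s => \sum_i q i * resid i s).
  by apply: BM_sum => i; apply: BMM => //; exact: BM_cst.
have BX : BM (fun s => (\sum_i q i * resid i s - theta * T s) * F s).
  by apply: BMM => //; apply: BMB => //; apply: BMM => //; exact: BM_cst.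
have -> : S1 - theta * E (fun s => T s * F s) = E (fun s => (\sum_i q i * resid i s - theta * T s) * F s).
  rewrite -(ExZ W _ (BMM BT BF)) -(ExB W (BMM BS BF) (BMM (BM_cst _ _) (BMM BT BF))).
  by apply: eq_Ex => s; ring.
apply: le_trans (Ex_norm W BX) _.
have Be := BM_norm (BM_lin e); have Bv := BM_norm (BM_lin v).
have Bf2 : BM (fun s => \sum_i `|q i| * fluct i s ^+ 2).
  by apply: BM_sum => i; apply: BMM; [exact: BM_cst | exact: BMX].
pose b s := steinK * (`|\sum_j e j * (spin s j - u j)| + `|\sum_j v j * (spin s j - u j)|
   + 4 * \sum_i `|q i| * fluct i s ^+ 2).
have Bb' : BM (fun s => `|\sum_j e j * (spin s j - u j)| + `|\sum_j v j * (spin s j - u j)|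
   + 4 * \sum_i `|q i| * fluct i s ^+ 2).
  by apply: BMD; [exact: BMD | apply: BMM => //; exact: BM_cst].
have Bb : BM b by apply: BMM => //; exact: BM_cst.
apply: (le_trans (y := E b)).
  apply: (Ex_le W (BM_norm BX) Bb) => s; rewrite normrM mulrC.
  apply: ler_pM => //; first exact: steinf_norm.
  pose rr i := bm mu A c i s - u i - fluct i s * D i.
  have rr4 i : `|rr i| <= 4 * fluct i s ^+ 2.
    by rewrite /rr uE /bm (th_fluct A c u); exact: m1_taylor.
  have -> : \sum_i q i * resid i s - theta * T s =
    - ups * (\sum_j e j * (spin s j - u j)) - \sum_j v j * (spin s j - u j) - \sum_i q i * rr i.
    have h1 : \sum_j v j * (spin s j - u j) = \sum_j q j * (D j - ups) * fluct j s.
      rewrite /v (mv_sym cA); apply: eq_bigr => j _; by rewrite -fluctE.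
    have h2 : \sum_j e j * (spin s j - u j) = \sum_j (q j * fluct j s - lambda * (q j * (spin s j - u j))).
      rewrite /e sumrB -mulr_sumr; under eq_bigr do rewrite mulrBl.
      rewrite sumrB (mv_sym cA) mulr_sumr; congr (_ - _); apply: eq_bigr => j _.
        by rewrite -fluctE.
      by rewrite mulrA.
    rewrite h1 h2 /T /theta !mulr_sumr -!sumrB; apply: eq_bigr => i _.
    rewrite /rr /resid; move: (fluct i s) (bm mu A c i s) (D i) => x y z; ring.
  have h3 : `|\sum_i q i * rr i| <= 4 * \sum_i `|q i| * fluct i s ^+ 2.
    apply: le_trans (ler_norm_sum _ _ _) _; rewrite mulr_sumr; apply: ler_sum => i _.
    by rewrite normrM mulrCA ler_wpM2l.
  apply: le_trans (ler_normB _ _) _; apply: lerD => //.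
  apply: le_trans (ler_normB _ _) _; rewrite lerD2r normrM normrN.
  case: ups01 => u0 u1; rewrite (gtr0_norm u0) -[leRHS]mul1r.
  by rewrite ler_wpM2r.
rewrite /b (ExZ W _ Bb') ler_wpM2l//; first by lra.
rewrite (ExD W (BMD Be Bv) (BMM (BM_cst _ _) Bf2)) (ExD W Be Bv) (ExZ W _ Bf2).
by apply: lerD; [exact: lerD | rewrite ler_wpM2l].
Qed.

(** Here [j] bounds 1 / sd; 2052 = 4 * 513 comes from the antisymmetric kernel and 531 = 513 + 16 +
    2 from [stein_sum2], using r <= Y. *)
Definition stein_const (kap ups : R) : R :=
  let j := 1 + 2 / ups in let K0 := stein_K0 kap in let C1 := stein_C1 kap in
  ups^-1 * (4 * j * (steinK + 2 * (j * (1 + C1))) + (2052 + 531 + 8 * K0) +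
            kap * (steinK * (2 * (1 + C1) + 4 * (1 + K0)))).

(** 2 iota <= iota^2 + 1 and iota^2 = theta / ups <= 2 / ups, which keeps the root and [lambda] out
    of the constant. *)
Let iota_le : iota <= 1 + 2 / ups.
Proof.
case: ups01 => u0 u1.
have i2 : iota ^+ 2 <= 2 / ups.
  by rewrite /iota exprVn sd2 invf_div ler_wpM2r// invr_ge0 ltW.
have ui : 0 <= 2 / ups by rewrite divr_ge0// ltW.
have := sqr_ge0 (iota - 1).
by rewrite (_ : (iota - 1) ^+ 2 = iota ^+ 2 - 2 * iota + 1); [lra | ring].
Qed.

Let sd_le : sd <= kap.
Proof.
case: ups01 => u0 u1; case: rho01 => p0 p1.
have k1 : 1 <= kap by rewrite /kap invf_ge1; lra.
suff h : sd ^+ 2 <= kap ^+ 2 by move: h; rewrite ler_pXn2r// nnegrE ltW.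
rewrite sd2; apply: (le_trans (y := kap)); last by rewrite expr2 -[leLHS]mulr1 ler_wpM2l// ltW.
rewrite -[leRHS]mul1r; apply: ler_pM => //; first exact: ltW.
  by rewrite invr_ge0 ltW.
by rewrite /kap lef_pV2 ?posrE//; lra.
Qed.

Lemma stein_kolmogorov : `|E I - Phi t| <= stein_const kap ups * Y.
Proof.
case: ups01 => u0 u1.
have K1 := @steinK_ge1 R.
have EG : E G = iota * E (fun s => T s * F s) + E I - Phi t.
  have BTF := BMM BT BF.
  have B1 : BM (fun s => iota * (T s * F s)) by apply: BMM => //; exact: BM_cst.
  rewrite -(ExZ W _ BTF) -(ExD W B1 BI).
  rewrite -[X in _ = _ - X](Ex_cst W) -(ExB W (BMD B1 BI) (BM_cst _ _)).
  by apply: eq_Ex => s; rewrite /G /iota; ring.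
have := stein_sum1; have := stein_sum2; have := stein_sum3.
move: EG; move: (E G) (E I) (E (fun s => T s * F s)) => g p tf gE h3 h2 h1.
have e1 : iota * ups * iota = theta.
  apply: (mulIf (x := sd)); first by rewrite gt_eqF.
  by rewrite /iota divfK ?gt_eqF// sdV mulrC.
(* The three sums combine so that [S1], [SJ] and E[T F] cancel; iota^2 ups = theta is the choice of
   the limiting variance. *)
have e2 : iota * ups * (p - Phi t) =
  - (2 * S1 - iota * SJ) / 2 - iota * (SJ - 2 * ups * g) / 2 + (S1 - theta * tf).
  rewrite -e1 gE; by field.
have h4 : iota * ups * `|p - Phi t| <=
  (8 * r * iota ^+ 2 * (steinK + 2 * (iota * (1 + C1))) + 8 * iota * (513 * r)) / 2 +
  iota * (2 * (513 * r + 8 * ((2 + K0) * r) + 2 * Y)) / 2 +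
  steinK * ((1 + C1) * r + (1 + C1) * Y + 4 * ((1 + K0) * r)).
  have iu : 0 <= iota * ups by rewrite mulr_ge0 ?ltW.
  rewrite -{1}(ger0_norm iu) -normrM e2.
  apply: le_trans (ler_normD _ _) _; apply: lerD => //.
  apply: le_trans (ler_normB _ _) _; apply: lerD.
    by rewrite mulNr normrN normrM (gtr0_norm (x := 2^-1)) ?invr_gt0// ler_wpM2r// invr_ge0.
  rewrite normrM (gtr0_norm (x := 2^-1)) ?invr_gt0// ler_wpM2r// ?invr_ge0//.
  by rewrite normrM (gtr0_norm iota0) ler_wpM2l// ltW.
have Yr := Y_ge_r.
have i0 := ltW iota0.
have c0 : 0 <= 1 + C1 by exact: addr_ge0.
have k0 : 0 <= 1 + K0 by exact: addr_ge0.
have s0 : 0 <= steinK :> R by lra.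
have h5 : iota * ups * `|p - Phi t| <=
  iota * ((4 * iota * (steinK + 2 * (iota * (1 + C1))) + (2052 + 531 + 8 * K0)) * Y) +
  steinK * (2 * (1 + C1) + 4 * (1 + K0)) * Y.
  apply: le_trans h4 _.
  have a0 : 0 <= 4 * iota * (steinK + 2 * (iota * (1 + C1))).
    apply: mulr_ge0; first exact: mulr_ge0.
    by apply: addr_ge0 => //; apply: mulr_ge0 => //; exact: mulr_ge0.
  have -> : (8 * r * iota ^+ 2 * (steinK + 2 * (iota * (1 + C1))) + 8 * iota * (513 * r)) / 2 +
    iota * (2 * (513 * r + 8 * ((2 + K0) * r) + 2 * Y)) / 2 =
    iota * (4 * iota * (steinK + 2 * (iota * (1 + C1))) * r + (2052 + 529 + 8 * K0) * r + 2 * Y) by field.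
  apply: lerD.
    apply: ler_wpM2l => //.
    have := ler_wpM2l a0 Yr.
    have b0 : 0 <= 2052 + 529 + 8 * K0 by have := K00; lra.
    have := ler_wpM2l b0 Yr; lra.
  rewrite -mulrA; apply: ler_wpM2l; first lra.
  have d0 : 0 <= 4 * (1 + K0) by exact: mulr_ge0.
  have := ler_wpM2l c0 Yr; have := ler_wpM2l d0 Yr; lra.
have ui : 0 < iota * ups by rewrite mulr_gt0.
rewrite -(ler_pM2l ui); apply: le_trans h5 _.
rewrite /stein_const -/K0 -/C1.
have -> : iota * ups * (ups^-1 * (4 * (1 + 2 / ups) * (steinK + 2 * ((1 + 2 / ups) * (1 + C1))) +
     (2052 + 531 + 8 * K0) + kap * (steinK * (2 * (1 + C1) + 4 * (1 + K0)))) * Y) =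
  iota * ((4 * (1 + 2 / ups) * (steinK + 2 * ((1 + 2 / ups) * (1 + C1))) + (2052 + 531 + 8 * K0)) * Y)
  + (iota * kap) * (steinK * (2 * (1 + C1) + 4 * (1 + K0)) * Y).
  by field; rewrite gt_eqF.
have j0 : 0 <= 1 + 2 / ups by apply: addr_ge0 => //; apply: divr_ge0 => //; exact: ltW.
have sK : 0 <= steinK * (2 * (1 + C1) + 4 * (1 + K0)) * Y.
  by apply: mulr_ge0 => //; apply: mulr_ge0 => //; apply: addr_ge0; exact: mulr_ge0.
apply: lerD.
  apply: ler_wpM2l => //; apply: ler_wpM2r => //; rewrite lerD2r.
  apply: ler_pM; [exact: mulr_ge0| |by rewrite ler_wpM2l|].
    by apply: addr_ge0 => //; apply: mulr_ge0 => //; exact: mulr_ge0.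
  by rewrite lerD2l ler_wpM2l// ler_wpM2r.
(* The drift error lacks the factor iota of the others; iota * kap >= 1 supplies it. *)
rewrite -[leLHS]mul1r ler_wpM2r//.
by rewrite -(@mulVf _ sd) ?gt_eqF// ler_wpM2l.
Qed.

End stein_bound.

(** * The mean-field optimizer *)

Section base_measure.
Context {R : realType}.
Local Notation RR := (measurableTypeR R).
Variable mu : probability RR R.
Hypothesis bmu : base_measure mu.
Local Notation m1 := (m1 mu).
Local Notation tvar := (tvar mu).

(** Locked copies of the three functions, so that conversion does not unfold their integrals. *)
Let psi : R -> R := locked (Defs.psi mu).
Let phi : R -> R := locked (Defs.phi mu).
Let rate0 : R -> R := locked (Defs.rate0 mu).

Let psi_lock : Defs.psi mu = psi. Proof. by rewrite /psi -lock. Qed.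
Let phi_lock : Defs.phi mu = phi. Proof. by rewrite /phi -lock. Qed.
Let rate0_lock : Defs.rate0 mu = rate0. Proof. by rewrite /rate0 -lock. Qed.

Let rate0E z : rate0 z = z * phi z - psi (phi z).
Proof. by rewrite -rate0_lock -phi_lock -psi_lock. Qed.

Let psi_derive t : is_derive t (1:R) psi (m1 t).
Proof. by rewrite -psi_lock; exact: psi_derive. Qed.

Lemma Rintegral_ge_indic (f : RR -> R) (U : set RR) k : BM f -> measurable U ->
  (forall z, 0 <= f z) -> (forall z, U z -> k <= f z) ->
  k * fine (mu U) <= \int[mu]_z f z.
Proof.
move=> Bf mU f0 fk.
have BU : BM (\1_U : RR -> R).
  split; first exact: measurable_indic.
  by exists 1 => z; rewrite indicE; case: (_ \in _); rewrite ?normr1 ?normr0.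
have -> : k * fine (mu U) = \int[mu]_z (k * \1_U z).
  rewrite RintegralZl//; last exact: BM_integrable.
  by rewrite /Rintegral integral_indic// setIT.
apply: le_Rintegral => //; [by apply: BM_integrable; BM|exact: BM_integrable|].
move=> z _; rewrite indicE; case: (boolP (z \in U)) => zU; rewrite ?mulr1 ?mulr0//.
by apply: fk; rewrite inE in zU.
Qed.

Lemma open_halfline (sg e : R) : open [set z : R | 1 - e < sg * z].
Proof.
have cg : continuous (fun z : R => sg * z) by exact: mulrl_continuous.
have := @open_comp _ _ (fun z : R => sg * z) [set y | 1 - e < y] (fun x _ => cg x).
by apply; exact: open_gt.
Qed.

Lemma support_halfline_gt0 (sg : R) e : sg = 1 \/ sg = -1 -> 0 < e ->
  0 < fine (mu [set z | 1 - e < sg * z]).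
Proof.
move=> sgE e0.
have op := @open_halfline sg e.
have : (0 < mu [set z | 1 - e < sg * z]%R)%E.
  have [_ _ sN1 s1] := bmu.
  by case: sgE => sgE; [apply: s1 | apply: sN1] => //=; rewrite sgE; lra.
by move=> h; rewrite fine_gt0// h/= ltey_eq fin_num_measure//; exact: open_measurable.
Qed.

Lemma measurable_halfline (sg e : R) : measurable [set z : RR | 1 - e < sg * z].
Proof. by apply: open_measurable; exact: open_halfline. Qed.

Lemma clip_halfline (sg e z : R) : sg = 1 \/ sg = -1 -> 0 <= e ->
  1 - e < sg * z -> 1 - e <= sg * clip z.
Proof.
move=> sgE e0; rewrite /clip maxEle minEle.
by case: sgE => ->; case: (leP z 1) => h1 /=; [case: (leP (-1) z) | case: (leP (-1) 1)
  | case: (leP (-1) z) | case: (leP (-1) 1)]; lra.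
Qed.

(** Near the endpoint lying on the opposite side of 0 from the mean, [mu] has positive mass and the
    spin is at distance at least 1/2 from the mean. *)
Lemma tvar_gt0 t : 0 < tvar t.
Proof.
pose m := m1 t.
have [sg sgE sgm] : exists2 sg : R, sg = 1 \/ sg = -1 & sg * m <= 0.
  have [m0|m0] := leP m 0; [exists 1; [by left | lra] | exists (-1); [by right | lra]].
have h2 : 0 < 1 / 2 :> R by lra.
have pU := support_halfline_gt0 sgE h2.
have Bc := @BM_clip R.
have Bf : BM (fun z : RR => tilted mu t z * (clip z - m) ^+ 2).
  by apply: BMM; [exact: BM_tilted | apply: BMX; apply: BMB => //; exact: BM_cst].
have [_ tw0 _] := weight_tilted mu t.
pose k := expR (- `|t|) / mgf mu t * (1 / 4).
have k0 : 0 < k by rewrite mulr_gt0 ?divr_gt0 ?expR_gt0 ?mgf_gt0//; lra.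
rewrite tvarE; apply: lt_le_trans (mulr_gt0 k0 pU) _.
apply: (Rintegral_ge_indic Bf (measurable_halfline _ _)) => [z|z Uz].
  by rewrite mulr_ge0 ?sqr_ge0.
have cz := clip_halfline sgE (ltW h2) Uz.
apply: ler_pM; [by rewrite divr_ge0 ?expR_ge0// ltW// mgf_gt0|by lra| |].
  rewrite /tilted ler_pM2r ?invr_gt0 ?mgf_gt0// ler_expR.
  have := ler_norm (- (t * clip z)); rewrite normrN normrM.
  have : `|t| * `|clip z| <= `|t| by rewrite -[leRHS]mulr1 ler_wpM2l// clip_norm.
  lra.
have -> : (clip z - m) ^+ 2 = (sg * clip z - sg * m) ^+ 2.
  by case: sgE => ->; ring.
rewrite (_ : 1 / 4 = (1 / 2) ^+ 2); last by field.
by rewrite lerXn2r ?nnegrE; lra.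
Qed.

Lemma m1_increasing a b : a < b -> m1 a < m1 b.
Proof.
move=> ab; have [c _ e] := mean_value a b (m1_derive mu).
by rewrite -subr_gt0 e mulr_gt0 ?tvar_gt0// subr_gt0.
Qed.

Lemma m1_nondecreasing a b : a <= b -> m1 a <= m1 b.
Proof. by rewrite le_eqVlt => /predU1P[->//|/m1_increasing/ltW]. Qed.

Lemma m1_inj : injective m1.
Proof.
move=> a b e; apply/eqP; rewrite eq_le !leNgt; apply/andP; split; apply/negP.
  by move/m1_increasing; rewrite e ltxx.
by move/m1_increasing; rewrite e ltxx.
Qed.

Lemma m1_lt1 t : -1 < m1 t < 1.
Proof.
have h1 : m1 t < m1 (t + 1) by apply: m1_increasing; rewrite ltrDl.
have h2 : m1 (t - 1) < m1 t by apply: m1_increasing; rewrite ltrBlDr ltrDl.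
have l1 : -1 <= m1 (t - 1) by have := m1_norm mu (t - 1); rewrite ler_norml => /andP[].
have l2 : m1 (t + 1) <= 1 by have := m1_norm mu (t + 1); rewrite ler_norml => /andP[].
by rewrite (le_lt_trans l1 h2) (lt_le_trans h1 l2).
Qed.

Lemma psi_tangent t x : psi t + m1 t * (x - t) <= psi x.
Proof.
have [c cx e] := mean_value t x psi_derive.
rewrite -subr_ge0 (_ : psi x - _ = (m1 c - m1 t) * (x - t)); last first.
  by move: e; move: (psi x) (psi t) (m1 c) (m1 t) => p q a b e; rewrite mulrBl -e; ring.
move: cx; rewrite minEle maxEle; case: (leP t x) => tx /andP[c1 c2].
  by rewrite mulr_ge0// subr_ge0// m1_nondecreasing.
by rewrite mulr_le0// subr_le0; [exact: m1_nondecreasing | exact: ltW].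
Qed.

(** psi'' <= 1: the gap has derivative h + m1 t - m1 (t + h), which has the sign of h because [m1]
    is 1-Lipschitz. *)
Lemma psi_smooth t h : psi (t + h) <= psi t + m1 t * h + h ^+ 2 / 2.
Proof.
pose G y := y ^+ 2 / 2 + m1 t * y - psi (t + y).
have GD (y : R) : is_derive y (1:R) G (y + m1 t - m1 (t + y)).
  have h1 : is_derive y (1:R) (fun y => y * y) (1 * y + y * 1) by exact: is_derive_mul.
  have h2 : is_derive y (1:R) (fun y => y * y / 2) ((1 * y + y * 1) * 2^-1 + y * y * 0) by exact: is_derive_mul.
  have h3 : is_derive y (1:R) (fun y => m1 t * y) (0 * y + m1 t * 1) by exact: is_derive_mul.
  have h4 : is_derive y (1:R) (fun y => t + y) (0 + 1) by exact: is_derive_add.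
  have h5 := is_derive_comp (psi_derive (t + y)) h4.
  apply: is_derive_eq (is_derive_sub (is_derive_add h2 h3) h5) _.
  by move: (m1 t) (m1 (t + y)) => a b; field.
have [c ch e] := mean_value 0 h GD.
have G0 : G 0 = - psi t by rewrite /G addr0 mulr0 expr0n/= mul0r addr0 add0r.
rewrite -subr_ge0 (_ : _ - _ = G h - G 0); last first.
  by rewrite G0 /G; move: (psi (t + h)) (psi t) (m1 t) => p q a; ring.
rewrite e subr0.
have ml := m1_lipschitz mu t (t + c); rewrite addrAC subrr add0r ler_norml in ml.
have /andP[] := ml; move: (m1 (t + c)) (m1 t) => a b l1 l2.
clear e G0 GD G.
have [g1 g2] : (0 <= c -> 0 <= c + b - a) /\ (c <= 0 -> c + b - a <= 0).
  by split=> hc; [rewrite (ger0_norm hc) in l2 | rewrite (ler0_norm hc) in l1]; lra.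
move: ch; rewrite minEle maxEle; case: (leP 0 h) => h0 /andP[c1 c2].
  by apply: mulr_ge0 => //; exact: g1.
by apply: mulr_le0; [exact: g2 | exact: ltW].
Qed.

(** Mass p near the endpoint [sg] forces psi (sg b) >= b (1 - e) + ln p, while convexity gives psi
    (sg b) <= b sg m1 (sg b). For large b this slope exceeds 1 - 2 e; the intermediate value theorem
    concludes. *)
Lemma m1_surjective z : -1 < z < 1 -> exists t, m1 t = z.
Proof.
move=> /andP[z1 z2].
have psi0 : psi 0 = 0.
  rewrite -psi_lock psiE// /mgf /tilt_int (_ : \int[mu]_z _ = 1) ?ln1//.
  transitivity (\int[mu]_y (cst (1 : R) y)); last by case: (weight1 mu).
  by apply: eq_Rintegral => y _; rewrite mul0r expR0 mulr1.
have key (sg : R) : sg = 1 \/ sg = -1 -> forall y, y < 1 -> exists2 b, 0 <= b & y <= sg * m1 (sg * b).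
  move=> sgE y y1.
  pose e := (1 - y) / 2; have e0 : 0 < e by rewrite divr_gt0//; lra.
  pose p := fine (mu [set z | 1 - e < sg * z]).
  have p0 : 0 < p by exact: support_halfline_gt0.
  have lb b : 0 <= b -> b * (1 - e) + ln p <= psi (sg * b).
    move=> b0; rewrite -psi_lock psiE// -[b * (1 - e)]expRK -lnM ?posrE ?expR_gt0// ler_ln ?posrE ?mulr_gt0 ?expR_gt0 ?mgf_gt0//.
    apply: Rintegral_ge_indic => [||z0|z0 Uz].
    - by apply: BMM; [exact: BM_cst | exact: BM_expclip].
    - exact: measurable_halfline.
    - by rewrite mul1r expR_ge0.
    - rewrite mul1r ler_expR (_ : sg * b * clip z0 = b * (sg * clip z0)); last by ring.
      by apply: ler_wpM2l => //; apply: clip_halfline => //; exact: ltW.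
  (* Large enough that |ln p| <= b e. *)
  pose b := 1 + `|ln p| / e.
  have b1 : 1 <= b by rewrite lerDl divr_ge0// ltW.
  have b0 : 0 <= b by lra.
  exists b => //.
  have tg := psi_tangent (sg * b) 0; rewrite psi0 sub0r in tg.
  have lbb := lb b b0.
  have h : b * (1 - e) + ln p <= b * (sg * m1 (sg * b)).
    apply: le_trans lbb _; move: tg; move: (psi (sg * b)) (m1 (sg * b)) => q a tg.
    have -> : b * (sg * a) = - (a * - (sg * b)) by ring.
    clear lb; lra.
  have h2 : b * (1 - 2 * e) <= b * (1 - e) + ln p.
    have : `|ln p| <= b * e by rewrite /b mulrDl divfK ?gt_eqF//; lra.
    by have := ler_norm (- ln p); rewrite normrN; lra.
  have bp : 0 < b by lra.
  have := le_trans h2 h; rewrite ler_pM2l//.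
  by rewrite /e mulrC divfK//; lra.
have [b b0 hb] := key 1 (or_introl erefl) z z2.
have zN : - z < 1 by lra.
have [a a0 ha] := key (-1) (or_intror erefl) (- z) zN.
rewrite !mul1r in hb; rewrite !mulN1r lerN2 in ha.
have ab : - a <= b by lra.
have cw : {within `[- a, b], continuous m1} by apply: continuous_subspaceT; exact: continuous_m1.
have [|x _ xz] := IVT ab cw (v := z); last by exists x.
by rewrite ge_min ha le_max hb orbT.
Qed.

Lemma phi_m1 t : phi (m1 t) = t.
Proof.
rewrite -phi_lock /Defs.phi; case: xgetP => [x _ /=|h]; first by rewrite psi1E// => /m1_inj.
by have := h t; rewrite /= psi1E.
Qed.

Lemma m1_phi z : -1 < z < 1 -> m1 (phi z) = z.
Proof. by move=> /m1_surjective[t <-]; rewrite phi_m1. Qed.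

Lemma rate0_m1 t : rate0 (m1 t) = t * m1 t - psi t.
Proof. by rewrite rate0E phi_m1 mulrC. Qed.

(** The Fenchel-Young inequality, with equality at x = phi z. *)
Lemma rate0_ge z x : -1 < z < 1 -> x * z - psi x <= rate0 z.
Proof.
move=> hz; rewrite rate0E; have := psi_tangent (phi z) x; rewrite m1_phi//.
by move: (phi z) => p; lra.
Qed.

Lemma rate0_monotone (sg a b : R) : sg = 1 \/ sg = -1 -> -1 < a < 1 -> -1 < b < 1 ->
  0 <= sg * phi a -> sg * a <= sg * b -> rate0 a <= rate0 b.
Proof.
move=> sgE ha hb pa ab; apply: le_trans (rate0_ge (phi a) hb).
rewrite rate0E lerD2r -subr_ge0.
have -> : phi a * b - a * phi a = (sg * phi a) * (sg * b - sg * a).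
  by case: sgE => ->; ring.
by rewrite mulr_ge0// subr_ge0.
Qed.

Lemma phi_sign (sg z : R) : sg = 1 \/ sg = -1 -> -1 < z < 1 ->
  sg * m1 0 <= sg * z -> 0 <= sg * phi z.
Proof.
move=> sgE hz mz; rewrite leNgt; apply/negP => h.
have := m1_phi hz; move: h; case: sgE mz => ->; rewrite ?mul1r ?mulN1r ?lerN2 ?oppr_lt0.
  by move=> mz /m1_increasing + e; rewrite e ltNge mz.
by move=> mz /m1_increasing + e; rewrite e ltNge mz.
Qed.

(* Near the boundary point [sg], [rate0] is monotone, so the limit defining
   [rate] is a supremum. *)
Lemma rate_endpoint (sg : R) x : sg = 1 \/ sg = -1 -> ((x * sg - psi x)%:E <= rate mu sg)%E.
Proof.
move=> sgE.
have /andP[m0 m2] := m1_lt1 0.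
have sm : -1 < sg * m1 0 < 1 by case: sgE => ->; apply/andP; split; lra.
have /andP[sm1 sm2] := sm.
have L : forall w, sg * m1 0 < w < 1 -> ((rate0 (sg * w))%:E <= rate mu sg)%E.
  (* Reflection makes both boundary limits a right limit at -1 of a nonincreasing function. *)
  pose f w := (rate0 (- sg * w))%:E.
  have nif : {in `](-1)%R, (- (sg * m1 0))[ &, nonincreasing_fun f}.
    move=> a b; rewrite !in_itv/= => /andP[a1 a2] /andP[b1 b2] ab; rewrite lee_fin.
    have ha : -1 < - sg * a < 1 by case: sgE a1 a2 b1 b2 => -> *; apply/andP; split; lra.
    have hb : -1 < - sg * b < 1 by case: sgE a1 a2 b1 b2 => -> *; apply/andP; split; lra.
    have sq (y : R) : sg * (- sg * y) = - y by case: sgE => ->; ring.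
    apply: (@rate0_monotone sg) => //; last by rewrite !sq; lra.
    by apply: phi_sign => //; rewrite sq; lra.
  have cv : f w @[w --> (-1)^'+] --> ereal_sup (f @` `](-1)%R, (- (sg * m1 0))[ ).
    by apply: (nonincreasing_at_right_cvge _ _ nif); rewrite bnd_simp; lra.
  have re : rate mu sg = ereal_sup (f @` `](-1)%R, (- (sg * m1 0))[ ).
    rewrite /rate rate0_lock; case: sgE cv => sgE; rewrite /f sgE.
      rewrite eqxx => cv; apply/cvg_lim => //; apply/cvg_at_leftNP.
      by move: cv; under eq_fun do rewrite mulN1r.
    rewrite eqxx ifF; last by apply/negbTE; rewrite lt_eqF//; lra.
    by move=> cv; apply/cvg_lim => //; move: cv; under eq_fun do rewrite opprK mul1r.
  move=> w /andP[w1 w2]; rewrite re; apply: ereal_sup_ubound; exists (- w); last by rewrite /f mulrNN.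
  by rewrite /= in_itv/=; apply/andP; split; lra.
apply/lee_addgt0Pr => e e0.
pose d := Num.min (e / (`|x| + 1)) ((1 - sg * m1 0) / 2).
have x1 : 0 < `|x| + 1 by have := normr_ge0 x; lra.
have d0 : 0 < d by rewrite lt_min !divr_gt0//; lra.
have d1 : d <= e / (`|x| + 1) by rewrite ge_min lexx.
have d2 : d <= (1 - sg * m1 0) / 2 by rewrite ge_min lexx orbT.
have wI : sg * m1 0 < 1 - d < 1 by apply/andP; split; lra.
have wJ : -1 < sg * (1 - d) < 1.
  by case: sgE sm1 sm2 wI => -> ? ? /andP[? ?]; apply/andP; split; lra.
apply: le_trans (leeD2r _ (L _ wI)); rewrite -EFinD lee_fin.
apply: le_trans (lerD (rate0_ge x wJ) (lexx e)).
have xd : `|x| * d <= e.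
  apply: (le_trans (y := (`|x| + 1) * d)); first by rewrite ler_wpM2r ?ltW//; lra.
  by rewrite mulrC -ler_pdivlMr.
have := ler_norm (x * sg * d); rewrite normrM normrM (gtr0_norm d0).
have -> : `|sg| = 1 by case: sgE => ->; rewrite ?normrN normr1.
rewrite mulr1 mulrBr mulr1 mulrBr; lra.
Qed.

Lemma rate_ge z x : -1 <= z <= 1 -> ((x * z - psi x)%:E <= rate mu z)%E.
Proof.
move=> /andP[z1 z2].
have [->|n1] := eqVneq z 1; first by apply: rate_endpoint; left.
have [->|nN1] := eqVneq z (-1); first by apply: rate_endpoint; right.
rewrite /rate (negbTE n1) (negbTE nN1) rate0_lock lee_fin; apply: rate0_ge.
by rewrite !lt_neqAle n1 z2 z1 eq_sym nN1.
Qed.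

(** Smoothness of psi dualises to strong convexity of its conjugate: take x = t + (z - m1 t) in the
    Fenchel-Young inequality. *)
Lemma rate_strong_convexity t z : -1 <= z <= 1 ->
  ((t * m1 t - psi t + t * (z - m1 t) + (z - m1 t) ^+ 2 / 2)%:E <= rate mu z)%E.
Proof.
move=> hz; apply: le_trans (rate_ge (t + (z - m1 t)) hz); rewrite lee_fin.
have := psi_smooth t (z - m1 t).
move: (m1 t) => m; move: (psi (t + _)) (psi t) => p q h.
rewrite -subr_ge0 (_ : _ - _ = q + m * (z - m) + (z - m) ^+ 2 / 2 - p); last by field.
by rewrite subr_ge0.
Qed.

Lemma rate_m1 t : rate mu (m1 t) = (t * m1 t - psi t)%:E.
Proof.
have /andP[h1 h2] := m1_lt1 t.
by rewrite /rate lt_eqF// gt_eqF// rate0_lock rate0_m1.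
Qed.

Section optimizer.
Variables (n : nat) (A : 'M[R]_n) (rho : R).
Hypothesis hrho : 0 < rho < 1.
Hypothesis cA : coupling A.
Hypothesis oA : opnorm4 A <= rho.
Variable (c : n.-tuple RR) (u : 'I_n -> R).
Hypothesis uE : forall i, u i = m1 (mv A u i + tnth c i).

Lemma hamiltonianE (z : 'cV[R]_n) : hamiltonian A c z =
  (\sum_i z i 0 * mv A (fun j => z j 0) i) / 2 + \sum_i tnth c i * z i 0.
Proof.
rewrite /hamiltonian /dot; congr (_ / _ + _); apply: eq_bigr => i _.
  by rewrite mxE.
by rewrite mxE.
Qed.

Lemma mf_opt_fixed_point : mf_opt mu A c = \col_i u i.
Proof.
have /andP[p0 p1] := hrho.
pose t i := mv A u i + tnth c i.
have uc : cube (\col_i u i).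
  by move=> i; rewrite mxE uE; have /andP[? ?] := m1_lt1 (mv A u i + tnth c i); rewrite !ltW.
pose v := hamiltonian A c (\col_i u i) - \sum_i (t i * u i - psi (t i)).
have ou : mf_objective mu A c (\col_i u i) = v%:E.
  rewrite /mf_objective /v EFinB; congr (_ - _)%E; rewrite -sumEFin.
  by apply: eq_bigr => i _; rewrite mxE [in LHS]uE rate_m1 -/(t i) [in RHS]uE.
(* The fixed-point equation makes the first-order terms cancel. The rate has convexity constant 1
   and the quadratic form at most [rho], so the objective drops by (1 - rho) / 2 times the squared
   distance to u. *)
have key (z : 'cV[R]_n) : cube z ->
    (mf_objective mu A c z <= (v - (1 - rho) / 2 * \sum_i (z i 0 - u i) ^+ 2)%:E)%E.
  move=> zc; pose y i := z i 0 - u i.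
  pose S := \sum_i (t i * u i - psi (t i) + t i * y i + y i ^+ 2 / 2).
  apply: (@le_trans _ _ (hamiltonian A c z - S)%:E).
    rewrite /mf_objective EFinB; apply: leeB => //; rewrite /S -sumEFin.
    apply: lee_sum => i _; rewrite /y uE; exact: (rate_strong_convexity (t i) (zc i)).
  rewrite lee_fin /v /S !big_split/= -!mulr_suml.
  have ae : mv A (fun j => z j 0) = fun i => mv A u i + mv A y i.
    apply/funext => i; rewrite /mv -big_split/=; apply: eq_bigr => j _; rewrite /y; ring.
  have hz : hamiltonian A c z = hamiltonian A c (\col_i u i) + \sum_i t i * y i + (\sum_i y i * mv A y i) / 2.
    rewrite !hamiltonianE ae.
    have e1 : \sum_i z i 0 * (mv A u i + mv A y i) =
      \sum_i u i * mv A u i + \sum_i y i * mv A u i + \sum_i u i * mv A y i + \sum_i y i * mv A y i.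
      by rewrite -!big_split/=; apply: eq_bigr => i _; rewrite /y; ring.
    have e2 : \sum_i u i * mv A y i = \sum_i y i * mv A u i.
      by rewrite -(mv_sym cA); apply: eq_bigr => i _; rewrite mulrC.
    have e3 : \sum_i tnth c i * z i 0 = \sum_i tnth c i * u i + \sum_i tnth c i * y i.
      by rewrite -big_split/=; apply: eq_bigr => i _; rewrite /y; ring.
    have e4 : \sum_i t i * y i = \sum_i y i * mv A u i + \sum_i tnth c i * y i.
      by rewrite -big_split/=; apply: eq_bigr => i _; rewrite /t; ring.
    have e5 : mv A (fun j => (\col_i u i) j 0) = mv A u by congr mv; apply/funext => j; rewrite mxE.
    have e6 : \sum_i (\col_i u i) i 0 * mv A u i = \sum_i u i * mv A u i.
      by apply: eq_bigr => i _; rewrite mxE.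
    have e7 : \sum_i tnth c i * (\col_i u i) i 0 = \sum_i tnth c i * u i.
      by apply: eq_bigr => i _; rewrite mxE.
    by rewrite e1 e2 e3 e4 e5 e6 e7; field.
  have yA : \sum_i y i * mv A y i <= rho * \sum_i y i ^+ 2.
    have Y0 : 0 <= \sum_i y i ^+ 2 by apply: sumr_ge0 => i _; exact: sqr_ge0.
    have := @sum_mul_le R n y (mv A y) (Num.sqrt (\sum_i y i ^+ 2)) (rho * Num.sqrt (\sum_i y i ^+ 2)).
    rewrite exprMn !sqr_sqrtr// => /(_ (sqrtr_ge0 _) (mulr_ge0 (ltW p0) (sqrtr_ge0 _)) (lexx _) (mv_l2 hrho cA oA y)).
    rewrite mulrCA -expr2 sqr_sqrtr//; apply: le_trans; apply: ler_sum => i _.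
    by rewrite -normrM ler_norm.
  rewrite hz; move: yA; rewrite -[in X in _ -> X]/(y _).
  have -> : \sum_i (z i 0 - u i) ^+ 2 = \sum_i y i ^+ 2 by [].
  move: (\sum_i y i * mv A y i) (\sum_i y i ^+ 2) (\sum_i t i * y i) (hamiltonian _ _ _) (\sum_i t i * u i) => a b d e f h.
  by lra.
rewrite /mf_opt; case: xgetP => [z _ [zc zmax]|no].
  have := zmax _ uc; rewrite ou => h; have := le_trans h (key z zc); rewrite lee_fin => {}h.
  have S0 : \sum_i (z i 0 - u i) ^+ 2 <= 0.
    have : (1 - rho) / 2 * \sum_i (z i 0 - u i) ^+ 2 <= 0 by lra.
    by rewrite pmulr_rle0//; lra.
  apply/colP => i; rewrite mxE; apply/eqP; rewrite -subr_eq0 -sqrf_eq0 eq_le sqr_ge0 andbT.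
  apply: le_trans S0; exact: (sum_sqr_le_max (fun i => z i 0 - u i)).
exfalso; apply: (no (\col_i u i)); split; [exact: uc | move=> w wc; rewrite ou].
apply: (le_trans (key w wc)); rewrite lee_fin gerBl; apply: mulr_ge0.
  by rewrite divr_ge0 ?subr_ge0 ?ltW.
by apply: sumr_ge0 => i _; exact: sqr_ge0.
Qed.

End optimizer.

End base_measure.

(** * Fixed-point iteration and the conditional distribution function *)

Section fixed_point.
Context {R : realType}.
Local Notation RR := (measurableTypeR R).
Variables (mu : probability RR R) (n : nat) (A : 'M[R]_n) (rho : R).
Hypothesis hrho : 0 < rho < 1.
Hypothesis cA : coupling A.
Hypothesis oA : opnorm4 A <= rho.

(** Explicit Picard iterates exhibit the fixed point as a pointwise limit of measurable functions of
    the field. *)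
Fixpoint mf_iter k (c : n.-tuple RR) : 'I_n -> R :=
  if k is k'.+1 then fun i => m1 mu (mv A (mf_iter k' c) i + tnth c i) else fun=> 0.

Lemma mf_iter_step c k :
  \sum_i (mf_iter k.+1 c i - mf_iter k c i) ^+ 2 <= (rho ^+ k) ^+ 2 * n%:R.
Proof.
elim: k => [|k IH].
  rewrite expr0 expr1n mul1r -[n in leRHS]card_ord -sumr_const; apply: ler_sum => i _ /=.
  rewrite subr0 -real_normK ?num_real// -(expr1n _ 2) lerXn2r ?nnegrE//; exact: m1_norm.
apply: (le_trans (y := \sum_i mv A (fun j => mf_iter k.+1 c j - mf_iter k c j) i ^+ 2)).
  apply: ler_sum => i _; rewrite -ler_sqrt ?sqr_ge0// !sqrtr_sqr.
  apply: le_trans (m1_lipschitz _ _ _) _; rewrite le_eqVlt; apply/orP; left; apply/eqP.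
  congr (`|_|); rewrite /mv opprD addrACA subrr addr0 -sumrB; apply: eq_bigr => j _; by rewrite [RHS]mulrBr.
apply: (le_trans (mv_l2 hrho cA oA _)).
rewrite (_ : (rho ^+ k.+1) ^+ 2 * n%:R = rho ^+ 2 * ((rho ^+ k) ^+ 2 * n%:R)); last first.
  by rewrite (exprS rho) exprMn mulrA.
by apply: ler_wpM2l IH; exact: sqr_ge0.
Qed.

Lemma mf_iter_cvg c i : cvgn (fun k => mf_iter k c i).
Proof.
have /andP[r0 r1] := hrho.
(* [n] is used in place of its square root to avoid roots. *)
have st k : `|mf_iter k.+1 c i - mf_iter k c i| <= geometric (n%:R) rho k.
  rewrite /geometric/= -ler_sqr ?nnegrE ?mulr_ge0 ?exprn_ge0 ?(ltW r0)//.
  rewrite real_normK ?num_real//.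
  apply: (le_trans (sum_sqr_le_max (fun i => mf_iter k.+1 c i - mf_iter k c i) i)).
  apply: (le_trans (mf_iter_step c k)).
  rewrite exprMn mulrC ler_wpM2r ?sqr_ge0// expr2 -natrM ler_nat leq_pmulr//.
  by case: (n) i => // -[].
have cs : cvgn (series (telescope (fun k => mf_iter k c i))).
  apply: normed_cvg; apply: (series_le_cvg _ _ st).
  - by move=> k; exact: normr_ge0.
  - by move=> k; rewrite /geometric/= mulr_ge0 ?exprn_ge0 ?(ltW r0).
  - by apply: is_cvg_geometric_series; rewrite ger0_norm ?(ltW r0).
move: cs; rewrite telescopeK.
by under eq_fun do rewrite subr0.
Qed.

Definition mf_fixpoint c i : R := limn (fun k => mf_iter k c i).

Lemma mf_fixpointE c i : mf_fixpoint c i = m1 mu (mv A (mf_fixpoint c) i + tnth c i).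
Proof.
have h : (fun k => mf_iter k.+1 c i) @ \oo --> m1 mu (mv A (mf_fixpoint c) i + tnth c i).
  apply: continuous_cvg; first exact: continuous_m1.
  apply: cvgD; last exact: cvg_cst.
  apply: cvg_big => [|j _]; first exact: add_continuous.
   apply: cvgMr; exact: mf_iter_cvg.
have h2 : (fun k => mf_iter k.+1 c i) @ \oo --> mf_fixpoint c i.
  by rewrite (cvg_shiftS (fun k => mf_iter k c i)); exact: mf_iter_cvg.
exact: (cvg_unique _ h2 h).
Qed.

Lemma measurable_mf_iter k i : measurable_fun [set: n.-tuple RR] (fun c => mf_iter k c i).
Proof.
elim: k i => [|k IH] i /=; first exact: measurable_cst.
apply: (measurableT_comp (f := m1 mu)).
  by apply: continuous_measurable_fun; exact: continuous_m1.
apply: measurable_funD; last exact: measurable_tnth.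
apply: measurable_sum => j; apply: measurable_funM => //; exact: measurable_cst.
Qed.

Lemma BM_mf_fixpoint i : BM (fun c : n.-tuple RR => mf_fixpoint c i).
Proof.
split; last by exists 1 => c; rewrite mf_fixpointE; exact: m1_norm.
apply: (measurable_fun_cvg (fun k => measurable_mf_iter k i)) => c _.
exact: mf_iter_cvg.
Qed.

End fixed_point.

Section iid_marginal.
Context {R : realType}.
Local Notation RR := (measurableTypeR R).
Variables (P : probability RR R) (n : nat).

Lemma integral_iid_tnth (i : 'I_n) (h : RR -> \bar R) :
  measurable_fun setT h -> (forall z, 0 <= h z)%E ->
  (\int[iid P n]_s h (tnth s i) = \int[P]_z h z)%E.
Proof.
move=> mh h0.
rewrite (@integral_iid_resample _ _ _ i (fun s => h (tnth s i)))//; last first.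
  by apply: (measurableT_comp mh); exact: measurable_tnth.
under eq_integral do under eq_integral do rewrite tnth_upd eqxx.
rewrite integral_cst//.
exact: (etrans (congr1 _ (probability_setT (iid P n))) (mule1 _)).
Qed.

Lemma ae_iid_tnth (B : set RR) : measurable B -> P (~` B) = 0%E ->
  {ae iid P n, forall s, forall i, B (tnth s i)}.
Proof.
move=> mB PB; apply: filter_forall => i.
have mi : measurable [set s : n.-tuple RR | ~ B (tnth s i)].
  by have := measurable_tnth i measurableT (measurableC mB); rewrite setTI; exact.
exists [set s | ~ B (tnth s i)]; split => //.
transitivity (\int[iid P n]_s (\1_[set s | ~ B (tnth s i)] s)%:E)%E.
  by rewrite integral_indic ?setIT.
have := @integral_iid_tnth i (fun z => (\1_(~` B) z)%:E).
have -> : (\int[P]_z (\1_(~` B) z)%:E)%E = 0%E.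
  by rewrite integral_indic ?setIT//; exact: measurableC.
move=> <-//; apply/measurable_EFinP; apply: measurable_indic; exact: measurableC.
Qed.

End iid_marginal.

(** * The conditional distribution function of q'sigma *)

Section conditional_cdf.
Context {R : realType}.
Local Notation RR := (measurableTypeR R).
Variables (mu : probability RR R) (n : nat) (A : 'M[R]_n) (q : 'cV[R]_n).
Hypothesis bmu : base_measure mu.

Definition cond_cdf (c : n.-tuple RR) (x : R) : R :=
  Ex (iid mu n) (gw mu A (tnth c)) (fun s => ((\sum_i q i 0 * spin s i <= x)%R%:R : R)).

Let spinE : {ae iid mu n, forall s, forall i, spin s i = tnth s i}.
Proof.
have := @ae_iid_tnth R mu n `[-1, 1]%classic (measurable_itv _).
rewrite probability_setC; last exact: measurable_itv.
case: bmu => -> _ _ _; rewrite subee// => /(_ erefl).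
apply: filterS => s h i; rewrite /spin clip_id//.
by have := h i; rewrite /= in_itv.
Qed.

Let hamE (c s : n.-tuple RR) : (forall i, spin s i = tnth s i) ->
  hamiltonian A c (colv s) = ham A (tnth c) s.
Proof.
move=> e; rewrite hamiltonianE /ham.
have -> : (fun j => colv s j 0) = spin s by apply/funext => j; rewrite mxE e.
by congr (_ / _ + _); apply: eq_bigr => i _; rewrite mxE e.
Qed.

Let measurable_colv i : measurable_fun setT (fun s : n.-tuple RR => colv s i 0).
Proof. by under eq_fun do rewrite mxE; exact: measurable_tnth. Qed.

Let measurable_hamiltonian (c : n.-tuple RR) :
  measurable_fun setT (fun s : n.-tuple RR => hamiltonian A c (colv s)).
Proof.
under eq_fun do rewrite hamiltonianE.
apply: measurable_funD; last first.
  by apply: measurable_sum => i; apply: measurable_funM => //; exact: measurable_cst.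
apply: measurable_funM; last exact: measurable_cst.
apply: measurable_sum => i; apply: measurable_funM => //.
by apply: measurable_sum => j; apply: measurable_funM => //; exact: measurable_cst.
Qed.

Lemma partition_functionE c : partition_function mu A c = gibbs_norm mu A (tnth c).
Proof.
rewrite /partition_function /gibbs_norm /Rintegral; congr fine.
apply: ae_eq_integral => //.
- by apply/measurable_EFinP; apply: measurableT_comp => //; exact: measurable_hamiltonian.
- by apply/measurable_EFinP; case: (BM_expham A (tnth c)).
- by move: spinE; apply: filterS => s h _ /=; rewrite hamE.
Qed.

(** Given the field, each centring is a constant, hence a shift of the argument of [cond_cdf]; all
    three claims reduce to this one function. *)
Lemma cond_law_affine c (X : 'cV[R]_n -> R) b t : (forall z, X z = dot q z - b) ->
  cond_law mu A c X [set` `]-oo, t]] = (cond_cdf c (t + b))%:E.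
Proof.
move=> XE; rewrite /cond_law /gibbs partition_functionE.
pose f (s : n.-tuple RR) : R := (dot q (colv s) <= t + b)%R%:R.
have mdot : measurable_fun setT (fun s : n.-tuple RR => dot q (colv s)).
  by apply: measurable_sum => i; apply: measurable_funM => //; exact: measurable_cst.
have [mf _] := @BM_le _ _ R _ (t + b) mdot.
have mlin : measurable_fun setT (fun s : n.-tuple RR => \sum_i q i 0 * spin s i).
  by apply: measurable_sum => i; apply: measurable_funM; [exact: measurable_cst | case: (BM_spin (R := R) i)].
rewrite integral_mkcond.
transitivity (\int[iid mu n]_s (gw mu A (tnth c) s * (\sum_i q i 0 * spin s i <= t + b)%R%:R)%:E)%E; last first.
  rewrite /cond_cdf /Ex Rintegral_fineK//; apply: BMM; first exact: BM_gw.
  exact: BM_le mlin.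
have -> : ((fun s => (expR (hamiltonian A c (colv s)) / gibbs_norm mu A (tnth c))%:E) \_
   [set s | [set` `]-oo, t]] (X (colv s))]) =
   fun s => (expR (hamiltonian A c (colv s)) / gibbs_norm mu A (tnth c) * f s)%:E.
  apply/funext => s; rewrite patchE /f.
  have -> : (s \in [set s | [set` `]-oo, t]] (X (colv s))]) = (dot q (colv s) <= t + b).
    apply/idP/idP; first by rewrite inE /= in_itv/= XE lerBlDr.
    by move=> h; rewrite inE /= in_itv/= XE lerBlDr.
  by case: (_ <= _); rewrite ?mulr1 ?mulr0.
apply: ae_eq_integral => //.
- apply/measurable_EFinP; apply: measurable_funM => //; apply: measurable_funM; last exact: measurable_cst.
  by apply: measurableT_comp => //; exact: measurable_hamiltonian.
- apply/measurable_EFinP; apply: measurable_funM; first by case: (BM_gw mu A (tnth c)).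
  by case: (BM_le (t + b) mlin).
- move: spinE; apply: filterS => s h _ /=; rewrite hamE// /gw /f.
  congr (_ * _)%:E; congr ((_ <= _)%R%:R : R).
  by apply: eq_bigr => i _; rewrite mxE h.
Qed.

End conditional_cdf.

Section sup_distance.
Context {R : realType}.

Lemma dKS_le (P Q : set R -> \bar R) B :
  (forall t, `|fine (P [set` `]-oo, t]]) - fine (Q [set` `]-oo, t]])| <= B) ->
  dKS P Q <= B.
Proof.
move=> h; apply: ge_sup; last by move=> _ [t _ <-].
by exists (`|fine (P [set` `]-oo, 0]]) - fine (Q [set` `]-oo, 0]])|), 0.
Qed.

Definition sup_dist (G H : R -> R) : R := sup [set `|G t - H t| | t in [set: R]].

Lemma dKSE (P Q : set R -> \bar R) (G H : R -> R) :
  (forall t, P [set` `]-oo, t]] = (G t)%:E) -> (forall t, fine (Q [set` `]-oo, t]]) = H t) ->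
  dKS P Q = sup_dist G H.
Proof.
move=> PG QH; rewrite /dKS /sup_dist; congr (sup _).
by apply: eq_imagel => t _; rewrite PG QH.
Qed.

Lemma sup_dist_le (G H : R -> R) B : (forall t, `|G t - H t| <= B) -> sup_dist G H <= B.
Proof.
move=> h; apply: ge_sup; last by move=> _ [t _ <-].
by exists (`|G 0 - H 0|), 0.
Qed.

Lemma sup_dist_ge (G H : R -> R) B t : (forall t, `|G t - H t| <= B) ->
  `|G t - H t| <= sup_dist G H.
Proof.
move=> h; apply: ub_le_sup; last by exists t.
by exists B => _ [x _ <-].
Qed.

Lemma sup_dist_ge0 (G H : R -> R) B : (forall t, `|G t - H t| <= B) -> 0 <= sup_dist G H.
Proof. by move=> h; apply: le_trans (sup_dist_ge 0 h). Qed.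

(* By monotonicity of [G c] and continuity of [H], the supremum may be taken
   over the rationals. *)
Lemma measurable_sup_dist d (T : measurableType d) (G : T -> R -> R) (H : R -> R) :
  (forall t, measurable_fun setT (G^~ t)) ->
  (forall c a b, a <= b -> G c a <= G c b) ->
  (forall c t, `|G c t - H t| <= 1) -> continuous H ->
  measurable_fun setT (fun c => sup_dist (G c) H).
Proof.
move=> mG Gmono GH1 cH; apply: (measurability _ (RGenOInfty.measurableE R)).
move=> _ [_ [a ->] <-]; rewrite setTI.
rewrite (_ : _ @^-1` _ = \bigcup_(r : rat) [set c | a < `|G c (ratr r) - H (ratr r)|]).
  apply: bigcupT_measurable_rat => r.
  have := @measurable_fun_ltr _ _ _ setT (cst a) (fun c => `|G c (ratr r) - H (ratr r)|)
    (measurable_cst _) _ measurableT [set true].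
  rewrite setTI preimage_true; apply => //.
  by apply: measurableT_comp => //; apply: measurable_funB => //; exact: measurable_cst.
apply/seteqP; split => [c|c [r _] /=]; rewrite /= in_itv/= andbT; last first.
  by move=> h; apply: (lt_le_trans h); exact: sup_dist_ge (GH1 c).
move=> h; have [|_ [t _ <-] at_] := sup_gt _ h.
  by exists (`|G c 0 - H 0|), 0.
pose e := `|G c t - H t| - a.
have e0 : 0 < e by rewrite subr_gt0.
have /cvgrPdist_lt /(_ e e0) [r /= r0 hr] := cH t.
have close x : `|t - x| < r -> `|H t - H x| < e by move=> ?; exact: hr.
(* If G exceeds H at t, a rational slightly to the right keeps the excess, as G cannot decrease and
   H barely moves; otherwise use one to the left. *)
have [GH|GH] := leP (H t) (G c t).
  have /rat_in_itvoo [p] : t < t + r by rewrite ltrDl.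
  rewrite in_itv/= => /andP[p1 p2].
  exists p => //=; apply: lt_le_trans (ler_norm _).
  have := Gmono c _ _ (ltW p1); have := close (ratr p).
  rewrite ltr0_norm ?subr_lt0// opprB ltrBlDl => /(_ p2); rewrite ltr_norml /e ger0_norm ?subr_ge0//.
  by move=> /andP[? ?] ?; lra.
have /rat_in_itvoo [p] : t - r < t by rewrite ltrBlDr ltrDl.
rewrite in_itv/= => /andP[p1 p2].
exists p => //=; rewrite distrC; apply: lt_le_trans (ler_norm _).
have := Gmono c _ _ (ltW p2); have := close (ratr p).
rewrite gtr0_norm ?subr_gt0// ltrBlDl -ltrBlDr => /(_ p1); rewrite ltr_norml /e ltr0_norm ?subr_lt0//.
by move=> /andP[? ?] ?; lra.
Qed.

End sup_distance.

Section joint_measurability.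
Context {R : realType}.
Local Notation RR := (measurableTypeR R).
Variables (mu : probability RR R) (n : nat) (A : 'M[R]_n) (q : 'cV[R]_n).

Let S (c : n.-tuple RR) := \sum_i `|tnth c i|.
Let lin (s : n.-tuple RR) : R := \sum_i q i 0 * spin s i.

(** The field is unbounded, so the Gibbs factor is not a bounded function of (c, s). Damping by exp
    (- sum |c_i|) bounds it and cancels between numerator and denominator. *)
Let BM_kernel : BM (fun p : n.-tuple RR * n.-tuple RR => expR (ham A (tnth p.1) p.2 - S p.1)).
Proof.
have mspin i : measurable_fun setT (fun p : n.-tuple RR * n.-tuple RR => spin p.2 i).
  by apply: (measurableT_comp (f := fun s : n.-tuple RR => spin s i)) => //; case: (BM_spin (R := R) i).
have mc i : measurable_fun setT (fun p : n.-tuple RR * n.-tuple RR => tnth p.1 i : R).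
  by apply: (measurableT_comp (measurable_tnth i)) => //.
split.
  apply: measurableT_comp => //; apply: measurable_funB; last first.
    by apply: measurable_sum => i; apply: measurableT_comp => //; exact: mc.
  apply: measurable_funD; last by apply: measurable_sum => i; exact: measurable_funM.
  apply: measurable_funM; last exact: measurable_cst.
  apply: measurable_sum => i; apply: measurable_funM => //.
  by apply: measurable_sum => j; apply: measurable_funM => //; exact: measurable_cst.
have [_ [K hK]] := BM_ham A (fun=> 0 : R).
exists (expR K) => -[c s]; rewrite ger0_norm ?expR_ge0// ler_expR /=.
have := hK s; rewrite ler_norml /ham => /andP[_].
rewrite [X in _ + X <= _ -> _]big1; last by move=> i _; rewrite mul0r.
rewrite addr0 => h; rewrite lerBlDr; apply: lerD => //; apply: ler_sum => i _.
by apply: le_trans (ler_norm _) _; rewrite normrM ler_piMr//; exact: spin_norm.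
Qed.

Let den c := \int[iid mu n]_s expR (ham A (tnth c) s - S c).

Let den_gt0 c : 0 < den c.
Proof.
rewrite /den; under eq_Rintegral do rewrite expRD.
rewrite RintegralZr//; last exact: BM_integrable (BM_expham A (tnth c)).
by rewrite mulr_gt0 ?expR_gt0//; exact: gibbs_norm_gt0.
Qed.

Let Bind x : BM (fun s : n.-tuple RR => ((lin s <= x)%R%:R : R)).
Proof.
apply: BM_le; apply: measurable_sum => i; apply: measurable_funM; first exact: measurable_cst.
by case: (BM_spin (R := R) i).
Qed.

Lemma cond_cdf_mono c a b : a <= b -> cond_cdf mu A q c a <= cond_cdf mu A q c b.
Proof.
move=> ab; apply: (Ex_le (weight_gw mu A (tnth c))) => // s.
case: (leP (lin s) a) => [h|_]; last by rewrite ler0n.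
by rewrite (le_trans h ab).
Qed.

Lemma cond_cdf_ge0 c a : 0 <= cond_cdf mu A q c a.
Proof. by apply: (Ex_ge0 (weight_gw mu A (tnth c))) => // s; exact: ler0n. Qed.

Lemma cond_cdf_le1 c a : cond_cdf mu A q c a <= 1.
Proof.
apply: (Ex_le_cst (weight_gw mu A (tnth c))) => [|s]; first exact: Bind.
by case: (lin s <= a).
Qed.

Lemma BM_cond_cdf (tau : n.-tuple RR -> R) : measurable_fun setT tau ->
  BM (fun c => cond_cdf mu A q c (tau c)).
Proof.
move=> mtau.
have Bj : BM (fun p : n.-tuple RR * n.-tuple RR => ((lin p.2 - tau p.1 <= 0)%R%:R : R)).
  apply: BM_le; apply: measurable_funB; last exact: measurableT_comp.
  apply: measurable_sum => i; apply: measurable_funM; first exact: measurable_cst.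
  by apply: (measurableT_comp (f := fun s : n.-tuple RR => spin s i)) => //; case: (BM_spin (R := R) i).
have E c : cond_cdf mu A q c (tau c) =
    (\int[iid mu n]_s (expR (ham A (tnth c) s - S c) * (lin s - tau c <= 0)%R%:R)) * expR (- ln (den c)).
  rewrite expRN lnK ?posrE// /cond_cdf /Ex.
  have -> : den c = gibbs_norm mu A (tnth c) * expR (- S c).
    rewrite /den; under eq_Rintegral do rewrite expRD.
    by rewrite RintegralZr//; exact: BM_integrable (BM_expham A (tnth c)).
  rewrite -RintegralZr//; last first.
    by apply: BM_integrable; apply: BMM; [exact: (BM_curry c BM_kernel) | exact: (BM_curry c Bj)].
  apply: eq_Rintegral => s _; rewrite /gw subr_le0 expRD invfM -/(lin s).
  have := gt_eqF (gibbs_norm_gt0 mu A (tnth c)); have := gt_eqF (expR_gt0 (- S c)).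
  move: (expR _) (expR _) (gibbs_norm _ _ _) ((lin s <= _)%R%:R) => x y z w /eqP/eqP x0 /eqP/eqP z0.
  by field; rewrite x0 z0.
have -> : (fun c => cond_cdf mu A q c (tau c)) = fun c =>
    (\int[iid mu n]_s (expR (ham A (tnth c) s - S c) * (lin s - tau c <= 0)%R%:R)) * expR (- ln (den c)).
  by apply/funext.
split.
  apply: measurable_funM.
    by case: (@BM_Rintegral _ _ _ _ R (iid mu n) (iid mu n) _ (BMM BM_kernel Bj)).
  apply: measurableT_comp => //; apply: measurableT_comp => //; apply: measurableT_comp.
    exact: measurable_ln.
  by case: (@BM_Rintegral _ _ _ _ R (iid mu n) (iid mu n) _ BM_kernel).
exists 1 => c; rewrite -E ger0_norm ?cond_cdf_le1 ?cond_cdf_ge0//.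
Qed.

End joint_measurability.

(** * Moments of the random field *)

Lemma Ex_weight1 d (T : measurableType d) (R : realType) (P : probability T R) (f : T -> R) :
  Ex P (fun=> 1) f = \int[P]_x f x.
Proof. by apply: eq_Rintegral => x _; rewrite mul1r. Qed.

Section iid_moments.
Context {R : realType}.
Local Notation RR := (measurableTypeR R).
Variables (F : probability RR R) (n : nat) (g : RR -> R).
Hypothesis Bg : BM g.
Hypothesis g1 : forall z, `|g z| <= 1.
Hypothesis g0 : \int[F]_z g z = 0.
Local Notation cfg := (n.-tuple RR).
Local Notation EF := (Ex (iid F n) (fun=> 1)).

Lemma BM_iid_tnth (h : RR -> R) (i : 'I_n) : BM h -> BM (fun c : cfg => h (tnth c i)).
Proof.
move=> [mh [M hM]]; split; last by exists M => c; exact: hM.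
exact: (measurableT_comp mh (measurable_tnth i)).
Qed.

Lemma E_iid_mean0 i (h : cfg -> R) : BM h -> (forall c z, h (upd c i z) = h c) ->
  EF (fun c => g (tnth c i) * h c) = 0.
Proof.
move=> Bh hE; rewrite /Ex; under eq_Rintegral do rewrite mul1r.
apply: (etrans (Rintegral_resample F i (BMM (BM_iid_tnth i Bg) Bh))).
transitivity (\int[iid F n]_c (0 : R)); last by rewrite Rintegral_cst// mul0r.
apply: eq_Rintegral => c _; transitivity (\int[F]_z (g z * h c)).
  by apply: eq_Rintegral => z _; rewrite tnth_upd eqxx hE.
by rewrite RintegralZr ?g0 ?mul0r//; exact: BM_integrable.
Qed.

Variable a : 'I_n -> R.
Let N := \sum_j a j ^+ 2.
Definition iid_lin (c : cfg) : R := \sum_j a j * g (tnth c j).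

Let B2 j : BM (fun c : cfg => g (tnth c j)). Proof. exact: BM_iid_tnth. Qed.

(** The surrogate required by [moment2] and [moment4]: for independent coordinates, dropping the
    j-th summand makes the form independent of c_j. *)
Let rest j (c : cfg) := \sum_(k | k != j) a k * g (tnth c k).

Let Brest j : BM (rest j).
Proof. by apply: BM_sum => k; apply: BMM; [exact: BM_cst | exact: B2]. Qed.

Let rest_upd j c z : rest j (upd c j z) = rest j c.
Proof. by apply: eq_bigr => k kj; rewrite tnth_upd (negbTE kj). Qed.

Let dev c : \sum_j (\sum_k a k * g (tnth c k) - rest j c) ^+ 2 <= 1 ^+ 2 * \sum_j a j ^+ 2.
Proof.
rewrite expr1n mul1r; apply: ler_sum => j _; rewrite (bigD1 j)//= addrK exprMn.
by rewrite -[leRHS]mulr1 ler_wpM2l ?sqr_ge0// -real_normK ?num_real// expr_le1.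
Qed.

Let g2 j (c : cfg) : `|g (tnth c j)| <= 2.
Proof. by apply: le_trans (g1 _) _; rewrite ler1n. Qed.

Let orth1 j : EF (fun c => g (tnth c j) * rest j c) = 0.
Proof. by apply: E_iid_mean0 => // c z; rewrite rest_upd. Qed.

Let orth3 j : EF (fun c => g (tnth c j) * rest j c ^+ 3) = 0.
Proof. by apply: E_iid_mean0 => [|c z]; [exact: BMX | rewrite rest_upd]. Qed.

Lemma E_iid_lin2 : EF (fun c => iid_lin c ^+ 2) <= 2 * N.
Proof.
rewrite -[X in X * _](mulr1 2).
exact: (moment2 (weight1 (iid F n)) B2 Brest g2 ler01 dev orth1).
Qed.

Lemma E_iid_lin4 : EF (fun c => iid_lin c ^+ 4) <= 26 * N ^+ 2.
Proof.
have -> : 26 = 20 * 1 ^+ 2 + 6 * 1 ^+ 3 :> R by rewrite !expr1n; lra.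
exact: (moment4 (weight1 (iid F n)) B2 Brest g2 ler01 dev orth1 orth3).
Qed.

End iid_moments.

(** * The mean-field solution under a random field *)

Section random_field.
Context {R : realType}.
Local Notation RR := (measurableTypeR R).
Variables (mu F : probability RR R) (n : nat) (A : 'M[R]_n) (rho : R).
Hypothesis hrho : 0 < rho < 1.
Hypothesis cA : coupling A.
Hypothesis oA : opnorm4 A <= rho.
Variables (q : 'cV[R]_n) (lambda ups : R).
Hypothesis hl : `|lambda| <= rho.
Hypothesis hups : 0 < ups <= 1.
Hypothesis hq : \sum_i q i 0 ^+ 2 = 1.
Hypothesis m0 : \int[F]_z m1 mu z = 0.
Hypothesis hv : \int[F]_z tvar mu z = ups.
Local Notation cfg := (n.-tuple RR).
Local Notation EF := (Ex (iid F n) (fun=> 1)).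
Local Notation W := (weight1 (iid F n)).
Local Notation m1 := (m1 mu).
Local Notation tvar := (tvar mu).
Local Notation mv := (mv A).

Definition cvar (z : RR) : R := tvar z - ups.
Definition field_mean (c : cfg) i : R := m1 (tnth c i).
Definition mf_field (c : cfg) : 'I_n -> R := mv (mf_fixpoint mu A c).
(* [noise] controls the part of the Stein bound that depends on the field; its
   expectation is [O(err ^+ 2)]. *)
Definition noise2 (c : cfg) : R := \sum_j mv (fun i => q i 0 * cvar (tnth c i)) j ^+ 2.
Definition diag_noise (c : cfg) : R := \sum_i q i 0 ^+ 2 * cvar (tnth c i).
Definition mean4 (c : cfg) : R := \sum_i mv (field_mean c) i ^+ 4.
Definition noise (c : cfg) : R := noise2 c + diag_noise c ^+ 2 + mean4 c.

Let BM_m1 : BM (m1 : RR -> R).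
Proof.
split; last by exists 1; exact: m1_norm.
exact: (continuous_measurable_fun (@continuous_m1 R mu)).
Qed.

Let BM_cvar : BM cvar.
Proof.
apply: BMB; last exact: BM_cst.
split; last by exists 1; exact: tvar_norm.
exact: (continuous_measurable_fun (@continuous_tvar R mu)).
Qed.

Lemma cvar_norm z : `|cvar z| <= 1.
Proof.
have := tvar_le1 mu z; have := tvar_ge0 mu z; have /andP[u0 u1] := hups.
by rewrite /cvar ler_norml => h1 h2; apply/andP; split; lra.
Qed.

Lemma cvar_mean0 : \int[F]_z cvar z = 0.
Proof.
have BT : BM (fun z : RR => tvar z).
  split; last by exists 1; exact: tvar_norm.
  exact: (continuous_measurable_fun (@continuous_tvar R mu)).
have := ExB (weight1 F) BT (BM_cst _ ups); by rewrite (Ex_cst (weight1 F)) !Ex_weight1 hv subrr.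
Qed.

Lemma mf_fieldE c i : mf_fixpoint mu A c i = m1 (mf_field c i + tnth c i).
Proof. exact: mf_fixpointE hrho cA oA c i. Qed.

Lemma fixpoint_diff c i : `|mf_fixpoint mu A c i - field_mean c i| <= `|mf_field c i|.
Proof. by rewrite mf_fieldE; apply: le_trans (m1_lipschitz _ _ _) _; rewrite addrK. Qed.

Let field_split c i : mf_field c i =
  mv (field_mean c) i + mv (fun j => mf_fixpoint mu A c j - field_mean c j) i.
Proof. by rewrite /mv -big_split/=; apply: eq_bigr => j _; rewrite -mulrDr addrC subrK. Qed.

(** A u = A psi'(c) + A (u - psi'(c)), and the last difference is dominated by |A u|; the l4
    contraction leaves a linear image of the i.i.d. vector psi'(c). *)
Lemma mf_field4 c : (1 - rho) ^+ 4 * \sum_i mf_field c i ^+ 4 <= mean4 c.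
Proof.
apply: (sum_contraction4 hrho (field_split c)).
apply: le_trans (mv_l4 hrho oA _) _; rewrite ler_wpM2l ?expr4_ge0//.
apply: ler_sum => i _; rewrite (_ : 4 = 2 * 2)%N// 2!exprM lerXn2r ?nnegrE ?sqr_ge0//.
by rewrite -ler_sqrt ?sqr_ge0// !sqrtr_sqr fixpoint_diff.
Qed.

Lemma mf_field2 c : (1 - rho) ^+ 2 * \sum_i mf_field c i ^+ 2 <= \sum_i mv (field_mean c) i ^+ 2.
Proof.
apply: (sum_contraction2 hrho (field_split c)).
apply: le_trans (mv_l2 hrho cA oA _) _; rewrite ler_wpM2l ?sqr_ge0//.
apply: ler_sum => i _; rewrite -ler_sqrt ?sqr_ge0// !sqrtr_sqr; exact: fixpoint_diff.
Qed.

Lemma BM_mf_field i : BM (fun c => mf_field c i).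
Proof. by apply: BM_sum => j; apply: BMM; [exact: BM_cst | exact: BM_mf_fixpoint hrho cA oA _]. Qed.

Let noise2E j c : mv (fun i => q i 0 * cvar (tnth c i)) j = iid_lin cvar (fun i => A j i * q i 0) c.
Proof. by apply: eq_bigr => i _; rewrite mulrA. Qed.

Let BM_cvar_tnth i : BM (fun c : cfg => cvar (tnth c i)).
Proof. exact: BM_iid_tnth BM_cvar. Qed.

Let BM_mean i : BM (fun c : cfg => field_mean c i).
Proof. exact: BM_iid_tnth BM_m1. Qed.

Lemma BM_mv_noise j : BM (fun c : cfg => mv (fun i => q i 0 * cvar (tnth c i)) j).
Proof. by apply: BM_sum => i; apply: BMM; [exact: BM_cst | apply: BMM; [exact: BM_cst |]]. Qed.

Lemma BM_mv_mean j : BM (fun c : cfg => mv (field_mean c) j).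
Proof. by apply: BM_sum => i; apply: BMM; [exact: BM_cst | ]. Qed.

Lemma BM_noise2 : BM noise2.
Proof. by apply: BM_sum => j; apply: BMX; exact: BM_mv_noise. Qed.

Lemma BM_diag_noise : BM diag_noise.
Proof. by apply: BM_sum => j; apply: BMM; [exact: BM_cst|]. Qed.

Lemma BM_mean4 : BM mean4.
Proof. by apply: BM_sum => j; apply: BMX; exact: BM_mv_mean. Qed.

Lemma BM_noise : BM noise.
Proof.
by apply: BMD; [apply: BMD; [exact: BM_noise2 | exact: BMX BM_diag_noise] | exact: BM_mean4].
Qed.

Lemma E_noise2 : EF noise2 <= 2 * alpha A.
Proof.
rewrite /noise2 (Ex_sum W); last by move=> j; apply: BMX; exact: BM_mv_noise.
apply: (le_trans (y := \sum_j 2 * \sum_i (A j i * q i 0) ^+ 2)).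
  apply: ler_sum => j _; rewrite (eq_Ex _ _ (fun c => congr1 (fun x => x ^+ 2) (noise2E j c))).
  exact: E_iid_lin2 BM_cvar cvar_norm cvar_mean0 _.
rewrite -mulr_sumr ler_wpM2l// exchange_big/=.
rewrite -[leRHS]mulr1 -hq mulr_sumr; apply: ler_sum => i _.
rewrite (eq_bigr (fun j => A i j ^+ 2 * q i 0 ^+ 2)); last first.
  by move=> j _; rewrite exprMn (coupling_sym cA j i).
by rewrite -mulr_suml ler_wpM2r ?sqr_ge0//; exact: alpha_row.
Qed.

Lemma E_diag_noise (r : R) : (forall i, `|q i 0| <= r) -> EF (fun c => diag_noise c ^+ 2) <= 2 * r ^+ 2.
Proof.
move=> hr; apply: (le_trans (E_iid_lin2 BM_cvar cvar_norm cvar_mean0 (fun i => q i 0 ^+ 2))).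
rewrite ler_wpM2l// -[leRHS]mulr1 -hq mulr_sumr; apply: ler_sum => i _.
rewrite expr2 ler_wpM2r ?sqr_ge0// -real_normK ?num_real// lerXn2r ?nnegrE//.
exact: le_trans (hr i).
Qed.

Lemma E_mean4 : EF mean4 <= 26 * (n%:R * alpha A ^+ 2).
Proof.
rewrite /mean4 (Ex_sum W); last by move=> j; apply: BMX; exact: BM_mv_mean.
apply: (le_trans (y := \sum_(i < n) 26 * alpha A ^+ 2)); last first.
  by rewrite sumr_const card_ord -[X in X <= _]mulr_natl mulrCA.
apply: ler_sum => j _.
apply: (le_trans (E_iid_lin4 BM_m1 (m1_norm mu) m0 (A j))).
rewrite ler_wpM2l// lerXn2r ?nnegrE ?alpha_ge0 ?alpha_row//.
by apply: sumr_ge0 => i _; exact: sqr_ge0.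
Qed.

Lemma E_field2 : (1 - rho) ^+ 2 * EF (fun c => \sum_i mf_field c i ^+ 2) <= 2 * (n%:R * alpha A).
Proof.
rewrite -(ExZ W); last by apply: BM_sum => i; apply: BMX; exact: BM_mf_field.
apply: (le_trans (y := EF (fun c => \sum_i mv (field_mean c) i ^+ 2))).
  apply: (Ex_le W) => [||c]; last exact: mf_field2.
  - by apply: BMM; [exact: BM_cst | apply: BM_sum => i; apply: BMX; exact: BM_mf_field].
  - by apply: BM_sum => i; apply: BMX; exact: BM_mv_mean.
rewrite (Ex_sum W); last by move=> j; apply: BMX; exact: BM_mv_mean.
apply: (le_trans (y := \sum_(i < n) 2 * alpha A)); last first.
  by rewrite sumr_const card_ord -[X in X <= _]mulr_natl mulrCA.
apply: ler_sum => j _.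
apply: (le_trans (E_iid_lin2 BM_m1 (m1_norm mu) m0 (A j))).
by rewrite ler_wpM2l// alpha_row.
Qed.

Let sd := Num.sqrt (ups / (1 - lambda * ups)).
Let kap := (1 - rho)^-1.

Lemma noise_ge0 c : 0 <= noise c.
Proof.
rewrite !addr_ge0 ?sqr_ge0//; apply: sumr_ge0 => i _; [exact: sqr_ge0|exact: expr4_ge0].
Qed.

Let rho01 : 0 < rho /\ rho < 1. Proof. by apply/andP. Qed.

Lemma theta_ge : 1 - rho <= 1 - lambda * ups.
Proof.
have /andP[u0 u1] := hups; have := hl; rewrite ler_norml => /andP[_ l1].
rewrite lerD2l lerN2; apply: (le_trans (y := rho * ups)); first by rewrite ler_wpM2r// ltW.
by case: rho01 => p0 p1; rewrite -[leRHS]mulr1 ler_wpM2l// ltW.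
Qed.

Lemma theta_gt0 : 0 < 1 - lambda * ups.
Proof. by apply: lt_le_trans theta_ge; case: rho01; rewrite subr_gt0. Qed.

Lemma sd_gt0 : 0 < sd.
Proof. by rewrite sqrtr_gt0 divr_gt0 ?theta_gt0//; case/andP: hups. Qed.

Lemma stein_const_ge0 : 0 <= stein_const kap ups.
Proof.
have /andP[u0 u1] := hups.
have k0 : 0 <= kap by rewrite invr_ge0 subr_ge0; case: rho01 => _ /ltW.
have j0 : 0 <= 1 + 2 / ups by rewrite addr_ge0// divr_ge0// ltW.
have K0 : 0 <= stein_K0 kap by rewrite /stein_K0 !mulr_ge0// expr4_ge0.
have C0 : 0 <= stein_C1 kap by rewrite /stein_C1 !mulr_ge0 ?sqr_ge0// addr_ge0.
have s0 : 0 <= @steinK R by apply: le_trans (@steinK_ge1 R).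
rewrite /stein_const; move: (stein_K0 _) (stein_C1 _) K0 C0 => a b a0 b0.
have ui : 0 <= ups^-1 by rewrite invr_ge0 ltW.
move: (1 + 2 / ups) j0 (@steinK R) s0 => j j0 s s0.
move: (ler0n R 2052) (ler0n R 531); move: (2052 : R) (531 : R) => x y x0 y0.
apply: mulr_ge0 => //; apply: addr_ge0; first apply: addr_ge0.
- apply: mulr_ge0; first exact: mulr_ge0.
  by apply: addr_ge0 => //; apply: mulr_ge0 => //; apply: mulr_ge0 => //; apply: addr_ge0.
- by apply: addr_ge0; [exact: addr_ge0 | exact: mulr_ge0].
- apply: mulr_ge0 => //; apply: mulr_ge0 => //.
  by apply: addr_ge0; apply: mulr_ge0 => //; apply: addr_ge0.
Qed.

(** Split psi'' at the mean field into its value at c_i, which is i.i.d. after centring, and a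
    difference at most 4 |w_i|. The latter produces sum q_i^2 w_i^2 <= (sum q_i^4 + sum w_i^4) /
    2. *)
Lemma field_noise c r : (forall i, `|q i 0| <= r) ->
  \sum_j mv (fun i => q i 0 * (tvar (mv (mf_fixpoint mu A c) i + tnth c i) - ups)) j ^+ 2 +
  (\sum_i q i 0 ^+ 2 * (tvar (mv (mf_fixpoint mu A c) i + tnth c i) - ups)) ^+ 2 <=
  32 * kap ^+ 4 * noise c + 32 * r ^+ 2.
Proof.
move=> hqr; rewrite -/(mf_field c).
pose dv i := tvar (mf_field c i + tnth c i) - tvar (tnth c i).
have dvE i : tvar (mf_field c i + tnth c i) - ups = cvar (tnth c i) + dv i.
  by rewrite /cvar /dv [RHS]addrC addrA subrK.
have dv2 i : dv i ^+ 2 <= 16 * mf_field c i ^+ 2.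
  have := tvar_lipschitz mu (tnth c i) (mf_field c i + tnth c i); rewrite addrK => h.
  rewrite -[leLHS]real_normK ?num_real// -[X in _ * X]real_normK ?num_real//.
  by rewrite (_ : 16 = 4 ^+ 2) -?exprMn ?lerXn2r ?nnegrE ?mulr_ge0//; ring.
have sq (a b : R) : (a + b) ^+ 2 <= 2 * a ^+ 2 + 2 * b ^+ 2.
  by have := sqr_ge0 (a - b); rewrite (_ : (a - b) ^+ 2 = 2 * a ^+ 2 + 2 * b ^+ 2 - (a + b) ^+ 2) ?subr_ge0//; ring.
pose X := \sum_i q i 0 ^+ 2 * mf_field c i ^+ 2.
have X0 : 0 <= X by apply: sumr_ge0 => i _; rewrite mulr_ge0 ?sqr_ge0.
have S1 : \sum_i (q i 0 * dv i) ^+ 2 <= 16 * X.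
  rewrite mulr_sumr; apply: ler_sum => i _.
  by rewrite exprMn (mulrCA 16); apply: ler_wpM2l; [exact: sqr_ge0 | exact: dv2].
have h1 : \sum_j mv (fun i => q i 0 * (tvar (mf_field c i + tnth c i) - ups)) j ^+ 2 <=
    2 * noise2 c + 32 * X.
  apply: (le_trans (y := \sum_j (2 * mv (fun i => q i 0 * cvar (tnth c i)) j ^+ 2 + 2 * mv (fun i => q i 0 * dv i) j ^+ 2))).
    apply: ler_sum => j _; apply: le_trans (sq _ _); rewrite le_eqVlt; apply/orP; left; apply/eqP.
    by congr (_ ^+ 2); rewrite -big_split/=; apply: eq_bigr => i _; rewrite dvE -!mulrDr.
  rewrite big_split/= -!mulr_sumr lerD2l (_ : 32 * X = 2 * (16 * X)); last by ring.
  rewrite ler_wpM2l//; apply: le_trans S1.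
  apply: (le_trans (mv_l2 hrho cA oA _)); rewrite -[leRHS]mul1r ler_wpM2r//.
    by apply: sumr_ge0 => i _; exact: sqr_ge0.
  by case: rho01 => p0 p1; rewrite expr_le1// ltW.
have h2 : (\sum_i q i 0 ^+ 2 * (tvar (mf_field c i + tnth c i) - ups)) ^+ 2 <=
    2 * diag_noise c ^+ 2 + 32 * X.
  rewrite (_ : \sum_i _ = diag_noise c + \sum_i q i 0 * (q i 0 * dv i)); last first.
    by rewrite -big_split/=; apply: eq_bigr => i _; rewrite dvE mulrDr mulrA -expr2.
  apply: (le_trans (sq _ _)); rewrite lerD2l (_ : 32 * X = 2 * (16 * X)); last by ring.
  rewrite ler_wpM2l//; apply: le_trans S1.
  by apply: (le_trans (cauchy_schwarz_sum _ _)); rewrite hq mul1r.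
have h3 : X <= r ^+ 2 / 2 + kap ^+ 4 * mean4 c / 2.
  have q4 : \sum_i q i 0 ^+ 4 <= r ^+ 2.
    rewrite -[leRHS]mulr1 -hq mulr_sumr; apply: ler_sum => i _.
    rewrite (_ : 4 = 2 + 2)%N// exprD ler_wpM2r ?sqr_ge0// -real_normK ?num_real//.
    by rewrite lerXn2r ?nnegrE//; exact: le_trans (hqr i).
  have w4 : \sum_i mf_field c i ^+ 4 <= kap ^+ 4 * mean4 c.
    by rewrite /kap exprVn mulrC ler_pdivlMr ?exprn_gt0 ?subr_gt0//; [rewrite mulrC mf_field4|case: rho01].
  apply: (le_trans (y := \sum_i (q i 0 ^+ 4 / 2 + mf_field c i ^+ 4 / 2))).
    apply: ler_sum => i _; have := sqr_ge0 (q i 0 ^+ 2 - mf_field c i ^+ 2).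
    rewrite -subr_ge0 => h; rewrite -subr_ge0.
    by rewrite (_ : _ - _ = (q i 0 ^+ 2 - mf_field c i ^+ 2) ^+ 2 / 2) ?divr_ge0 ?sqr_ge0//; field.
  by rewrite big_split/= -!mulr_suml lerD// ler_wpM2r.
have n1 : 0 <= noise2 c by apply: sumr_ge0 => i _; exact: sqr_ge0.
have n2 := sqr_ge0 (diag_noise c).
have k1 : 1 <= kap ^+ 4.
  by rewrite exprn_ege1// /kap invf_ge1 ?subr_gt0; case: rho01 => p0 p1; rewrite ?gerBl ?ltW.
have : 1 * (noise2 c + diag_noise c ^+ 2) <= kap ^+ 4 * (noise2 c + diag_noise c ^+ 2).
  by rewrite ler_wpM2r ?addr_ge0.
clear S1 X0; clearbody X; move: h1 h2 h3 n1 n2; rewrite /noise.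
move: (\sum_j mv _ j ^+ 2) ((\sum_i _) ^+ 2) X (noise2 c) (diag_noise c ^+ 2) (mean4 c) (kap ^+ 4) => a b x d e f k.
by rewrite !mulrDr; lra.
Qed.

Lemma cond_cdf_normal c r t : (forall i, `|q i 0| <= r) -> 0 < r -> r <= 1 ->
  alpha A <= r ^+ 2 -> n%:R * alpha A ^+ 2 <= r ^+ 2 ->
  \sum_i (mv (fun j => q j 0) i - lambda * q i 0) ^+ 2 <= r ^+ 2 ->
  `|cond_cdf mu A q c (t + \sum_i q i 0 * mf_fixpoint mu A c i) - Phi (t / sd)| <=
  stein_const kap ups * (33 * r + 32 * kap ^+ 4 * (noise c / r)).
Proof.
move=> hqr r0 r1 har hnar her.
have := stein_kolmogorov hrho cA oA (mf_fieldE c) hl hups hq hqr r0 r1 har hnar her (t / sd).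
have -> : Ex (iid mu n) (gw mu A (tnth c)) (fun s =>
    ((\sum_j q j 0 * (spin s j - mf_fixpoint mu A c j)) / sd <= t / sd)%R%:R) =
   cond_cdf mu A q c (t + \sum_i q i 0 * mf_fixpoint mu A c i).
  apply: eq_Ex => s; congr ((_ : bool)%:R : R).
  rewrite ler_pM2r ?invr_gt0 ?sd_gt0// -lerBlDr -sumrB; congr (_ <= _).
  by apply: eq_bigr => j _; rewrite mulrBr.
move=> h; apply: (le_trans h); apply: ler_wpM2l; first exact: stein_const_ge0.
have h1 := field_noise c hqr.
rewrite (_ : 33 * r + _ = r + (32 * kap ^+ 4 * noise c + 32 * r ^+ 2) / r); last first.
  by field; rewrite gt_eqF.
by rewrite lerD2l ler_wpM2r// invr_ge0 ltW.
Qed.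

Definition eps i : R := mv (fun j => q j 0) i - lambda * q i 0.
Definition noise_mean (c : cfg) : R :=
  \sum_j field_mean c j * mv (fun i => q i 0 * cvar (tnth c i)) j.
Definition eps_mean (c : cfg) : R := \sum_i eps i * field_mean c i.
Definition mf_shift (c : cfg) : R :=
  \sum_i q i 0 * mf_fixpoint mu A c i - \sum_i q i 0 * (field_mean c i / (1 - lambda * ups)).

(** Expand u_i = psi'(c_i + w_i) at c_i and split psi''(c_i) = ups + cvar; by symmetry [A] moves
    from u to q, where A q = lambda q + eps returns lambda q'u to the left-hand side. *)
Lemma mf_shiftE c : exists2 rem : R, `|rem| <= 4 * \sum_i `|q i 0| * mf_field c i ^+ 2 &
  (1 - lambda * ups) * mf_shift c =
  ups * \sum_i eps i * mf_fixpoint mu A c i +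
  \sum_i mv (fun i => q i 0 * cvar (tnth c i)) i * mf_fixpoint mu A c i + rem.
Proof.
pose u := mf_fixpoint mu A c.
pose rm i := u i - field_mean c i - mf_field c i * tvar (tnth c i).
have rmE i : `|rm i| <= 4 * mf_field c i ^+ 2.
  by rewrite /rm /u mf_fieldE (addrC (mf_field c i)); exact: m1_taylor.
exists (\sum_i q i 0 * rm i).
  apply: le_trans (ler_norm_sum _ _ _) _; rewrite mulr_sumr; apply: ler_sum => i _.
  by rewrite normrM mulrCA ler_wpM2l.
have e1 : \sum_i eps i * u i = \sum_i q i 0 * mf_field c i - lambda * \sum_i q i 0 * u i.
  have -> : \sum_i q i 0 * mf_field c i = \sum_i mv (fun j => q j 0) i * u i.
    exact: (esym (mv_sym cA (fun j => q j 0) u)).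
  rewrite mulr_sumr -sumrB; apply: eq_bigr => i _; rewrite /eps.
  by move: (mv _ i) (u i) (q i 0) => x y z; ring.
have e2 : \sum_i mv (fun i => q i 0 * cvar (tnth c i)) i * u i =
    \sum_i q i 0 * cvar (tnth c i) * mf_field c i by exact: (mv_sym cA).
have e3 : \sum_i q i 0 * u i = \sum_i q i 0 * field_mean c i + ups * (\sum_i q i 0 * mf_field c i)
    + \sum_i q i 0 * cvar (tnth c i) * mf_field c i + \sum_i q i 0 * rm i.
  rewrite mulr_sumr -!big_split/=; apply: eq_bigr => i _; rewrite /rm /cvar.
  by move: (u i) (mf_field c i) (q i 0) (tvar _) (field_mean c i) => x y z t m; ring.
have e4 : \sum_i q i 0 * (field_mean c i / (1 - lambda * ups)) =
    (\sum_i q i 0 * field_mean c i) / (1 - lambda * ups).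
  by rewrite mulr_suml; apply: eq_bigr => i _; rewrite mulrA.
rewrite /mf_shift -/u e1 e2 e4 mulrBr mulrCA mulfV ?gt_eqF ?theta_gt0// mulr1.
rewrite mulrBl mul1r [X in X - _ - _ = _]e3.
ring.
Qed.

Let rest j (c : cfg) : R := \sum_(k | k != j) field_mean c k *
  \sum_(i | i != j) A k i * (q i 0 * cvar (tnth c i)).

(* [rest j] is what remains of [noise_mean] once every term containing [c_j] is
   removed, so each summand of [noise_mean] is orthogonal to its own [rest]. *)
Lemma E_noise_mean2 : EF (fun c => noise_mean c ^+ 2) <= 4 * alpha A.
Proof.
pose v j c := mv (fun i => q i 0 * cvar (tnth c i)) j.
pose x c j := mv (field_mean c) j.
have Bv j : BM (v j) by exact: BM_mv_noise.
have Brest j : BM (rest j).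
  apply: BM_sum => k; apply: BMM => //; apply: BM_sum => i.
  by apply: BMM; [exact: BM_cst | apply: BMM => //; exact: BM_cst].
(* The summand of index j is centred in c_j. Since A j j = 0, c_j enters the bilinear form only
   through these two extra terms. *)
have dec c j : noise_mean c = rest j c + field_mean c j * v j c + q j 0 * cvar (tnth c j) * x c j.
  have Ajj : A j j = 0 by case: cA.
  have vj k : v k c = (\sum_(i | i != j) A k i * (q i 0 * cvar (tnth c i))) + A k j * (q j 0 * cvar (tnth c j)).
    by rewrite /v /mv (bigD1 j)//= addrC.
  rewrite /noise_mean (bigD1 j)//= -/(v j c).
  rewrite (eq_bigr (fun k => field_mean c k * (\sum_(i | i != j) A k i * (q i 0 * cvar (tnth c i))) +
     q j 0 * cvar (tnth c j) * (A j k * field_mean c k))); last first.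
    by move=> k _; rewrite -/(v k c) vj (coupling_sym cA j k); ring.
  rewrite big_split/= -mulr_sumr -/(rest j c).
  rewrite /x /mv [in RHS](bigD1 j)//= Ajj mul0r add0r; ring.
have BN : BM noise_mean by apply: BM_sum => j; apply: BMM; [exact: BM_mean | exact: Bv].
have orth j : EF (fun c => field_mean c j * (v j c * rest j c)) = 0.
  apply: (E_iid_mean0 BM_m1 m0); first exact: BMM.
  move=> c z; congr (_ * _).
    apply: eq_bigr => i _; rewrite tnth_upd; case: eqP => [->|//].
    by case: cA => _ ->; rewrite !mul0r.
  apply: eq_bigr => k kj; rewrite /field_mean tnth_upd (negbTE kj); congr (_ * _).
  by apply: eq_bigr => i ij; rewrite tnth_upd (negbTE ij).
have -> : EF (fun c => noise_mean c ^+ 2) =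
    EF (fun c => \sum_j field_mean c j * v j c * (field_mean c j * v j c + q j 0 * cvar (tnth c j) * x c j)).
  transitivity (EF (fun c => \sum_j field_mean c j * v j c * noise_mean c)).
    by apply: eq_Ex => c; rewrite expr2 {1}/noise_mean mulr_suml.
  have Bx j : BM (fun c => x c j) by exact: BM_mv_mean.
  have Bqx j : BM (fun c => q j 0 * cvar (tnth c j) * x c j).
    by apply: BMM => //; apply: BMM => //; exact: BM_cst.
  have Byv j : BM (fun c => field_mean c j * v j c) by apply: BMM; [exact: BM_mean | exact: Bv].
  have Bl j : BM (fun c => field_mean c j * v j c * (field_mean c j * v j c + q j 0 * cvar (tnth c j) * x c j)).
    by apply: BMM => //; apply: BMD.
  rewrite !(Ex_sum W)//; last by move=> j; exact: BMM.
  apply: eq_bigr => j _; rewrite -[RHS]add0r -(orth j) -(ExD W)//; last by apply: BMM => //; exact: BMM.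
  by apply: eq_Ex => c; rewrite (dec c j); ring.
have Bx j : BM (fun c => x c j) by exact: BM_mv_mean.
have B1 : BM (fun c => 3 / 2 * noise2 c) by apply: BMM; [exact: BM_cst | exact: BM_noise2].
have B2 : BM (fun c => \sum_j q j 0 ^+ 2 / 2 * x c j ^+ 2).
  by apply: BM_sum => j; apply: BMM; [exact: BM_cst | exact: BMX].
(* From y a (y a + b') <= 3/2 (y a)^2 + b'^2 / 2; in expectation this gives 3/2 * 2 alpha +
   alpha. *)
apply: (le_trans (y := EF (fun c => 3 / 2 * noise2 c + \sum_j q j 0 ^+ 2 / 2 * x c j ^+ 2))).
  apply: (Ex_le W) => [||c]; last first.
  - rewrite /noise2 mulr_sumr -big_split/=; apply: ler_sum => j _; rewrite -/(v j c).
    have y2 : field_mean c j ^+ 2 <= 1 by rewrite -real_normK ?num_real// expr_le1// m1_norm.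
    have c2 : cvar (tnth c j) ^+ 2 <= 1 by rewrite -real_normK ?num_real// expr_le1// cvar_norm.
    move: (field_mean c j) (cvar _) (v j c) (x c j) (q j 0) y2 c2 => y z a b p y2 z2.
    have h1 : y ^+ 2 * a ^+ 2 <= a ^+ 2 by rewrite -[leRHS]mul1r ler_wpM2r ?sqr_ge0.
    have h2 : z ^+ 2 * (p ^+ 2 * b ^+ 2) <= p ^+ 2 * b ^+ 2.
      by rewrite -[leRHS]mul1r ler_wpM2r// mulr_ge0 ?sqr_ge0.
    have h3 := sqr_ge0 (y * a - p * z * b).
    have e3 : (y * a - p * z * b) ^+ 2 = y ^+ 2 * a ^+ 2 + z ^+ 2 * (p ^+ 2 * b ^+ 2) - 2 * (y * a * (p * z * b)) by ring.
    rewrite e3 in h3.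
    have -> : y * a * (y * a + p * z * b) = y ^+ 2 * a ^+ 2 + y * a * (p * z * b) by ring.
    rewrite (_ : p ^+ 2 / 2 * b ^+ 2 = (p ^+ 2 * b ^+ 2) / 2); last by ring.
    by clear e3 y2 z2; lra.
  - exact: BMD.
  - apply: BM_sum => j; have Byv : BM (fun c => field_mean c j * v j c) by apply: BMM; [exact: BM_mean | exact: Bv].
    apply: BMM => //; apply: BMD => //; apply: BMM => //.
    by apply: BMM => //; exact: BM_cst.
have -> : EF (fun c => 3 / 2 * noise2 c + \sum_j q j 0 ^+ 2 / 2 * x c j ^+ 2) =
    3 / 2 * EF noise2 + \sum_j EF (fun c => q j 0 ^+ 2 / 2 * x c j ^+ 2).
  rewrite (ExD W B1 B2) (ExZ W _ BM_noise2); congr (_ + _); apply: (Ex_sum W) => j.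
  by apply: BMM; [exact: BM_cst | exact: BMX].
have h1 := E_noise2.
have h2 : \sum_j EF (fun c => q j 0 ^+ 2 / 2 * x c j ^+ 2) <= alpha A.
  rewrite -[leRHS]mulr1 -[X in _ <= _ * X]hq mulr_sumr; apply: ler_sum => j _.
  rewrite (ExZ W (q j 0 ^+ 2 / 2) (BMX 2 (Bx j))).
  rewrite (mulrC (alpha A)) -mulrA ler_wpM2l ?sqr_ge0// mulrC ler_pdivrMr// (mulrC _ 2).
  apply: (le_trans (E_iid_lin2 BM_m1 (m1_norm mu) m0 (A j))).
  by rewrite ler_wpM2l// alpha_row.
by move: h1 h2; move: (EF _) (\sum_j _) (alpha A) => a b d ? ?; lra.
Qed.

Lemma BM_mf_shift : BM mf_shift.
Proof.
apply: BMB; apply: BM_sum => i; apply: BMM; [exact: BM_cst| |exact: BM_cst|].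
  exact: BM_mf_fixpoint hrho cA oA _.
by apply: BMM; [exact: BM_mean | exact: BM_cst].
Qed.

Lemma Ex_norm_le_sqr (f : cfg -> R) B e : 0 < e -> BM f -> EF (fun c => f c ^+ 2) <= B * e ^+ 2 ->
  EF (fun c => `|f c|) <= (B + 1) * e.
Proof.
move=> e0 Bf h; apply: (le_trans (y := EF (fun c => e^-1 * f c ^+ 2 + e))).
  apply: (Ex_le W) => [||c]; [exact: BM_norm| |].
    by apply: BMD; [apply: BMM; [exact: BM_cst | exact: BMX] | exact: BM_cst].
  by rewrite mulrC; exact: le_sqr_div_add.
have B2 := BMX 2 Bf; rewrite (ExD W (BMM (BM_cst _ _) B2) (BM_cst _ _)) (ExZ W _ B2) (Ex_cst W).
rewrite mulrDl mul1r lerD2r ler_pdivrMl// mulrCA; exact: h.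
Qed.

Lemma E_mf_shift e : 0 < e -> \sum_i eps i ^+ 2 <= e ^+ 2 ->
  (\sum_i eps i ^+ 2) * (n%:R * alpha A) <= e ^+ 2 -> alpha A <= e ^+ 2 ->
  Num.sqrt n%:R * alpha A <= e ->
  EF (fun c => `|mf_shift c|) <= kap * (12 + 3 * kap ^+ 2 + 52 * kap ^+ 4) * e.
Proof.
have aux1 (a b k x : R) : a <= 2 * x -> b <= 2 * k * x -> (a + b) / 2 <= (1 + k) * x.
  by move=> ? ?; lra.
have aux2 (a1 a2 a3 a4 a5 k l x : R) : a1 <= 3 * x -> a2 <= (2 * k + 1) * x -> a3 <= 5 * x ->
    a4 <= (1 + k) * x -> a5 <= (2 + 52 * l) * x ->
    a1 + a2 + a3 + a4 + a5 <= (12 + 3 * k + 52 * l) * x.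
  by move=> ? ? ? ? ?; lra.
have aux3 (a b x1 x2 x3 x4 x5 d r : R) : ups * a + b + r = d -> `|a| <= x1 + x2 ->
    `|b| <= x3 + x4 -> `|r| <= x5 -> `|d| <= x1 + x2 + x3 + x4 + x5.
  move=> <- h1 h2 h3; apply: le_trans (ler_normD _ _) _; apply: lerD => //.
  apply: le_trans (ler_normD _ _) _; rewrite -[leRHS]addrA; apply: lerD => //.
  rewrite normrM; apply: le_trans h1; rewrite ler_piMl//; have /andP[u0 u1] := hups.
  by rewrite gtr0_norm.
move=> e0 h1 h2 h3 h4.
have [p0 p1] := rho01; have /andP[u0 u1] := hups.
have k0 : 0 < kap by rewrite invr_gt0 subr_gt0.
have al0 := alpha_ge0 A.
have n0 : 0 < n%:R :> R.
  rewrite ltr0n lt0n; apply/eqP => n0; have := hq.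
  rewrite big1 => [/eqP|[i hi] _]; first by rewrite eq_sym oner_eq0.
  by exfalso; move: (hi); rewrite [X in (_ < X)%N]n0.
have s0 : 0 < Num.sqrt n%:R :> R by rewrite sqrtr_gt0.
have s2 : Num.sqrt n%:R ^+ 2 = n%:R :> R by rewrite sqr_sqrtr// ltW.
have ee : 0 <= \sum_i eps i ^+ 2 by apply: sumr_ge0 => i _; exact: sqr_ge0.
pose w := mf_field; pose v c j := mv (fun i => q i 0 * cvar (tnth c i)) j.
have Bw i : BM (fun c => w c i) by exact: BM_mf_field.
have Bv i : BM (fun c => v c i) by exact: BM_mv_noise.
have Ew2 : EF (fun c => \sum_i w c i ^+ 2) <= 2 * kap ^+ 2 * (n%:R * alpha A).
  have := E_field2; rewrite -/kap -ler_pdivlMl ?exprn_gt0 ?subr_gt0// => /le_trans; apply.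
  by rewrite le_eqVlt /kap exprVn; apply/orP; left; apply/eqP; ring.
have Bw2 : BM (fun c => \sum_i w c i ^+ 2) by apply: BM_sum => i; exact: BMX.
have Bw4 : BM (fun c => \sum_i w c i ^+ 4) by apply: BM_sum => i; exact: BMX.
have Ew4 : EF (fun c => \sum_i w c i ^+ 4) <= 26 * kap ^+ 4 * e ^+ 2.
  apply: (le_trans (y := EF (fun c => kap ^+ 4 * mean4 c))).
    apply: (Ex_le W) => // [|c]; first by apply: BMM; [exact: BM_cst | exact: BM_mean4].
    by rewrite /kap exprVn ler_pdivlMl ?exprn_gt0 ?subr_gt0// mf_field4.
  rewrite (ExZ W _ BM_mean4) (_ : 26 * _ * _ = kap ^+ 4 * (26 * e ^+ 2)); last by ring.
  rewrite ler_wpM2l ?exprn_ge0 ?(ltW k0)//.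
  apply: (le_trans E_mean4); rewrite ler_wpM2l// (_ : _ * _ ^+ 2 = (Num.sqrt n%:R * alpha A) ^+ 2); last by rewrite exprMn s2.
  by rewrite lerXn2r ?nnegrE ?(ltW e0) ?mulr_ge0 ?(ltW s0).
pose X1 c := `|eps_mean c|.
pose X2 c := \sum_i `|eps i| * `|w c i|.
pose X3 c := `|noise_mean c|.
(* The weight sqrt n balances [noise2], of order alpha, against sum w_i^2, of order n alpha: both
   become sqrt n * alpha. *)
pose X4 c := (Num.sqrt n%:R * noise2 c + (Num.sqrt n%:R)^-1 * \sum_i w c i ^+ 2) / 2.
pose X5 c := 2 * e + 2 * e^-1 * \sum_i w c i ^+ 4.
have BX1' : BM eps_mean by apply: BM_sum => i; apply: BMM; [exact: BM_cst | exact: BM_mean].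
have BX1 : BM X1 by exact: BM_norm.
have BX2 : BM X2 by apply: BM_sum => i; apply: BMM; [exact: BM_cst | exact: BM_norm].
have BX3' : BM noise_mean by apply: BM_sum => j; apply: BMM; [exact: BM_mean | exact: Bv].
have BX3 : BM X3 by exact: BM_norm.
have B4a : BM (fun c => Num.sqrt n%:R * noise2 c) by apply: BMM; [exact: BM_cst | exact: BM_noise2].
have B4b : BM (fun c => (Num.sqrt n%:R)^-1 * \sum_i w c i ^+ 2) by apply: BMM => //; exact: BM_cst.
have BX4 : BM X4 by apply: BMM; [exact: BMD | exact: BM_cst].
have B5 : BM (fun c => 2 * e^-1 * \sum_i w c i ^+ 4) by apply: BMM => //; exact: BM_cst.
have BX5 : BM X5 by apply: BMD => //; exact: BM_cst.
have E1 : EF X1 <= 3 * e.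
  rewrite (_ : 3 = 2 + 1 :> R); last by ring.
  apply: Ex_norm_le_sqr => //; apply: (le_trans (E_iid_lin2 BM_m1 (m1_norm mu) m0 eps)).
  by rewrite ler_wpM2l.
have E2 : EF X2 <= (2 * kap ^+ 2 + 1) * e.
  have X20 c : 0 <= X2 c by apply: sumr_ge0 => i _; rewrite mulr_ge0.
  rewrite (eq_Ex _ _ (fun c => esym (ger0_norm (X20 c)))); apply: Ex_norm_le_sqr => //.
  apply: (le_trans (y := EF (fun c => (\sum_i eps i ^+ 2) * \sum_i w c i ^+ 2))).
    apply: (Ex_le W) => [||c]; [exact: BMX | by apply: BMM => //; exact: BM_cst |].
    apply: le_trans (cauchy_schwarz_sum _ _) _; rewrite le_eqVlt; apply/orP; left; apply/eqP.
    by congr (_ * _); apply: eq_bigr => i _; rewrite real_normK ?num_real.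
  rewrite (ExZ W _ Bw2); apply: (le_trans (ler_wpM2l ee Ew2)).
  by rewrite mulrCA ler_wpM2l// mulr_ge0// sqr_ge0.
have E3 : EF X3 <= 5 * e.
  rewrite (_ : 5 = 4 + 1 :> R); last by ring.
  by apply: Ex_norm_le_sqr => //; apply: (le_trans E_noise_mean2); rewrite ler_wpM2l.
have E4 : EF X4 <= (1 + kap ^+ 2) * e.
  rewrite (ExZr W _ (BMD B4a B4b)) (ExD W B4a B4b) (ExZ W _ BM_noise2) (ExZ W _ Bw2).
  have i1 : Num.sqrt n%:R * EF noise2 <= 2 * e.
    apply: (le_trans (ler_wpM2l (ltW s0) E_noise2)).
    by rewrite mulrCA ler_wpM2l.
  have i2 : (Num.sqrt n%:R)^-1 * EF (fun c => \sum_i w c i ^+ 2) <= 2 * kap ^+ 2 * e.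
    rewrite ler_pdivrMl//; apply: (le_trans Ew2).
    rewrite -[in n%:R * _]s2 (_ : 2 * kap ^+ 2 * _ = Num.sqrt n%:R * (2 * kap ^+ 2 * (Num.sqrt n%:R * alpha A))); last by ring.
    by rewrite ler_wpM2l ?(ltW s0)// ler_wpM2l// mulr_ge0// sqr_ge0.
  exact: aux1 i1 i2.
have E5 : EF X5 <= (2 + 52 * kap ^+ 4) * e.
  rewrite (ExD W (BM_cst _ _) B5) (Ex_cst W) (ExZ W _ Bw4) [leRHS]mulrDl lerD2l.
  rewrite (_ : 52 * kap ^+ 4 * e = 2 * e^-1 * (26 * kap ^+ 4 * e ^+ 2)); last by field; rewrite gt_eqF.
  by rewrite ler_wpM2l// mulr_ge0// invr_ge0 ltW.
have th := theta_gt0.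
have pt c : `|mf_shift c| <= kap * (X1 c + X2 c + X3 c + X4 c + X5 c).
  have split (a : 'I_n -> R) : `|\sum_i a i * mf_fixpoint mu A c i| <=
      `|\sum_i a i * field_mean c i| + \sum_i `|a i| * `|w c i|.
    have -> : \sum_i a i * mf_fixpoint mu A c i = \sum_i a i * field_mean c i +
        \sum_i a i * (mf_fixpoint mu A c i - field_mean c i).
      by rewrite -big_split/=; apply: eq_bigr => i _; rewrite -mulrDr addrC subrK.
    apply: le_trans (ler_normD _ _) _; rewrite lerD2l.
    apply: le_trans (ler_norm_sum _ _ _) _; apply: ler_sum => i _.
    by rewrite normrM ler_wpM2l// fixpoint_diff.
  have [rem hrem shE] := mf_shiftE c.
  have b4 : `|\sum_i v c i * mf_fixpoint mu A c i| <= X3 c + X4 c.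
    apply: (le_trans (split (v c))); apply: lerD.
      by rewrite /X3 /noise_mean le_eqVlt; apply/orP; left; apply/eqP; congr (`|_|); apply: eq_bigr => i _; rewrite mulrC.
    rewrite /X4 /noise2 !mulr_sumr -big_split/= mulr_suml; apply: ler_sum => i _; rewrite -/(v c i).
    rewrite -[v c i ^+ 2]real_normK ?num_real// -[w c i ^+ 2]real_normK ?num_real//.
    move: `|v c i| `|w c i| (Num.sqrt n%:R) s0 => a b s s0; rewrite -subr_ge0.
    rewrite (_ : _ - _ = (s * a - b) ^+ 2 / (2 * s)); last by field; rewrite gt_eqF.
    by rewrite divr_ge0 ?sqr_ge0// mulr_ge0// ltW.
  have b5 : `|rem| <= X5 c.
    apply: (le_trans hrem); rewrite /X5 -[2 * e]mulr1 -[X in _ <= _ * X + _]hq !mulr_sumr -big_split/=.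
    apply: ler_sum => i _; rewrite -[q i 0 ^+ 2]real_normK ?num_real// -/(w c i).
    move: `|q i 0| (w c i) => a b; rewrite -subr_ge0.
    rewrite (_ : _ - _ = 2 * (e * a - b ^+ 2) ^+ 2 / e); last by field; rewrite gt_eqF.
    apply: divr_ge0; last exact: ltW.
    by apply: mulr_ge0 => //; exact: sqr_ge0.
  have := aux3 _ _ _ _ _ _ _ _ _ (esym shE) (split eps) b4 b5.
  rewrite normrM gtr0_norm// -/(eps_mean c) -/(X1 c) -/(X2 c) => h.
  rewrite /kap ler_pdivlMl ?subr_gt0//; apply: le_trans h.
  by rewrite ler_wpM2r//; exact: theta_ge.
have BS : BM (fun c => X1 c + X2 c + X3 c + X4 c + X5 c).
  by apply: BMD => //; apply: BMD => //; apply: BMD => //; exact: BMD.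
apply: (le_trans (y := EF (fun c => kap * (X1 c + X2 c + X3 c + X4 c + X5 c)))).
  apply: (Ex_le W) => //; first by apply: BM_norm; exact: BM_mf_shift.
  by apply: BMM => //; exact: BM_cst.
rewrite (ExZ W _ BS) -mulrA ler_wpM2l ?(ltW k0)//.
rewrite (ExD W (BMD (BMD (BMD BX1 BX2) BX3) BX4) BX5) (ExD W (BMD (BMD BX1 BX2) BX3) BX4).
rewrite (ExD W (BMD BX1 BX2) BX3) (ExD W BX1 BX2).
exact: aux2 E1 E2 E3 E4 E5.
Qed.

End random_field.

(** * Lindeberg replacement and Gaussian convolution *)

Section gaussian_smoothing.
Context {R : realType}.

Definition gaussB : R := 16 * normal_peak 1.

(** exp (y^2 / 2) is the square of exp (y^2 / 4) >= (1 + y^2) / 4. *)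
Lemma phi1_poly_le (y : R) : (1 + y ^+ 2) ^+ 2 * phi1 y <= gaussB.
Proof.
rewrite phi1E mulrCA mulrC /gaussB ler_wpM2r ?normal_peak_ge0//.
rewrite expRN ler_pdivrMr ?expR_gt0//.
have -> : y ^+ 2 / 2 = y ^+ 2 / 4 + y ^+ 2 / 4 by field.
rewrite expRD -expr2; have h := expR_ge1Dx (y ^+ 2 / 4); have y2 := sqr_ge0 y.
move: (expR _) h => e h; have h4 : 1 + y ^+ 2 <= 4 * e by lra.
rewrite (_ : 16 * e ^+ 2 = (4 * e) ^+ 2); last by ring.
have p0 : 0 <= 1 + y ^+ 2 by rewrite addr_ge0.
by apply: lerXn2r => //; rewrite nnegrE// (le_trans p0).
Qed.

Let phi1_le (y c : R) : `|c| <= (1 + y ^+ 2) ^+ 2 -> `|c * phi1 y| <= gaussB.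
Proof.
move=> h; rewrite normrM (gtr0_norm (phi1_gt0 y)); apply: le_trans (phi1_poly_le y).
by rewrite ler_wpM2r// ltW// phi1_gt0.
Qed.

Let norm_le_poly (y : R) : `|y| <= 1 + y ^+ 2.
Proof.
have := sqr_ge0 (`|y| - 1); rewrite (_ : (`|y| - 1) ^+ 2 = `|y| ^+ 2 - 2 * `|y| + 1); last by ring.
rewrite real_normK ?num_real//; have := sqr_ge0 y; have := normr_ge0 y; lra.
Qed.

Let phi1_derive2 (y : R) : is_derive y (1:R) (fun y => - y * phi1 y) ((y ^+ 2 - 1) * phi1 y).
Proof.
have h : is_derive y (1:R) (fun y : R => - y) (-1) by apply: is_derive_opp.
by apply: is_derive_eq (is_derive_mul h (phi1_derive y)) _; ring.
Qed.

Lemma Phi_taylor (y k : R) :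
  `|Phi (y + k) - Phi y - k * phi1 y - k ^+ 2 / 2 * (- y * phi1 y)| <= gaussB * `|k| ^+ 3.
Proof.
apply: (@taylor2 R Phi phi1 (fun y => - y * phi1 y) gaussB Phi_derive phi1_derive).
apply: (derive_bounded_lipschitz phi1_derive2) => x; apply: phi1_le.
have x2 := sqr_ge0 x; have x4 := mulr_ge0 x2 x2; move: (x ^+ 2) x2 x4 => z z0 zz.
by rewrite ler_norml (_ : (1 + z) ^+ 2 = 1 + 2 * z + z * z); [apply/andP; split; lra | ring].
Qed.

(* The heat equation for the normal cdf of variance [expR l]; in the parameter [l]
   the function is smooth with bounded derivatives on the whole line. *)
Lemma Phi_scale_taylor (y l : R) :
  `|Phi (y * expR (- l / 2)) - Phi y - l * (- (y * phi1 y) / 2)| <= gaussB * l ^+ 2.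
Proof.
pose p s := y * expR (- s / 2).
have pD (s : R) : is_derive s (1:R) p (- p s / 2).
  have h1 : is_derive s (1:R) (fun s : R => - s / 2) (- 1 / 2).
    have h : is_derive s (1:R) (fun y : R => - y) (-1) by apply: is_derive_opp.
    by apply: is_derive_eq (is_derive_mul h (is_derive_cst (2^-1 : R) s 1)) _; rewrite mulr0 addr0.
  have h2 := @is_derive_comp _ expR (fun s : R => - s / 2) s _ _ (is_derive_expR _) h1.
  apply: is_derive_eq (is_derive_mul (is_derive_cst y s 1) h2) _; rewrite /p /cst.
  by move: (expR _) => e; ring.
have D1 (s : R) : is_derive s (1:R) (fun s => Phi (p s)) (- (p s * phi1 (p s)) / 2).
  apply: is_derive_eq (@is_derive_comp _ Phi p s _ _ (Phi_derive (p s)) (pD s)) _.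
  by move: (p s) (phi1 (p s)) => b a; ring.
have D2 (s : R) : is_derive s (1:R) (fun s => - (p s * phi1 (p s)) / 2) (p s * (1 - p s ^+ 2) / 4 * phi1 (p s)).
  have := is_derive_mul (@is_derive_comp _ (fun y => - y * phi1 y) p s _ _ (phi1_derive2 (p s)) (pD s)) (is_derive_cst (2^-1 : R) s 1).
  have -> : (fun x : R => (- p x * phi1 (p x)) * cst (2^-1) x) = (fun s => - (p s * phi1 (p s)) / 2).
    by apply/funext => x; rewrite mulNr.
  move=> h; apply: is_derive_eq h _; rewrite /cst; move: (p s) (phi1 (p s)) => b a; by field.
have := @taylor1 R _ _ gaussB D1 _ 0 l; rewrite add0r.
rewrite /p oppr0 mul0r expR0 mulr1; apply.
apply: (derive_bounded_lipschitz D2) => s; apply: phi1_le.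
move: (p s) => x; rewrite !normrM -[leLHS]mulrA expr2; apply: ler_pM => //.
have x2 := sqr_ge0 x; rewrite [`|4^-1|]ger0_norm// ler_pdivrMr//.
by rewrite ler_norml; apply/andP; split; lra.
Qed.

End gaussian_smoothing.

Section lindeberg.
Context {R : realType}.
Local Notation RR := (measurableTypeR R).
Variables (F : probability RR R) (g : RR -> R) (G S2 V : R).
Hypothesis Bg : BM g.
Hypothesis gG : forall z, `|g z| <= G.
Hypothesis g0 : \int[F]_z g z = 0.
Hypothesis g2 : \int[F]_z g z ^+ 2 = S2.
Hypothesis V0 : 0 < V.

Let G0 : 0 <= G. Proof. exact: le_trans (gG 0). Qed.
Let W := weight1 F.

Lemma continuous_Phi : continuous (@Phi R).
Proof. exact: is_derive_continuous Phi_derive. Qed.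

Let S20 : 0 <= S2.
Proof. by rewrite -g2; apply: Rintegral_ge0 => z _; exact: sqr_ge0. Qed.

Let S2G : S2 <= G ^+ 2.
Proof.
rewrite -g2 -Ex_weight1; apply: (Ex_le_cst W) => [|z]; first exact: BMX.
by rewrite -real_normK ?num_real// lerXn2r ?nnegrE.
Qed.

Definition lindeberg_err (b : R) : R := gaussB * ((`|b| * G) ^+ 3 + 2 * (`|b| * G) ^+ 4).

Let gaussB0 : 0 <= @gaussB R.
Proof. by rewrite mulr_ge0// normal_peak_ge0. Qed.

(** Adding the centred noise b g and raising the variance from 1 to 1 + b^2 S2 both move Phi y by s
    c, up to a third-order and a fourth-order error in b respectively. *)
Lemma lindeberg_step y b :
  `|\int[F]_z Phi (y + b * g z) - Phi (y / Num.sqrt (1 + b ^+ 2 * S2))| <= lindeberg_err b.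
Proof.
pose c := - (y * phi1 y) / 2; pose s := b ^+ 2 * S2.
have s0 : 0 <= s by rewrite mulr_ge0 ?sqr_ge0.
have sG : s ^+ 2 <= (`|b| * G) ^+ 4.
  rewrite (_ : (`|b| * G) ^+ 4 = (`|b| ^+ 2 * G ^+ 2) ^+ 2); last by ring.
  have h : s <= b ^+ 2 * G ^+ 2 by apply: ler_wpM2l; rewrite ?sqr_ge0.
  by rewrite real_normK ?num_real//; apply: lerXn2r => //; rewrite nnegrE// (le_trans s0).
pose T z := Phi y + b * g z * phi1 y + (b * g z) ^+ 2 / 2 * (- y * phi1 y).
have BP : BM (fun z : RR => Phi (y + b * g z)).
  apply: (BM_comp continuous_Phi); apply: BMD; first exact: BM_cst.
  by apply: BMM => //; exact: BM_cst.
have BTa : BM (fun z : RR => b * phi1 y * g z) by apply: BMM => //; exact: BM_cst.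
have BTb : BM (fun z : RR => b ^+ 2 * c * g z ^+ 2) by apply: BMM; [exact: BM_cst | exact: BMX].
have TE : T = fun z => Phi y + b * phi1 y * g z + b ^+ 2 * c * g z ^+ 2.
  by apply/funext => z; rewrite /T /c; move: (g z) (phi1 y) (Phi y) => u v w; field.
have BT : BM T by rewrite TE; apply: BMD => //; apply: BMD => //; exact: BM_cst.
have ET : Ex F (fun=> 1) T = Phi y + s * c.
  rewrite TE (ExD W (BMD (BM_cst _ _) BTa) BTb) (ExD W (BM_cst _ _) BTa) (Ex_cst W).
  rewrite (ExZ W _ Bg) (ExZ W _ (BMX 2 Bg)) !Ex_weight1 g0 g2 mulr0 addr0 /s; ring.
have h1 : `|Ex F (fun=> 1) (fun z => Phi (y + b * g z)) - (Phi y + s * c)| <= gaussB * (`|b| * G) ^+ 3.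
  rewrite -ET -(ExB W BP BT); apply: (Ex_norm_le W) => [|z]; first exact: BMB.
  rewrite /T !opprD !addrA; apply: (le_trans (Phi_taylor y (b * g z))).
  rewrite ler_wpM2l// normrM lerXn2r ?nnegrE ?mulr_ge0// ler_wpM2l//.
(* The logarithm of the variance is the parameter of [Phi_scale_taylor]; s - s^2 <= l <= s makes it
   interchangeable with s. *)
pose l := ln (1 + s).
have l1 : l <= s by apply: le_ln1Dx; lra.
have l0 : 0 <= l by apply: ln_ge0; lra.
have l2 : s - s ^+ 2 <= l.
  have p : 0 < 1 + s by lra.
  have := @le_ln1Dx R (- s / (1 + s)).
  have e : 1 + - s / (1 + s) = (1 + s)^-1 by field; rewrite gt_eqF.
  rewrite e lnV ?posrE// -/l => /(_ _) h.
  have : - l <= - s / (1 + s) by apply: h; rewrite -subr_gt0 opprK addrC e invr_gt0.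
  suff : - s / (1 + s) <= s ^+ 2 - s by move=> ? ?; lra.
  rewrite ler_pdivrMr// -subr_ge0 (_ : _ - _ = s ^+ 3); last by ring.
  exact: exprn_ge0.
have cB : `|c| <= gaussB.
  rewrite /c mulrC normrM normrN [`|2^-1|]ger0_norm// normrM (gtr0_norm (phi1_gt0 y)).
  have := phi1_poly_le y; have y2 := sqr_ge0 y; have := phi1_gt0 y.
  have : `|y| <= (1 + y ^+ 2) ^+ 2.
    have := sqr_ge0 (`|y| - 1); rewrite (_ : (`|y| - 1) ^+ 2 = `|y| ^+ 2 - 2 * `|y| + 1); last by ring.
    rewrite real_normK ?num_real// (_ : (1 + y ^+ 2) ^+ 2 = 1 + 2 * y ^+ 2 + y ^+ 2 * y ^+ 2); last by ring.
    by have := mulr_ge0 y2 y2; have := normr_ge0 y; lra.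
  move: (phi1 y) ((1 + y ^+ 2) ^+ 2) => p k h p0 h2.
  have : `|y| * p <= k * p by rewrite ler_wpM2r// ltW.
  have : 0 <= `|y| * p by rewrite mulr_ge0// ltW.
  by move: (`|y| * p) (k * p) (gaussB) h2 => ? ? ? ? ? ?; lra.
have h2 : `|Phi (y / Num.sqrt (1 + s)) - (Phi y + s * c)| <= gaussB * (2 * s ^+ 2).
  have -> : y / Num.sqrt (1 + s) = y * expR (- l / 2).
    congr (_ * _); have p : 0 < 1 + s by lra.
    rewrite -[1 + s]lnK ?posrE// -/l mulNr expRN; congr (_^-1).
    rewrite {1}(_ : l = l / 2 + l / 2); last by field.
    by rewrite expRD -expr2 sqrtr_sqr ger0_norm ?expR_ge0.
  have := Phi_scale_taylor y l; rewrite -/c.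
  have lc : `|(l - s) * c| <= s ^+ 2 * gaussB.
    rewrite normrM; apply: ler_pM => //; rewrite ler_norml; apply/andP; split; lra.
  have ls : gaussB * l ^+ 2 <= gaussB * s ^+ 2.
    by rewrite ler_wpM2l// lerXn2r ?nnegrE.
  move: (Phi _) (Phi y) (gaussB * l ^+ 2) ls lc => a d e ls lc h.
  have -> : a - (d + s * c) = a - d - l * c + (l - s) * c by ring.
  apply: le_trans (ler_normD _ _) _.
  rewrite (_ : gaussB * (2 * s ^+ 2) = gaussB * s ^+ 2 + s ^+ 2 * gaussB); last by ring.
  by apply: lerD => //; exact: le_trans ls.
rewrite -Ex_weight1 -/s /lindeberg_err mulrDr.
move: h1 h2; move: (Ex _ _ _) (Phi _) (Phi y + s * c) => a d e h1 h2.
have -> : a - d = (a - e) - (d - e) by ring.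
apply: le_trans (ler_normB _ _) _; apply: lerD => //; apply: le_trans h2 _.
by rewrite ler_wpM2l// ler_wpM2l.
Qed.

Lemma Rintegral_iidS n (f : n.+1.-tuple RR -> R) : BM f -> (forall s, 0 <= f s) ->
  \int[iid F n.+1]_s f s = \int[F]_x \int[iid F n]_s f (tcons (x, s)).
Proof.
move=> Bf f0; have [mf [M fM]] := Bf.
have B2 : BM (fun p : RR * n.-tuple RR => f (tcons p)).
  split; last by exists M => p; exact: fM.
  exact: (measurableT_comp mf (@measurable_tcons R n)).
apply: EFin_inj; rewrite (Rintegral_fineK _ Bf) integral_iidS//; last exact/measurable_EFinP.
rewrite (Rintegral_fineK F (BM_Rintegral F (iid F n) B2)).
apply: eq_integral => x _; rewrite (Rintegral_fineK _ (BM_curry x B2))//.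
Qed.

Lemma BM_Phi_lin n (q : 'I_n -> R) x v :
  BM (fun c : n.-tuple RR => Phi ((x - \sum_i q i * g (tnth c i)) / v)).
Proof.
apply: (BM_comp continuous_Phi); apply: BMM; last exact: BM_cst.
apply: BMB; first exact: BM_cst.
by apply: BM_sum => i; apply: BMM; [exact: BM_cst | exact: BM_iid_tnth].
Qed.

(** Induction peeling off the first coordinate: the others are already Gaussian, so it is replaced
    against variance v' >= V. The floor [V] bounds the step error uniformly and spares any smoothing
    of the indicator. *)
Lemma lindeberg n (q : 'I_n -> R) v x : V <= v ->
  `|\int[iid F n]_c Phi ((x - \sum_i q i * g (tnth c i)) / Num.sqrt v) -
    Phi (x / Num.sqrt (v + S2 * \sum_i q i ^+ 2))| <= \sum_i lindeberg_err (q i / Num.sqrt V).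
Proof.
elim: n q v x => [|n IH] q v x Vv.
  rewrite !big_ord0 mulr0 addr0.
  have -> : \int[iid F 0]_c Phi ((x - \sum_(i < 0) q i * g (tnth c i)) / Num.sqrt v) = Phi (x / Num.sqrt v).
    rewrite -Ex_weight1 -[RHS](Ex_cst (weight1 (iid F 0))); apply: eq_Ex => c.
    by rewrite big_ord0 subr0.
  by rewrite subrr normr0.
rewrite Rintegral_iidS; [|exact: BM_Phi_lin|by move=> s; exact: Phi_ge0].
pose q' i := q (lift ord0 i); pose Q := \sum_i q' i ^+ 2.
have Q0 : 0 <= Q by apply: sumr_ge0 => i _; exact: sqr_ge0.
pose v' := v + S2 * Q; have Vv' : V <= v' by rewrite (le_trans Vv)// lerDl mulr_ge0.
have v0 : 0 < v' by exact: lt_le_trans Vv'.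
pose J z := \int[iid F n]_s Phi ((x - q ord0 * g z - \sum_i q' i * g (tnth s i)) / Num.sqrt v).
have lin z (s : n.-tuple RR) : x - \sum_i q i * g (tnth (tcons (z, s)) i) =
    x - q ord0 * g z - \sum_i q' i * g (tnth s i).
  rewrite big_ord_recl opprD addrA; congr (_ - _).
  by apply: eq_bigr => i _; rewrite /q' /tcons tnthS.
have JE z : \int[iid F n]_s Phi ((x - \sum_i q i * g (tnth (tcons (z, s)) i)) / Num.sqrt v) = J z.
  by apply: eq_Rintegral => s _; rewrite lin.
have -> : \int[F]_z \int[iid F n]_s Phi ((x - \sum_i q i * g (tnth (tcons (z, s)) i)) / Num.sqrt v) =
    Ex F (fun=> 1) J.
  by rewrite Ex_weight1; apply: eq_Rintegral => z _; exact: JE.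
have BJ : BM J.
  have BK : BM (fun p : RR * n.-tuple RR => Phi ((x - q ord0 * g p.1 - \sum_i q' i * g (tnth p.2 i)) / Num.sqrt v)).
    apply: (BM_comp continuous_Phi); apply: BMM; last exact: BM_cst.
    have [mg [M gM]] := Bg.
    apply: BMB; first (apply: BMB; first exact: BM_cst).
      apply: BMM; first exact: BM_cst.
      by split; [exact: measurableT_comp | exists M => p].
    apply: BM_sum => i; apply: BMM; first exact: BM_cst.
    split; last by exists M => p.
    apply: measurableT_comp => //; apply: (measurableT_comp (measurable_tnth i)) => //.
  exact: (BM_Rintegral F (iid F n) BK).
pose b := - q ord0 / Num.sqrt v'.
pose L z := Phi (x / Num.sqrt v' + b * g z).
have BL : BM L.
  apply: (BM_comp continuous_Phi); apply: BMD; first exact: BM_cst.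
  by apply: BMM => //; exact: BM_cst.
rewrite [leRHS]big_ord_recl [leRHS]addrC.
have h1 : `|Ex F (fun=> 1) J - Ex F (fun=> 1) L| <= \sum_i lindeberg_err (q' i / Num.sqrt V).
  rewrite -(ExB W BJ BL); apply: (Ex_norm_le W) => [|z]; first exact: BMB.
  rewrite /L /b (_ : _ + _ = (x - q ord0 * g z) / Num.sqrt v'); last by rewrite mulrBl mulNr mulrAC mulNr.
  exact: IH.
have h2 : `|Ex F (fun=> 1) L - Phi (x / Num.sqrt (v + S2 * \sum_i q i ^+ 2))| <=
    lindeberg_err (q ord0 / Num.sqrt V).
  have s0 : 0 < Num.sqrt v' by rewrite sqrtr_gt0.
  have e : x / Num.sqrt v' / Num.sqrt (1 + b ^+ 2 * S2) = x / Num.sqrt (v + S2 * \sum_i q i ^+ 2).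
    rewrite -mulrA -invfM -sqrtrM ?(ltW v0)//; congr (_ / Num.sqrt _).
    rewrite big_ord_recl -/Q /b exprMn sqrrN exprVn sqr_sqrtr ?(ltW v0)//.
    rewrite (_ : v + _ = v' + S2 * q ord0 ^+ 2); last by rewrite /v'; ring.
    by clearbody v'; field; rewrite gt_eqF.
  rewrite Ex_weight1 -e; apply: (le_trans (lindeberg_step _ _)).
  have bq : `|b| <= `|q ord0 / Num.sqrt V|.
    rewrite /b !normrM normrN ler_wpM2l// !ger0_norm ?invr_ge0//.
    by rewrite lef_pV2 ?posrE ?sqrtr_gt0// ler_sqrt// ltW.
  rewrite /lindeberg_err ler_wpM2l//; apply: lerD.
    by rewrite lerXn2r ?nnegrE ?mulr_ge0// ler_wpM2r.
  by rewrite ler_wpM2l// lerXn2r ?nnegrE ?mulr_ge0// ler_wpM2r.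
move: h1 h2; move: (Ex _ _ L) (Ex _ _ J) (Phi _) => d a f h1 h2.
rewrite -(subrKA d); apply: le_trans (ler_normD _ _) _; exact: lerD.
Qed.

End lindeberg.

(** * Convolution of Gaussian laws *)

Section gaussian_convolution.
Context {R : realType}.
Local Notation RR := (measurableTypeR R).
Local Notation leb := (@lebesgue_measure R).

Lemma integral_normal_density (m s : R) (f : RR -> R) : BM f ->
  (\int[normal_prob m s]_x (f x)%:E = \int[leb]_x (f x * normal_pdf m s x)%:E)%E.
Proof.
move=> Bf; have [mf _] := Bf.
have mE : measurable_fun setT (fun x : RR => (f x)%:E) by exact/measurable_EFinP.
rewrite -(Radon_Nikodym_change_of_variables (normal_prob_dominates m s))//=; last first.
  exact: (BM_integrable (normal_prob m s) Bf).
under [RHS]eq_integral do rewrite EFinM.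
apply: ae_eq_integral => //.
- apply: emeasurable_funM => //; apply: (measurable_int leb).
  by apply: Radon_Nikodym_integrable; exact: normal_prob_dominates.
- apply: emeasurable_funM => //=; apply/measurableT_comp => //=.
  exact: measurable_normal_pdf.
- apply: ae_eqe_mul2l => /=.
  rewrite Radon_NikodymE//=; first exact: normal_prob_dominates.
  move=> dom; case: cid => /= h [h1 h2 h3].
  apply: integral_ae_eq => //=.
  + by apply/measurableT_comp =>//; exact: measurable_normal_pdf.
  + by move=> E _ E1; rewrite -h3.
Qed.

Lemma gauss_cdf (v t : R) : 0 < v -> gauss v [set` `]-oo, t]] = (Phi (t / Num.sqrt v))%:E.
Proof.
move=> v0; rewrite /gauss gt_eqF//= -[in RHS](subr0 t) -ncdf_scale ?sqrtr_gt0//.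
rewrite /ncdf fineK//; apply: fin_num_measure; exact: measurable_itv.
Qed.

Lemma convolution_gauss (v t : R) (Q : probability RR R) : 0 < v ->
  convolution (gauss v) Q [set` `]-oo, t]] = (\int[Q]_y (Phi ((t - y) / Num.sqrt v))%:E)%E.
Proof.
move=> v0; rewrite /convolution.
set A := [set p | _].
have mA : measurable A.
  have := @measurable_funD _ _ R setT (fst : RR * RR -> RR) (snd : RR * RR -> RR) measurable_fst measurable_snd.
  move=> /(_ measurableT _ (measurable_itv `]-oo, t])); rewrite setTI; exact.
transitivity (\int[(gauss v \x Q)%E]_z (\1_A z)%:E)%E.
  by rewrite integral_indic ?setIT.
apply: etrans (@fubini_tonelli2 _ _ _ _ R (gauss v) Q (EFin \o \1_A) _ _) _.
- by apply/measurable_EFinP; exact: measurable_indic.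
- by move=> z; rewrite lee_fin.
apply: eq_integral => y _; rewrite /fubini_G.
transitivity (\int[gauss v]_x (\1_([set` `]-oo, (t - y)%R]]) x)%:E)%E.
  apply: eq_integral => x _; rewrite !indicE; congr ((_ : bool)%:R)%:E.
  by apply/idP/idP; rewrite !inE /A /= !in_itv/= lerBrDr.
rewrite integral_indic ?setIT//; exact: gauss_cdf.
Qed.

(* Completing the square in [y]. *)
Lemma normal_pdf_convolution (a b x y : R) : 0 < a -> 0 < b ->
  let s := Num.sqrt (a ^+ 2 + b ^+ 2) in
  normal_pdf y a x * normal_pdf 0 b y =
  normal_pdf 0 s x * normal_pdf (x * b ^+ 2 / s ^+ 2) (a * b / s) y.
Proof.
move=> a0 b0 s; have s0 : 0 < s by rewrite sqrtr_gt0 addr_gt0// exprn_gt0.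
have s2 : s ^+ 2 = a ^+ 2 + b ^+ 2 by rewrite sqr_sqrtr// addr_ge0 ?sqr_ge0.
have c0 : 0 < a * b / s by rewrite divr_gt0// mulr_gt0.
rewrite !normal_pdf_scale// !phi1E !subr0.
set p := normal_peak 1.
transitivity (p ^+ 2 / (a * b) * expR (- ((x - y) / a) ^+ 2 / 2 - (y / b) ^+ 2 / 2)).
  by rewrite expRD !mulNr; move: (expR _) (expR _) => e f; field; rewrite !gt_eqF.
transitivity (p ^+ 2 / (a * b) * expR (- (x / s) ^+ 2 / 2 - ((y - x * b ^+ 2 / s ^+ 2) / (a * b / s)) ^+ 2 / 2)); last first.
  by rewrite expRD !mulNr; move: (expR _) (expR _) => e f; field; rewrite !gt_eqF.
congr (_ * expR _).
have -> : (y - x * b ^+ 2 / s ^+ 2) / (a * b / s) = (y * s ^+ 2 - x * b ^+ 2) / (a * b * s).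
  by field; rewrite !gt_eqF.
rewrite !expr_div_n !exprMn s2; have h1 : a ^+ 2 + b ^+ 2 != 0 by rewrite gt_eqF// addr_gt0// exprn_gt0.
by field; rewrite h1 !gt_eqF.
Qed.

Let BPhi (t r : R) : BM (fun y : RR => Phi ((t - y) / r)).
Proof.
split; last by exists 1 => y; rewrite ger0_norm ?Phi_ge0 ?Phi_le1.
apply: measurableT_comp; first exact: continuous_measurable_fun continuous_Phi.
apply: measurable_funM; last exact: measurable_cst.
by apply: measurable_funB => //; exact: measurable_cst.
Qed.

Let measurable_density2 (a b t : R) : 0 < a -> 0 < b ->
  measurable_fun setT (fun z : RR * RR => normal_pdf z.1 a z.2 * normal_pdf 0 b z.1 * (z.2 <= t)%R%:R).
Proof.
move=> a0 b0; apply: measurable_funM; last by case: (BM_le (R := R) t (measurable_snd (T1 := RR) (T2 := RR))).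
apply: measurable_funM; last by apply: measurableT_comp; [exact: measurable_normal_pdf | exact: measurable_fst].
under eq_fun do rewrite normal_pdf_scale//.
apply: measurable_funM; last exact: measurable_cst.
apply: measurableT_comp; first exact: measurable_normal_pdf.
apply: measurable_funM; last exact: measurable_cst.
by apply: measurable_funB; [exact: measurable_snd | exact: measurable_fst].
Qed.

Lemma convolution_gauss_gauss (v w t : R) : 0 < v -> 0 <= w ->
  fine (convolution (gauss v) (gauss w) [set` `]-oo, t]]) = Phi (t / Num.sqrt (v + w)).
Proof.
move=> v0 w0; rewrite convolution_gauss//.
(* The second variance vanishes when psi'(c_1) = 0 almost surely; [gauss 0] is then a Dirac mass. *)
have [->|wn0] := eqVneq w 0.
  rewrite addr0 /gauss eqxx integral_dirac//= ?diracT ?mul1e ?subr0//; first by rewrite indicT mul1r.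
  by apply/measurable_EFinP; case: (BPhi t (Num.sqrt v)).
have w1 : 0 < w by rewrite lt_neqAle eq_sym wn0.
pose a := Num.sqrt v; pose b := Num.sqrt w.
have a0 : 0 < a by rewrite sqrtr_gt0.
have b0 : 0 < b by rewrite sqrtr_gt0.
pose s := Num.sqrt (a ^+ 2 + b ^+ 2).
have sE : s = Num.sqrt (v + w) by rewrite /s !sqr_sqrtr// ltW.
have s0 : 0 < s by rewrite sE sqrtr_gt0 addr_gt0.
pose I x : R := (x <= t)%R%:R.
pose k (y x : R) := normal_pdf y a x * normal_pdf 0 b y * I x.
have -> : gauss w = normal_prob 0 b :> probability RR R by rewrite /gauss gt_eqF.
rewrite integral_normal_density; last first.
  exact: BPhi.
transitivity (fine (\int[leb]_y \int[leb]_x (k y x)%:E)%E).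
  congr fine; apply: eq_integral => y _.
  have -> : (Phi ((t - y) / Num.sqrt v) * normal_pdf 0 b y)%:E =
      (\int[leb]_(x in [set` `]-oo, t]]) (normal_pdf y a x * normal_pdf 0 b y)%:E)%E.
    under [RHS]eq_integral do rewrite EFinM.
    rewrite ge0_integralZr//.
    - rewrite EFinM; congr (_ * _)%E; rewrite -ncdf_scale// /ncdf fineK//.
      by apply: fin_num_measure; exact: measurable_itv.
    - by apply/measurable_EFinP; apply: measurable_funTS; exact: measurable_normal_pdf.
    - by move=> x _; rewrite lee_fin normal_pdf_ge0.
    - by rewrite lee_fin normal_pdf_ge0.
  rewrite integral_mkcond; apply: eq_integral => x _; rewrite patchE /k /I.
  have -> : (x \in [set` `]-oo, t]]) = (x <= t) by rewrite mem_setE in_itv.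
  by case: (x <= t); rewrite ?mulr1 ?mulr0.
have k0 y x : 0 <= k y x by rewrite !mulr_ge0// normal_pdf_ge0.
(* After the exchange, completing the square leaves a Gaussian density in y that integrates to 1. *)
transitivity (fine (\int[leb]_x \int[leb]_y (k y x)%:E)%E).
  congr fine; apply: (@fubini_tonelli _ _ _ _ R leb leb (fun z => (k z.1 z.2)%:E)).
  - by apply/measurable_EFinP; exact: measurable_density2.
  - by move=> z; rewrite lee_fin.
rewrite -sE -[t in RHS]subr0 -ncdf_scale// /ncdf /normal_prob [in RHS]integral_mkcond; congr fine.
apply: eq_integral => x _; rewrite patchE.
have -> : (x \in [set` `]-oo, t]]) = (x <= t) by rewrite mem_setE in_itv.
under eq_integral do rewrite /k normal_pdf_convolution// -/s mulrAC EFinM.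
rewrite ge0_integralZl//; last 3 first.
- by apply/measurable_EFinP; exact: measurable_normal_pdf.
- by move=> y _; rewrite lee_fin normal_pdf_ge0.
- by rewrite lee_fin mulr_ge0// normal_pdf_ge0.
rewrite integral_normal_pdf mule1 /I.
by case: (x <= t); rewrite ?mulr1 ?mulr0.
Qed.

End gaussian_convolution.

(** * Assembling the bounds *)

Lemma markov_OP d (T : measurableType d) (R : realType) (P : probability T R)
    (X D : T -> R) (K r : R) :
  measurable_fun setT X -> (forall c, 0 <= X c <= D c) -> BM D ->
  Ex P (fun=> 1) D <= K * r -> 0 < K -> 0 < r ->
  OP_with P (fun delta => K / delta) X r.
Proof.
move=> mX XD BD ED K0 r0 delta d0.
pose a := K / delta * r; have a0 : 0 < a by rewrite mulr_gt0// divr_gt0.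
set S := [set c | _].
have SE : S = [set c | a < X c].
  apply/seteqP; split=> c; rewrite /S /= ger0_norm//; by have /andP[] := XD c.
have mS : measurable S.
  rewrite SE; have := @measurable_fun_ltr _ _ _ setT (cst a) X (measurable_cst _) mX measurableT [set true].
  by rewrite setTI preimage_true; exact.
have D0 c : 0 <= D c by have /andP[h1 h2] := XD c; exact: le_trans h2.
apply: (@le_trans _ _ (Ex P (fun=> 1) (fun c => D c * a^-1))%:E).
  rewrite Ex_weight1 Rintegral_fineK; last by apply: BMM => //; exact: BM_cst.
  rewrite -[S]setIT -integral_indic//; apply: ge0_le_integral => //.
  - by apply/measurable_EFinP; exact: measurable_indic.
  - by apply/measurable_EFinP; apply: measurable_funM; [case: BD | exact: measurable_cst].
  move=> c _; rewrite lee_fin indicE; case: (boolP (c \in S)) => [|_]; last by rewrite mulr_ge0// invr_ge0 ltW.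
  rewrite inE SE /= => h; rewrite ler_pdivlMr// mul1r.
  by have /andP[_ h2] := XD c; exact: le_trans (ltW h) h2.
rewrite lee_fin (ExZr (weight1 P) _ BD) ler_pdivrMr//; apply: (le_trans ED).
by rewrite /a mulrA mulrCA mulrV ?mulr1// unitfE gt_eqF.
Qed.

Section error_terms.
Context {R : realType}.
Variables (n : nat) (A : 'M[R]_n) (q : 'cV[R]_n) (lambda : R).
Hypothesis hq : \sum_i q i 0 ^+ 2 = 1.

Local Notation err := (Err A lambda q).
Local Notation e2 := (l2norm (A *m q - lambda *: q)).

Lemma l2norm_eps : e2 ^+ 2 = \sum_i (mv A (fun j => q j 0) i - lambda * q i 0) ^+ 2.
Proof.
rewrite /l2norm sqr_sqrtr; last by apply: sumr_ge0 => i _; exact: sqr_ge0.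
by apply: eq_bigr => i _; rewrite !mxE.
Qed.

Lemma linfnorm_ge i : `|q i 0| <= linfnorm q.
Proof. exact: le_bigmax. Qed.

Lemma linfnorm_gt0 : 0 < linfnorm q.
Proof.
rewrite lt_neqAle; apply/andP; split; last exact: bigmax_ge_id.
apply/negP => /eqP h; have := hq; rewrite big1 => [/eqP|i _]; first by rewrite eq_sym oner_eq0.
have := linfnorm_ge i; rewrite -h normr_le0 => /eqP ->; exact: expr0n.
Qed.

Let a0 := alpha_ge0 A.

Lemma Err_ge : [/\ Num.sqrt (alpha A) <= err, Num.sqrt n%:R * alpha A <= err,
  e2 <= err & linfnorm q <= err].
Proof.
have h1 := sqrtr_ge0 (alpha A).
have h2 : 0 <= Num.sqrt n%:R * alpha A by rewrite mulr_ge0.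
have h3 : 0 <= e2 by exact: sqrtr_ge0.
have h4 := ltW linfnorm_gt0; rewrite /Err.
by move: (Num.sqrt (alpha A)) (Num.sqrt n%:R * _) e2 (linfnorm q) h1 h2 h3 h4 => x y z w *; split; lra.
Qed.

Lemma Err_gt0 : 0 < err.
Proof. by apply: lt_le_trans linfnorm_gt0 _; case: Err_ge. Qed.

Lemma Err_sqr : [/\ alpha A <= err ^+ 2, n%:R * alpha A ^+ 2 <= err ^+ 2,
  e2 ^+ 2 <= err ^+ 2 & linfnorm q ^+ 2 <= err ^+ 2].
Proof.
have e0 := ltW Err_gt0; have [h1 h2 h3 h4] := Err_ge; split.
- by rewrite -[leLHS]sqr_sqrtr//; apply: lerXn2r => //; rewrite nnegrE sqrtr_ge0.
- rewrite (_ : _ * _ = (Num.sqrt n%:R * alpha A) ^+ 2); last by rewrite exprMn sqr_sqrtr.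
  by apply: lerXn2r => //; rewrite nnegrE mulr_ge0.
- by apply: lerXn2r => //; rewrite nnegrE sqrtr_ge0.
- by apply: lerXn2r => //; rewrite nnegrE ltW// linfnorm_gt0.
Qed.

End error_terms.

Section conditional_distance.
Context {R : realType}.
Local Notation RR := (measurableTypeR R).
Variables (mu F : probability RR R) (n : nat) (A : 'M[R]_n) (rho : R).
Hypothesis hrho : 0 < rho < 1.
Hypothesis cA : coupling A.
Hypothesis oA : opnorm4 A <= rho.
Variables (q : 'cV[R]_n) (lambda ups : R).
Hypothesis hl : `|lambda| <= rho.
Hypothesis hups : 0 < ups <= 1.
Hypothesis hq : \sum_i q i 0 ^+ 2 = 1.
Hypothesis m0 : \int[F]_z m1 mu z = 0.
Hypothesis hv : \int[F]_z tvar mu z = ups.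
Local Notation cfg := (n.-tuple RR).
Local Notation EF := (Ex (iid F n) (fun=> 1)).
Local Notation W := (weight1 (iid F n)).
Local Notation err := (Err A lambda q).
Local Notation theta := (1 - lambda * ups).
Local Notation sd := (Num.sqrt (ups / theta)).
Local Notation kap := ((1 - rho)^-1).
Let isd : R := (Num.sqrt (ups / 2))^-1.

Definition KS_const : R := 1 + stein_const kap ups * (33 + 32 * kap ^+ 4).

Let rho01 : 0 < rho /\ rho < 1. Proof. by apply/andP. Qed.
Let kap0 : 0 < kap. Proof. by rewrite invr_gt0 subr_gt0; case: rho01. Qed.
Let th0 : 0 < theta. Proof. by eapply theta_gt0; eassumption. Qed.
Let sd0 : 0 < sd. Proof. by eapply sd_gt0; eassumption. Qed.
Let stein0 : 0 <= stein_const kap ups. Proof. by eapply stein_const_ge0; eassumption. Qed.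

(** 1 - lambda ups <= 2, so [isd] bounds 1 / sd by a quantity free of [lambda]. *)
Lemma isd_ge : sd^-1 <= isd.
Proof.
have /andP[u0 u1] := hups.
rewrite lef_pV2 ?posrE ?sqrtr_gt0// ?divr_gt0// ler_sqrt; last by rewrite ltW// divr_gt0.
rewrite ler_wpM2l ?(ltW u0)// lef_pV2 ?posrE//.
have := hl; rewrite ler_norml => /andP[l1 _].
have h : - lambda * ups <= 1 * 1.
  apply: (le_trans (y := 1 * ups)); last by rewrite ler_wpM2l.
  by rewrite ler_wpM2r ?(ltW u0)//; case: rho01 => p0 p1; lra.
by rewrite mulNr in h; lra.
Qed.

(* The trivial bound by [1] covers [err > 1], where the Stein bound is not available. *)
Lemma KS_pointwise c t b :
  `|cond_cdf mu A q c (t + b) - Phi (t / sd)| <=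
  KS_const * (err + noise mu A q ups c / err) +
  normal_peak 1 * isd * `|\sum_i q i 0 * mf_fixpoint mu A c i - b|.
Proof.
set dl := \sum_i _ - b.
have e0 := Err_gt0 A lambda hq.
have n0 : 0 <= noise mu A q ups c by exact: noise_ge0.
have ne0 : 0 <= noise mu A q ups c / err by rewrite divr_ge0// ltW.
have p0 : 0 <= normal_peak 1 * isd * `|dl|.
  by rewrite !mulr_ge0// ?normal_peak_ge0// invr_ge0 sqrtr_ge0.
have K0 : 0 <= stein_const kap ups * (33 + 32 * kap ^+ 4).
  by rewrite mulr_ge0// addr_ge0// mulr_ge0// exprn_ge0// ltW.
have [e1|e1] := leP err 1; last first.
  apply: (@le_trans _ _ 1).
    have := cond_cdf_le1 mu A q c (t + b); have := cond_cdf_ge0 mu A q c (t + b).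
    have := Phi_ge0 (t / sd); have := Phi_le1 (t / sd).
    by move: (cond_cdf _ _ _ _ _) (Phi _) => x y *; rewrite ler_norml; apply/andP; split; lra.
  rewrite -[leLHS]addr0; apply: lerD => //; rewrite -[leLHS]mul1r; apply: ler_pM => //.
    by rewrite /KS_const lerDl.
  by apply: (le_trans (ltW e1)); rewrite lerDl.
have [s1 s2 s3 s4] := Err_sqr A lambda hq; have [r1 r2 r3 r4] := Err_ge A lambda hq.
(* The Stein bound is centred at q'u; evaluating it at t - dl changes the centring to b, and the
   Lipschitz bound for Phi pays for dl. *)
have h := @cond_cdf_normal R mu n A rho hrho cA oA q lambda ups hl hups hq c err (t - dl)
  (fun i => le_trans (linfnorm_ge q i) r4) e0 e1 s1 s2.
rewrite l2norm_eps in s3; have {}h := h s3.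
have e : t - dl + \sum_i q i 0 * mf_fixpoint mu A c i = t + b by rewrite /dl; ring.
rewrite e in h.
have h2 : `|Phi ((t - dl) / sd) - Phi (t / sd)| <= normal_peak 1 * isd * `|dl|.
  have pp (x : R) : `|phi1 x| <= normal_peak 1 by rewrite gtr0_norm ?phi1_gt0// phi1_le_peak.
  have h' := derive_bounded_lipschitz Phi_derive pp (t / sd) ((t - dl) / sd); apply: (le_trans h').
  rewrite -mulrBl addrAC subrr add0r normrM normrN -mulrA ler_wpM2l ?normal_peak_ge0//.
  rewrite mulrC ler_wpM2r// gtr0_norm ?invr_gt0//; exact: isd_ge.
have h3 : stein_const kap ups * (33 * err + 32 * kap ^+ 4 * (noise mu A q ups c / err)) <=
    KS_const * (err + noise mu A q ups c / err).
  have k4 : 0 <= kap ^+ 4 by rewrite exprn_ge0// ltW.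
  rewrite /KS_const; move: (noise _ _ _ _ _ / err) ne0 (kap ^+ 4) k4 (stein_const _ _) stein0 => x x0 k k0 s s0.
  have e0' := ltW e0; move: (Err _ _ _) e0' => y y0.
  rewrite -subr_ge0 (_ : _ - _ = y + x + s * (33 * x + 32 * k * y)); last by ring.
  apply: addr_ge0; first exact: addr_ge0.
  by apply: mulr_ge0 => //; apply: addr_ge0; apply: mulr_ge0 => //; exact: mulr_ge0.
rewrite -(subrKA (Phi ((t - dl) / sd))); apply: le_trans (ler_normD _ _) _.
by apply: lerD => //; exact: le_trans h3.
Qed.

Lemma E_noise_le : EF (noise mu A q ups) <= 30 * err ^+ 2.
Proof.
have [s1 s2 s3 s4] := Err_sqr A lambda hq.
have b1 := BM_noise2 mu A q ups; have b2 := BMX 2 (BM_diag_noise mu q ups (n := n)).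
have b3 := BM_mean4 mu A.
rewrite (ExD W (BMD b1 b2) b3) (ExD W b1 b2).
have h1 : EF (noise2 mu A q ups) <= 2 * alpha A by exact: E_noise2.
have h2 : EF (fun c => diag_noise mu q ups c ^+ 2) <= 2 * linfnorm q ^+ 2.
  by apply: E_diag_noise => // i; exact: linfnorm_ge.
have h3 : EF (mean4 mu A) <= 26 * (n%:R * alpha A ^+ 2) by exact: E_mean4.
have aux (a b d x y z e : R) : x <= e -> y <= e -> z <= e -> a <= 2 * x -> b <= 2 * z ->
    d <= 26 * y -> a + b + d <= 30 * e by move=> *; lra.
exact: aux s1 s2 s4 h1 h2 h3.
Qed.

Let err' : R := err + Num.sqrt (n%:R * alpha A) * l2norm (A *m q - lambda *: q).
Let Kp : R := normal_peak 1 * isd.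
Let k_shift : R := kap * (12 + 3 * kap ^+ 2 + 52 * kap ^+ 4).
Let Da (c : cfg) : R := KS_const * (err + noise mu A q ups c / err).
Let Db (c : cfg) : R := Da c + Kp * `|mf_shift mu A q lambda ups c|.

(** 31 = 1 + 30 from err + E[noise] / err; the second term pays for the change of centring, and is
    kept for the mean-field centring so that both claims share one constant. *)
Definition OP_const : R := 31 * KS_const + Kp * k_shift.

Let isd0 : 0 < isd.
Proof. by rewrite invr_gt0 sqrtr_gt0 divr_gt0//; case/andP: hups. Qed.
Let Kp0 : 0 <= Kp. Proof. by rewrite mulr_ge0 ?normal_peak_ge0// ltW. Qed.
Let k_shift0 : 0 <= k_shift.
Proof.
apply: mulr_ge0; first exact: ltW.
by rewrite !addr_ge0// mulr_ge0// exprn_ge0// ltW.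
Qed.
Let KS0 : 0 < KS_const.
Proof.
by rewrite ltr_pwDl// mulr_ge0// addr_ge0// mulr_ge0// exprn_ge0// ltW.
Qed.

Let e0 : 0 < err. Proof. exact: Err_gt0. Qed.
Let err'_ge : err <= err'.
Proof. by rewrite lerDl mulr_ge0 ?sqrtr_ge0. Qed.

Let BDa : BM Da.
Proof.
apply: BMM; first exact: BM_cst; apply: BMD; first exact: BM_cst.
by apply: BMM; [exact: BM_noise | exact: BM_cst].
Qed.

Let BDb : BM Db.
Proof.
apply: BMD => //; apply: BMM; first exact: BM_cst; apply: BM_norm.
by eapply BM_mf_shift; eassumption.
Qed.

Let EDa : EF Da <= 31 * KS_const * err.
Proof.
have Bn : BM (noise mu A q ups) by exact: BM_noise.
have Bi : BM (fun c => noise mu A q ups c / err) by apply: BMM => //; exact: BM_cst.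
rewrite (ExZ W _ (BMD (BM_cst _ _) Bi)) (ExD W (BM_cst _ _) Bi) (Ex_cst W) (ExZr W _ Bn).
rewrite (mulrC 31) -mulrA; apply: ler_wpM2l; first exact: ltW.
rewrite (_ : 31 * err = err + 30 * err ^+ 2 / err); last by field; rewrite gt_eqF.
by rewrite lerD2l ler_wpM2r ?invr_ge0 ?(ltW e0)//; exact: E_noise_le.
Qed.

Let EDb : EF Db <= OP_const * err'.
Proof.
have Bs : BM (mf_shift mu A q lambda ups) by eapply BM_mf_shift; eassumption.
have Bn := BM_norm Bs.
rewrite (ExD W BDa (BMM (BM_cst _ _) Bn)) (ExZ W _ Bn) /OP_const [leRHS]mulrDl; apply: lerD.
  apply: (le_trans EDa); apply: ler_wpM2l err'_ge; rewrite mulr_ge0// ltW//.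
rewrite -[leRHS]mulrA; apply: ler_wpM2l; first exact: Kp0.
have [s1 s2 s3 s4] := Err_sqr A lambda hq; have [r1 r2 r3 r4] := Err_ge A lambda hq.
have e'0 : 0 < err' by exact: lt_le_trans err'_ge.
have ee : err ^+ 2 <= err' ^+ 2 by rewrite lerXn2r ?nnegrE ?(ltW e0) ?(ltW e'0).
have ep : \sum_i eps A q lambda i ^+ 2 = l2norm (A *m q - lambda *: q) ^+ 2 by rewrite l2norm_eps.
apply: E_mf_shift => //.
- by rewrite ep; exact: le_trans ee.
- have na : 0 <= n%:R * alpha A by rewrite mulr_ge0// alpha_ge0.
  rewrite ep -[X in _ * X]sqr_sqrtr// -exprMn mulrC; apply: lerXn2r.
  + by rewrite nnegrE mulr_ge0 ?sqrtr_ge0.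
  + by rewrite nnegrE ltW.
  + by rewrite /err' lerDr ltW.
- exact: le_trans ee.
- exact: le_trans err'_ge.
Qed.

Lemma OP_const_gt0 : 0 < OP_const.
Proof. by apply: ltr_wpDr; [exact: mulr_ge0 | exact: mulr_gt0]. Qed.

Lemma measurable_KS (b : cfg -> R) : measurable_fun setT b ->
  measurable_fun setT (fun c => sup_dist (fun t => cond_cdf mu A q c (t + b c)) (fun t => Phi (t / sd))).
Proof.
move=> mb; apply: (measurable_sup_dist (G := fun c t => cond_cdf mu A q c (t + b c))).
- move=> t; case: (@BM_cond_cdf R mu n A q (fun c => t + b c)) => //.
  by apply: measurable_funD => //; exact: measurable_cst.
- by move=> c x y xy; apply: cond_cdf_mono; rewrite lerD2r.
- move=> c t; have := cond_cdf_le1 mu A q c (t + b c); have := cond_cdf_ge0 mu A q c (t + b c).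
  have := Phi_ge0 (t / sd); have := Phi_le1 (t / sd).
  by move: (cond_cdf _ _ _ _ _) (Phi _) => x y *; rewrite ler_norml; apply/andP; split; lra.
- move=> t; apply: (@continuous_comp _ _ _ (fun t : R => t / sd) (@Phi R)); last exact: continuous_Phi.
  by apply: cvgMl; exact: cvg_id.
Qed.

Let sup0 (b : cfg -> R) c B : (forall t, `|cond_cdf mu A q c (t + b c) - Phi (t / sd)| <= B) ->
  0 <= sup_dist (fun t => cond_cdf mu A q c (t + b c)) (fun t => Phi (t / sd)) <= B.
Proof. by move=> h; rewrite (sup_dist_ge0 h) sup_dist_le. Qed.

Lemma OP_mean_field :
  OP_with (iid F n) (fun delta => OP_const / delta)
    (fun c => sup_dist (fun t => cond_cdf mu A q c (t + \sum_i q i 0 * mf_fixpoint mu A c i))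
                       (fun t => Phi (t / sd))) err.
Proof.
apply: (markov_OP (D := Da)) => //.
- apply: measurable_KS; apply: measurable_sum => i; apply: measurable_funM; first exact: measurable_cst.
  by case: (BM_mf_fixpoint mu hrho cA oA i).
- move=> c; apply: (sup0 (b := fun c => \sum_i q i 0 * mf_fixpoint mu A c i)) => t.
  by apply: (le_trans (KS_pointwise c t _)); rewrite subrr normr0 mulr0 addr0.
- apply: (le_trans EDa); rewrite ler_wpM2r ?(ltW e0)// /OP_const lerDl mulr_ge0//.
- exact: OP_const_gt0.
Qed.

Let ctr (c : cfg) := \sum_i q i 0 * (m1 mu (tnth c i) / theta).

Let mctr : measurable_fun setT ctr.
Proof.
apply: measurable_sum => i; apply: measurable_funM; first exact: measurable_cst.
apply: measurable_funM; last exact: measurable_cst.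
apply: (measurableT_comp (f := m1 mu)); last exact: measurable_tnth.
by apply: continuous_measurable_fun; exact: continuous_m1.
Qed.

Let KS_ctr c t : `|cond_cdf mu A q c (t + ctr c) - Phi (t / sd)| <= Db c.
Proof. exact: KS_pointwise. Qed.

Lemma OP_centered :
  OP_with (iid F n) (fun delta => OP_const / delta)
    (fun c => sup_dist (fun t => cond_cdf mu A q c (t + ctr c)) (fun t => Phi (t / sd))) err'.
Proof.
apply: (markov_OP (D := Db)) => //.
- exact: measurable_KS.
- by move=> c; apply: (sup0 (b := ctr)) => t; exact: KS_ctr.
- exact: OP_const_gt0.
- exact: lt_le_trans err'_ge.
Qed.

Let M : R := kap * isd.
Definition averaged_const : R := OP_const + gaussB * (M ^+ 3 + 2 * M ^+ 4).

Lemma averaged_normal (S2 t : R) : \int[F]_z m1 mu z ^+ 2 = S2 ->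
  `|EF (fun c => cond_cdf mu A q c t) - Phi (t / Num.sqrt (ups / theta + S2 / theta ^+ 2))| <=
  averaged_const * err'.
Proof.
move=> hS2; pose g (z : RR) := m1 mu z / theta.
have Bm : BM (m1 mu : RR -> R).
  split; last by exists 1; exact: m1_norm.
  by apply: continuous_measurable_fun; exact: continuous_m1.
have Bg : BM g by apply: BMM => //; exact: BM_cst.
have tk : theta^-1 <= kap.
  rewrite lef_pV2 ?posrE// ?subr_gt0; last by case: rho01.
  by eapply theta_ge; eassumption.
have gk z : `|g z| <= kap.
  rewrite /g normrM (ger0_norm (x := theta^-1)) ?invr_ge0 ?(ltW th0)//.
  by apply: le_trans tk; rewrite ler_piMl ?m1_norm// invr_ge0 ltW.
have g0 : \int[F]_z g z = 0.
  by rewrite -Ex_weight1 (ExZr (weight1 F) _ Bm) Ex_weight1 m0 mul0r.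
have g2 : \int[F]_z g z ^+ 2 = S2 / theta ^+ 2.
  have e z : g z ^+ 2 = m1 mu z ^+ 2 * (theta ^+ 2)^-1 by rewrite /g expr_div_n.
  by rewrite -Ex_weight1 (eq_Ex _ _ e) (ExZr (weight1 F) _ (BMX 2 Bm)) Ex_weight1 hS2.
have V0 : 0 < ups / theta by rewrite divr_gt0//; case/andP: hups.
have := lindeberg Bg gk g0 g2 V0 (fun i => q i 0) t (lexx _); rewrite hq mulr1 => L.
have BP : BM (fun c : cfg => Phi ((t - \sum_i q i 0 * g (tnth c i)) / sd)) by exact: BM_Phi_lin.
have BC : BM (fun c : cfg => cond_cdf mu A q c t) by apply: (BM_cond_cdf mu A q (tau := fun=> t)); exact: measurable_cst.
have h1 : `|EF (fun c => cond_cdf mu A q c t) - EF (fun c => Phi ((t - \sum_i q i 0 * g (tnth c i)) / sd))|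
    <= OP_const * err'.
  rewrite -(ExB W BC BP); apply: (le_trans (Ex_norm W (BMB BC BP))); apply: le_trans EDb.
  apply: (Ex_le W) => // [|c]; first by apply: BM_norm; exact: BMB.
  have := KS_ctr c (t - ctr c); rewrite subrK; exact.
have [r1 r2 r3 r4] := Err_ge A lambda hq.
have M0 : 0 <= M by rewrite mulr_ge0// ltW.
(* Since |q_i| is at most 1 and at most [err'], powers three and four of |q_i| are at most err'
   q_i^2, which sums to [err']. *)
have h2 : \sum_i lindeberg_err kap (q i 0 / sd) <= gaussB * (M ^+ 3 + 2 * M ^+ 4) * err'.
  apply: (le_trans (y := \sum_i gaussB * (M ^+ 3 + 2 * M ^+ 4) * err' * q i 0 ^+ 2)); last first.
    by rewrite -mulr_sumr hq mulr1.
  apply: ler_sum => i _; rewrite /lindeberg_err -(mulrA _ err') -(mulrA gaussB).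
  apply: ler_wpM2l.
    by apply: mulr_ge0 => //; exact: normal_peak_ge0.
  have x1 : `|q i 0| <= err' by exact: le_trans (le_trans (linfnorm_ge q i) r4) err'_ge.
  have x2 : `|q i 0| <= 1.
    rewrite -(expr_le1 (n := 2))// real_normK ?num_real// -hq.
    exact: (sum_sqr_le_max (fun i => q i 0)).
  have bM : `|q i 0 / sd| * kap <= `|q i 0| * M.
    rewrite normrM (ger0_norm (x := sd^-1)) ?invr_ge0 ?(ltW sd0)// -mulrA ler_wpM2l//.
    by rewrite mulrC ler_wpM2l ?isd_ge// ltW.
  have b0 : 0 <= `|q i 0 / sd| * kap by rewrite mulr_ge0// ltW.
  have h3 : (`|q i 0 / sd| * kap) ^+ 3 <= (`|q i 0| * M) ^+ 3.
    by apply: lerXn2r => //; rewrite nnegrE mulr_ge0.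
  have h4 : (`|q i 0 / sd| * kap) ^+ 4 <= (`|q i 0| * M) ^+ 4.
    by apply: lerXn2r => //; rewrite nnegrE mulr_ge0.
  rewrite -[X in _ <= _ * (_ * X)]real_normK ?num_real//.
  have M3 := exprn_ge0 3 M0; have M4 := exprn_ge0 4 M0; have x0 := normr_ge0 (q i 0).
  rewrite (exprMn 3 `|q i 0|) in h3; rewrite (exprMn 4 `|q i 0|) in h4.
  have c3 : `|q i 0| ^+ 3 * M ^+ 3 <= M ^+ 3 * (err' * `|q i 0| ^+ 2).
    by rewrite mulrC ler_wpM2l// exprS ler_wpM2r// exprn_ge0.
  have c4 : `|q i 0| ^+ 4 * M ^+ 4 <= M ^+ 4 * (err' * `|q i 0| ^+ 2).
    rewrite mulrC ler_wpM2l// (_ : _ ^+ 4 = `|q i 0| * `|q i 0| * `|q i 0| ^+ 2); last by ring.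
    by rewrite ler_wpM2r ?exprn_ge0//; apply: le_trans x1; rewrite ler_piMl.
  rewrite [leRHS]mulrDl -(mulrA 2 (M ^+ 4)); apply: lerD; first exact: le_trans h3 c3.
  by apply: ler_wpM2l => //; exact: le_trans h4 c4.
rewrite /averaged_const mulrDl; apply: le_trans (lerD h1 (le_trans L h2)).
rewrite -Ex_weight1; move: (Ex _ _ _) (Ex _ _ _) (Phi _) => y x z.
by rewrite -(subrKA y); exact: ler_normD.
Qed.

End conditional_distance.

(** Positivity: if the integral of psi'' vanished, psi'' would be 0 almost everywhere under F, yet
    it is positive everywhere. *)
Lemma expectation_variance_bounds (R : realType) (mu F : probability (measurableTypeR R) R) (ups : R) :
  base_measure mu -> ('E_F[psi2 mu] = ups%:E)%E -> \int[F]_z tvar mu z = ups /\ 0 < ups <= 1.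
Proof.
move=> bmu; rewrite (psi2E bmu) unlock => h.
have BT : BM (fun z : measurableTypeR R => tvar mu z).
  split; last by exists 1; exact: tvar_norm.
  exact: (continuous_measurable_fun (@continuous_tvar R mu)).
have e : \int[F]_z tvar mu z = ups by rewrite /Rintegral h.
split=> //; apply/andP; split; last first.
  by rewrite -e -Ex_weight1; apply: (Ex_le_cst (weight1 F)) => // z; exact: tvar_le1.
have u0 : 0 <= ups by rewrite -e; apply: Rintegral_ge0 => z _; exact: tvar_ge0.
rewrite lt_neqAle u0 andbT; apply/negP => /eqP u00.
have /ae_eq_integral_abs : measurable_fun [set: measurableTypeR R] (fun z : measurableTypeR R => (tvar mu z)%:E).
  by apply/measurable_EFinP; case: BT.
move=> /(_ F measurableT) [+ _].
under eq_integral do rewrite /= ger0_norm ?tvar_ge0//.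
rewrite h -u00 => /(_ erefl) [N [mN N0 sub]].
have NT : N = setT.
  apply/seteqP; split => // z _; apply: sub => /= hz.
  by have := hz I => -[] /eqP; rewrite gt_eqF// tvar_gt0.
have := probability_setT F; rewrite -NT => FN.
by have := etrans (esym FN) N0 => /eqP; rewrite onee_eq0.
Qed.

Theorem theorem2p6 (R : realType) (rho upsilon : R) (hrho : 0 < rho < 1) :
  exists (C : R -> R) (K : R),
  forall (mu F : probability (measurableTypeR R) R) (lambda : R) (n : nat)
         (A : 'M[R]_n) (q : 'cV[R]_n),
    base_measure mu ->
    ('E_F[psi1 mu] = 0)%E ->
    ('E_F[psi2 mu] = upsilon%:E)%E ->
    `|lambda| <= rho ->
    coupling A ->
    opnorm4 A <= rho ->
    l2norm q = 1 ->
    let err := Err A lambda q in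
    let err' := err + Num.sqrt (n%:R * alpha A) * l2norm (A *m q - lambda *: q) in
    let W := gauss (upsilon / (1 - lambda * upsilon)) in
    let W' := gauss (fine ('E_F[fun x => (psi1 mu x ^+ 2)%R])%E
                    / (1 - lambda * upsilon) ^+ 2) in
    [/\ OP_with (iid F n) C
          (fun c => dKS (cond_law mu A c (fun s => dot q (s - mf_opt mu A c))) W)
          err,
        OP_with (iid F n) C
          (fun c => dKS (cond_law mu A c
             (fun s => \sum_(i < n) q i 0 *
                (s i 0 - psi1 mu (tnth c i) / (1 - lambda * upsilon)))) W)
          err' &
        dKS (averaged_law mu A F (fun s => dot q s)) (convolution W W')
          <= K * err'].
Proof.
(* The tail constant K / delta is the one produced by Markov's inequality. *)
exists (fun delta => OP_const rho upsilon / delta), (averaged_const rho upsilon).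
move=> mu F lambda n A q bmu m0 v0 hl cA oA hq err err' W W'.
have [hv hups] := expectation_variance_bounds bmu v0.
have /andP[u0 u1] := hups.
have {}m0 : \int[F]_z m1 mu z = 0 by move: m0; rewrite (psi1E bmu) unlock /Rintegral => ->.
have {}hq : \sum_i q i 0 ^+ 2 = 1.
  move: hq => /(congr1 (fun x => x ^+ 2)); rewrite expr1n /l2norm sqr_sqrtr//.
  by apply: sumr_ge0 => i _; exact: sqr_ge0.
have th0 : 0 < 1 - lambda * upsilon by eapply theta_gt0; eassumption.
have WE t : fine (W [set` `]-oo, t]]) = Phi (t / Num.sqrt (upsilon / (1 - lambda * upsilon))).
  by rewrite gauss_cdf// divr_gt0.
split.
- have -> : (fun c => dKS (cond_law mu A c (fun s => dot q (s - mf_opt mu A c))) W) =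
    fun c => sup_dist (fun t => cond_cdf mu A q c (t + \sum_i q i 0 * mf_fixpoint mu A c i))
                      (fun t => Phi (t / Num.sqrt (upsilon / (1 - lambda * upsilon)))).
    apply/funext => c; apply: dKSE => // t.
    apply: cond_law_affine => // z.
    rewrite (mf_opt_fixed_point bmu hrho cA oA (mf_fixpointE mu hrho cA oA c)).
    by rewrite /dot -sumrB; apply: eq_bigr => i _; rewrite !mxE mulrBr.
  by eapply OP_mean_field; eassumption.
- have -> : (fun c => dKS (cond_law mu A c (fun s => \sum_(i < n) q i 0 *
      (s i 0 - psi1 mu (tnth c i) / (1 - lambda * upsilon)))) W) =
    fun c => sup_dist (fun t => cond_cdf mu A q c (t + \sum_i q i 0 * (m1 mu (tnth c i) / (1 - lambda * upsilon))))
                      (fun t => Phi (t / Num.sqrt (upsilon / (1 - lambda * upsilon)))).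
    apply/funext => c; apply: dKSE => // t.
    apply: cond_law_affine => // z.
    by rewrite /dot -sumrB (psi1E bmu); apply: eq_bigr => i _; rewrite mulrBr.
  by eapply OP_centered; eassumption.
- apply: dKS_le => t.
  have S20 : 0 <= \int[F]_z m1 mu z ^+ 2 by apply: Rintegral_ge0 => z _; exact: sqr_ge0.
  have S2E : fine ('E_F[fun x => (psi1 mu x ^+ 2)%R])%E = \int[F]_z m1 mu z ^+ 2.
    by rewrite (psi1E bmu) unlock.
  rewrite convolution_gauss_gauss; [|exact: divr_gt0|by rewrite S2E divr_ge0// sqr_ge0].
  have -> : fine (averaged_law mu A F (fun s => dot q s) [set` `]-oo, t]]) =
      Ex (iid F n) (fun=> 1) (fun c => cond_cdf mu A q c t).
    rewrite Ex_weight1 /averaged_law /Rintegral; congr fine; apply: eq_integral => c _.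
    by rewrite (@cond_law_affine _ _ _ _ q bmu c _ 0)// => [|z]; rewrite ?addr0 ?subr0.
  rewrite S2E; eapply averaged_normal; by [eassumption|].
Qed.
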